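(* Let $q\in(-1,0)\cup(0,1)$. For every compactly supported probability measure $\mu$ on $\mathbb{R}$ there exist unique compactly supported probability measures $\nu$ and $\lambda$ on $\mathbb{R}$ such that \[ 1-G_\mu(z)=(1-qG_\nu(z))^{1/q}\qquad\text{and}\qquad 1+G_\mu(z-1)=(1-qG_\lambda(z))^{-1/q} \] for all $z\in\mathbb{C}$ with $|z|$ large enough (principal branches, equal to $1$ at $G=0$). The maps $\mathfrak P:\mu\mapsto\nu$ and $\mathfrak Q:\mu\mapsto\lambda$ are injective, and for all compactly supported probability measures $\nu_1,\nu_2$ the measures $\mathfrak P(\nu_1)\otimes_q\mathfrak P(\nu_2)$ and $\mathfrak Q(\nu_1)\otimes_q\mathfrak Q(\nu_2)$ exist and \[ \mathfrak P(\nu_1\boxplus\nu_2)=\mathfrak P(\nu_1)\otimes_q\mathfrak P(\nu_2),\qquad \mathfrak Q(\nu_1\boxplus\nu_2)=\mathfrak Q(\nu_1)\otimes_q\mathfrak Q(\nu_2). \]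
   Context: $G_\mu(z)=\int\frac{\mu(dt)}{z-t}$ is the Stieltjes transform. For a compactly supported probability measure $\mu$, the free cumulants $\kappa_n(\mu)$ are defined by $\int t^kd\mu=\sum_{\pi\in NC(k)}\prod_{V\in\pi}\kappa_{|V|}(\mu)$ ($NC(k)$ the non-crossing partitions of $\{1,\dots,k\}$) and the $R$-transform is $R_\mu(z)=\sum_{n\ge1}\kappa_n(\mu)z^{n-1}$; $\boxplus$ is free convolution, characterized by $R_{\mu_1\boxplus\mu_2}=R_{\mu_1}+R_{\mu_2}$. Let $e_q(z)=(1-qz)^{-1/q}$ and $\beta(1-q,1+q)$ the beta distribution with parameters $1-q,1+q$, whose $R$-transform is $R_{\beta(1-q,1+q)}(z)=\frac{e_q(z)}{e_q(z)-1}-\frac1z$. The $q$-deformed quantized $R$-transform is $R^{quant(q)}_\mu=R_\mu-R_{\beta(1-q,1+q)}$, and for compactly supported probability measures $\rho_1,\rho_2$, $\rho_1\otimes_q\rho_2$ denotes the (unique, if it exists) compactly supported probability measure $\rho$ with $R^{quant(q)}_\rho=R^{quant(q)}_{\rho_1}+R^{quant(q)}_{\rho_2}$. *)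

(* Defs.v *)
From HB Require Import structures.
From mathcomp Require Import all_boot all_order all_algebra.
From mathcomp Require Import all_classical all_reals all_analysis.
From mathcomp Require Import complex.

Set Implicit Arguments.
Unset Strict Implicit.
Unset Printing Implicit Defensive.

Import Order.TTheory GRing.Theory Num.Theory.
Local Open Scope ring_scope.

Section Defs.
Context {R : realType}.

Notation prob := (probability (measurableTypeR R) R).

Definition compact_supp (mu : prob) : Prop :=
  exists M : R, mu ([set x : R | M < `|x|])%classic = 0%E.

Definition meas_eq (mu nu : prob) : Prop :=
  forall A : set R, measurable A -> mu A = nu A.

Definition cabs (z : R[i]) : R :=
  Num.sqrt (complex.Re z ^+ 2 + complex.Im z ^+ 2).

Definition stieltjes (mu : prob) (z : R[i]) : R[i] :=
  Complex (Rintegral mu setT (fun t : R => complex.Re ((z - Complex t 0)^-1)))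
          (Rintegral mu setT (fun t : R => complex.Im ((z - Complex t 0)^-1))).

(** principal argument, with values in (-pi, pi] (Arg 0 = 0) *)
Definition Arg (w : R[i]) : R :=
  let x := complex.Re w in let y := complex.Im w in
  if 0 < x then atan (y / x)
  else if x < 0 then (if 0 <= y then atan (y / x) + pi else atan (y / x) - pi)
  else if 0 < y then pi / 2 else if y < 0 then - (pi / 2) else 0.

(** principal power w^a = exp(a Log w), Log w = ln|w| + i Arg w, for real a
    (for w = 0 and a <> 0 this gives 0) *)
Definition cpow (w : R[i]) (a : R) : R[i] :=
  Complex (powR (cabs w) a * cos (a * Arg w))
          (powR (cabs w) a * sin (a * Arg w)).

Definition moment (mu : prob) (k : nat) : R :=
  Rintegral mu setT (fun t : R => t ^+ k).

Definition noncrossing n (P : {set {set 'I_n}}) : bool :=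
  [forall V in P, forall W in P, (V != W) ==>
     ~~ [exists a : 'I_n, exists b : 'I_n, exists c : 'I_n, exists d : 'I_n,
          [&& (a < b)%N, (b < c)%N, (c < d)%N, a \in V, c \in V, b \in W & d \in W]]].

Definition NC n (P : {set {set 'I_n}}) : bool :=
  finset.partition P [set: 'I_n] && noncrossing P.

(** free cumulants of a moment sequence m, defined by the moment-cumulant
    formula m_n = \sum_{pi in NC(n)} \prod_{V in pi} kappa_{|V|} (n >= 1),
    solved recursively: kseq m n = [:: 0; kappa_1; ...; kappa_n]. *)
Fixpoint kseq (m : nat -> R) (n : nat) : seq R :=
  match n with
  | 0 => [:: 0]
  | n'.+1 =>
      let L := kseq m n' in
      rcons L (m n'.+1 -
        \sum_(P : {set {set 'I_n'.+1} } | NC P && (P != [set [set: 'I_n'.+1]]))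
           \prod_(V in P) nth 0 L #|V|)
  end.

Definition free_cumulant_seq (m : nat -> R) (n : nat) : R := nth 0 (kseq m n) n.

Definition free_cumulant (mu : prob) (n : nat) : R :=
  free_cumulant_seq (moment mu) n.

(** beta distribution beta(a,b) with real parameters a, b > 0: density
    x^(a-1)(1-x)^(b-1)/B(a,b) on [0,1] w.r.t. Lebesgue measure; we only need
    its moments. *)
Definition beta_density_unnorm (a b : R) (x : R) : R :=
  powR x (a - 1) * powR (1 - x) (b - 1).

Definition beta_moment (a b : R) (k : nat) : R :=
  Rintegral lebesgue_measure `[0%R, 1%R] (fun x : R => x ^+ k * beta_density_unnorm a b x)
  / Rintegral lebesgue_measure `[0%R, 1%R] (beta_density_unnorm a b).

Definition beta_cumulant (q : R) (n : nat) : R :=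
  free_cumulant_seq (beta_moment (1 - q) (1 + q)) n.

(** rho = nu1 ⊞ nu2 : R_rho = R_nu1 + R_nu2, i.e. equality of all
    coefficients kappa_n, n >= 1, of the R-transforms *)
Definition is_free_conv (rho nu1 nu2 : prob) : Prop :=
  forall n : nat, (0 < n)%N ->
    free_cumulant rho n = free_cumulant nu1 n + free_cumulant nu2 n.

(** rho = rho1 ⊗_q rho2 : R^quant(q)_rho = R^quant(q)_rho1 + R^quant(q)_rho2,
    coefficientwise, with R^quant(q)_mu = R_mu - R_beta(1-q,1+q). *)
Definition is_qconv (q : R) (rho rho1 rho2 : prob) : Prop :=
  forall n : nat, (0 < n)%N ->
    free_cumulant rho n - beta_cumulant q n =
      (free_cumulant rho1 n - beta_cumulant q n)
      + (free_cumulant rho2 n - beta_cumulant q n).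

Definition P_rel (q : R) (mu nu : prob) : Prop :=
  exists r : R, forall z : R[i], r < cabs z ->
    1 - stieltjes mu z = cpow (1 - Complex q 0 * stieltjes nu z) (1 / q).

Definition Q_rel (q : R) (mu lam : prob) : Prop :=
  exists r : R, forall z : R[i], r < cabs z ->
    1 + stieltjes mu (z - 1) = cpow (1 - Complex q 0 * stieltjes lam z) (- (1 / q)).

End Defs.

(* Main.v *)
(* Put u = 1/z and g_mu(u) = sum_n m_n(mu) u^(n+1) = G_mu(1/u).  The first relation
   reads g_nu = phi o g_mu with phi(w) = (1 - (1 - w)^q) / q.  From the equation
   (1 - w) phi' = 1 - q phi one finds that phi is the series g of beta(1-q, 1+q), so
   nu has to be the monotone convolution of this beta law with mu: its moment sequence
   is positive and grows at most geometrically, and a moment theorem provides nu.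
   Conversely the formal identity q A' B = A B' for A = 1 - g_mu, B = 1 - q g_nu makes
   q Log A - Log B constant along rays, which gives the relation with principal powers
   for large z.

   By the moment-cumulant formula g = u (1 + C(g)) with C(w) = sum_n kappa_n w^n, hence
   C_nu = C_beta + (1 + C_beta) (C_mu o phi^-1).  This is affine in C_mu and gives the
   statements on the q-convolution, once the free convolution of compactly supported
   measures is known to exist; for that, the subordination functions are constructed
   by iteration on formal series, positivity being preserved at each step.

   Finally G of the image of mu under x |-> b - x is -G_mu(b - z), so the second
   relation for (mu, lam) is the first one, with -q in place of q, for the images of mu
   and lam under x |-> -1 - x and x |-> -x. *)
Require Import Defs.
From HB Require Import structures.
From mathcomp Require Import all_boot all_order all_algebra.
From mathcomp Require Import all_classical all_reals all_analysis.
From mathcomp Require Import complex measurable_realfun ring lra zify.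
Set Implicit Arguments.
Unset Strict Implicit.
Unset Printing Implicit Defensive.
Import Order.TTheory GRing.Theory Num.Theory.
Import numFieldNormedType.Exports.
Local Open Scope ring_scope.

(** * Formal power series *)

Section FormalPowerSeries.
Variable R : comNzRingType.

(** Both relations concern large [|z|], and the moments of a compactly supported measure grow at
    most geometrically; so the work is done on coefficients, a measure being a sequence with Hankel
    positivity and geometric growth. Analysis remains where a measure is recovered from such a
    sequence, where the beta density is integrated, and where series are evaluated at [1/z].
    Uniqueness only looks at large positive [z], where the principal power is the real one. The
    obstacle is positivity of a composition [g_s o g_m]: tested on a square, it yields a polynomial
    that is non-negative but not visibly a square, so the outer sequence must be positive on all
    non-negative polynomials. For the sequences coming from [z - a - 1/G] this stronger positivity
    is obtained by realising them as measures. The shift [z - 1] in the second relation matches the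
    cumulants: passing from beta(1-q, 1+q) to beta(1+q, 1-q) by x |-> 1 - x adds 1 to the first
    cumulant, and the reflection x |-> -1 - x of mu contributes the opposite term. Hence the same
    beta law is subtracted in both cases. *)

Definition fps := nat -> R.
HB.instance Definition _ := GRing.Zmodule.copy fps (nat -> R).

Implicit Types (f g h : fps) (p r : {poly R}).

Lemma fpsP f g : f =1 g -> f = g.
Proof. exact: funext. Qed.

Lemma fpsDE f g n : (f + g) n = f n + g n. Proof. by []. Qed.
Lemma fpsNE f n : (- f) n = - f n. Proof. by []. Qed.
Definition fps_one : fps := fun n => (n == 0)%:R.
Definition fps_mul f g : fps := fun n => \sum_(i < n.+1) f i * g (n - i)%N.

(** Congruence modulo [X^N]. Laws of polynomials (associativity, composition, chain rule) pass to
    series because two series are equal as soon as, for each [N], one polynomial is congruent to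
    both. *)
Definition agree N p f := forall i, (i < N)%N -> p`_i = f i.

Definition trunc N f : {poly R} := \poly_(i < N) f i.

Lemma agree_trunc N f : agree N (trunc N f) f.
Proof. by move=> i iN; rewrite coef_poly iN. Qed.

Lemma agree_mul N p r f g : agree N p f -> agree N r g -> agree N (p * r) (fps_mul f g).
Proof.
move=> pf rg i iN; rewrite coefM /fps_mul; apply: eq_bigr => j _.
rewrite pf ?rg //; first exact: leq_ltn_trans (leq_subr _ _) iN.
by apply: leq_trans iN; rewrite ltnS -ltnS.
Qed.

Lemma agree_one N : agree N 1 fps_one.
Proof. by move=> i _; rewrite coef1. Qed.

Lemma agree_eq f g : (forall N, exists p, agree N p f /\ agree N p g) -> f = g.
Proof.
by move=> H; apply: fpsP => n; have [p [pf pg]] := H n.+1; rewrite -pf // pg.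
Qed.

Lemma fps_mulA : associative fps_mul.
Proof.
move=> f g h; apply: agree_eq => N.
exists (trunc N f * (trunc N g * trunc N h)); split.
  by do !apply: agree_mul; exact: agree_trunc.
by rewrite mulrA; do !apply: agree_mul; exact: agree_trunc.
Qed.

Lemma fps_mulC : commutative fps_mul.
Proof.
move=> f g; apply: agree_eq => N; exists (trunc N f * trunc N g); split.
  by do !apply: agree_mul; exact: agree_trunc.
by rewrite mulrC; do !apply: agree_mul; exact: agree_trunc.
Qed.

Lemma fps_mul1 : left_id fps_one fps_mul.
Proof.
move=> f; apply: agree_eq => N; exists (trunc N f); split; last exact: agree_trunc.
by rewrite -[trunc N f]mul1r; apply: agree_mul; [exact: agree_one|exact: agree_trunc].
Qed.

Lemma fps_mulDl : left_distributive fps_mul +%R.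
Proof.
move=> f g h; apply: fpsP => n; rewrite fpsDE /fps_mul -big_split /=.
by apply: eq_bigr => i _; rewrite fpsDE mulrDl.
Qed.

Lemma fps_one_neq0 : fps_one != 0.
Proof. by apply/eqP => /(congr1 (fun f => f 0%N)) /= /eqP; rewrite oner_eq0. Qed.

HB.instance Definition _ := GRing.Zmodule_isComNzRing.Build fps
  fps_mulA fps_mulC fps_mul1 fps_mulDl fps_one_neq0.

Lemma fps1E n : (1 : fps) n = (n == 0)%:R. Proof. by []. Qed.

Lemma fpsME f g n : (f * g) n = \sum_(i < n.+1) f i * g (n - i)%N.
Proof. by []. Qed.

Definition fpsC (c : R) : fps := fun n => if n == 0 then c else 0.
Definition fpsX : fps := fun n => (n == 1)%:R.

Lemma fpsCE c f n : (fpsC c * f) n = c * f n.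
Proof.
rewrite fpsME big_ord_recl /= subn0 big1 ?addr0 // => i _.
by rewrite /fpsC /= mul0r.
Qed.

Lemma fpsC1 : fpsC 1 = 1.
Proof. by apply: fpsP => n; rewrite fps1E /fpsC; case: ifP. Qed.
Lemma fpsCN c : fpsC (- c) = - fpsC c.
Proof. by apply: fpsP => n; rewrite fpsNE /fpsC; case: ifP; rewrite ?oppr0. Qed.
Lemma fpsCM c d : fpsC (c * d) = fpsC c * fpsC d.
Proof. by apply: fpsP => n; rewrite fpsCE /fpsC; case: ifP; rewrite ?mulr0. Qed.

Lemma fpsXE f n : (fpsX * f) n = if n is m.+1 then f m else 0.
Proof.
case: n => [|n].
  by rewrite fpsME big_ord_recl big_ord0 /= mul0r addr0.
rewrite fpsME 2!big_ord_recl /= mul0r add0r mul1r subSS subn0 big1 ?addr0 //.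
by move=> i _; rewrite /fpsX /= mul0r.
Qed.

Lemma fpsX_inj f g : fpsX * f = fpsX * g -> f = g.
Proof.
by move=> fg; apply: fpsP => n; have := congr1 (fun h : fps => h n.+1) fg; rewrite !fpsXE.
Qed.

Lemma fpsXP f : f 0%N = 0 -> f = fpsX * (fun n => f n.+1).
Proof. by move=> f0; apply: fpsP => -[|n]; rewrite fpsXE. Qed.

Lemma fpsM1 f g : (f * g) 1%N = f 0%N * g 1%N + f 1%N * g 0%N.
Proof. by rewrite fpsME 2!big_ord_recl big_ord0 /= addr0. Qed.

Lemma agreeM N p r f g : agree N p f -> agree N r g -> agree N (p * r) (f * g).
Proof. exact: agree_mul. Qed.

Lemma agreeX N p f k : agree N p f -> agree N (p ^+ k) (f ^+ k).
Proof.
move=> pf; elim: k => [|k IH]; first exact: agree_one.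
by rewrite !exprS; apply: agreeM.
Qed.

Lemma fpsX_lt f k n : f 0%N = 0 -> (n < k)%N -> (f ^+ k) n = 0.
Proof.
move=> f0; elim: k n => // k IH n; rewrite ltnS => nk.
rewrite exprS fpsME big_ord_recl f0 mul0r add0r big1 // => i _.
rewrite lift0 IH ?mulr0 //; apply: leq_trans nk.
by have := ltn_ord i; rewrite -ltnS => /= ?; lia.
Qed.

Lemma fps_eq_low f g k n : (forall i, (i <= n)%N -> f i = g i) -> (f ^+ k) n = (g ^+ k) n.
Proof.
move=> fg.
have aT : agree n.+1 (trunc n.+1 f) f by exact: agree_trunc.
have bT : agree n.+1 (trunc n.+1 f) g by move=> i iN; rewrite agree_trunc // fg.
by rewrite -(agreeX k aT) // (agreeX k bT).
Qed.

(** The sum stops at [k = n], which is the true substitution when [g 0 = 0], since then [g ^+ k]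
    starts at degree [k]. This is why that hypothesis accompanies most laws below. *)
Definition fcomp f g : fps := fun n => \sum_(k < n.+1) f k * (g ^+ k) n.

Lemma fcompE f g n N : g 0%N = 0 -> (n < N)%N ->
  fcomp f g n = \sum_(k < N) f k * (g ^+ k) n.
Proof.
move=> g0 nN; rewrite /fcomp.
rewrite (big_ord_widen N (fun k => f k * (g ^+ k) n)) //.
rewrite [RHS](bigID (fun k : 'I_N => (k < n.+1)%N)) /= [X in _ + X]big1 ?addr0 //.
by move=> k; rewrite -leqNgt => kn; rewrite fpsX_lt // mulr0.
Qed.

Lemma agree_comp N p r f g : g 0%N = 0 -> agree N p f -> agree N r g ->
  agree N (p \Po r) (fcomp f g).
Proof.
move=> g0 pf rg n nN; rewrite coef_comp_poly.
have rz k : (n < k)%N -> (r ^+ k)`_n = 0.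
  by move=> nk; rewrite (agreeX k rg) // fpsX_lt.
transitivity (\sum_(k < N) p`_k * (r ^+ k)`_n); last first.
  by rewrite (fcompE f g0 nN); apply: eq_bigr => k _; rewrite pf // (agreeX k rg).
set F := fun k => p`_k * (r ^+ k)`_n.
have Fz k : (size p <= k)%N -> F k = 0 by move=> sk; rewrite /F nth_default // mul0r.
have Fz' k : (N <= k)%N -> F k = 0 by move=> sk; rewrite /F rz ?mulr0 // (leq_trans nN).
rewrite (big_ord_widen (size p + N) F) ?leq_addr //.
rewrite [RHS](big_ord_widen (size p + N) F) ?leq_addl //.
rewrite big_mkcond [RHS]big_mkcond; apply: eq_bigr => i _.
by case: ltnP => [_|/Fz ->]; case: ltnP => // /Fz' ->.
Qed.

Lemma agreeD N p r f g : agree N p f -> agree N r g -> agree N (p + r) (f + g).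
Proof. by move=> pf rg i iN; rewrite coefD fpsDE pf ?rg. Qed.

Lemma fcompD f g h : fcomp (f + g) h = fcomp f h + fcomp g h.
Proof.
apply: fpsP => n; rewrite fpsDE -big_split; apply: eq_bigr => i _.
by rewrite fpsDE mulrDl.
Qed.

Lemma fcompN f h : fcomp (- f) h = - fcomp f h.
Proof.
apply: fpsP => n; rewrite fpsNE /fcomp -sumrN.
by apply: eq_bigr => i _; rewrite fpsNE mulNr.
Qed.

Lemma fcompM f g h : h 0%N = 0 -> fcomp (f * g) h = fcomp f h * fcomp g h.
Proof.
move=> h0; apply: agree_eq => N; exists ((trunc N f * trunc N g) \Po trunc N h); split.
  apply: agree_comp => //; last exact: agree_trunc.
  by apply: agreeM; exact: agree_trunc.
by rewrite comp_polyM; apply: agreeM; apply: agree_comp => //; exact: agree_trunc.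
Qed.

Lemma fcompC c h : fcomp (fpsC c) h = fpsC c.
Proof.
apply: fpsP => n; rewrite /fcomp big_ord_recl big1 => [|i _]; last by rewrite /fpsC mul0r.
by rewrite addr0 expr0 fps1E /fpsC; case: n => [|n] /=; rewrite ?mulr1 ?mulr0.
Qed.

Lemma fcomp1 h : fcomp 1 h = 1.
Proof. by rewrite -fpsC1 fcompC. Qed.

Lemma fcompX f : f 0%N = 0 -> fcomp fpsX f = f.
Proof.
move=> f0; apply: fpsP => n; rewrite (@fcompE _ _ n n.+2) //.
rewrite 2!big_ord_recl /= mul0r add0r mul1r expr1 big1 ?addr0 // => i _.
by rewrite /fpsX /= mul0r.
Qed.

Lemma fpsXnE k n : (fpsX ^+ k) n = (n == k)%:R.
Proof.
elim: k n => [|k IH] n; first by rewrite expr0 fps1E.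
by rewrite exprS fpsXE; case: n.
Qed.

Lemma fcompXr f : fcomp f fpsX = f.
Proof.
apply: fpsP => n; rewrite /fcomp big_ord_recr /= fpsXnE eqxx mulr1 big1 ?add0r // => i _.
by rewrite fpsXnE gtn_eqF ?mulr0.
Qed.

Lemma fcomp0 f g : fcomp f g 0%N = f 0%N.
Proof. by rewrite /fcomp big_ord_recl big_ord0 /= expr0 mulr1 addr0. Qed.

Lemma fcomp1E f g : g 0%N = 0 -> fcomp f g 1%N = f 1%N * g 1%N.
Proof.
by move=> g0; rewrite /fcomp 2!big_ord_recl big_ord0 /= expr0 fps1E mulr0 add0r addr0 expr1.
Qed.

Lemma fcompA f g h : g 0%N = 0 -> h 0%N = 0 -> fcomp (fcomp f g) h = fcomp f (fcomp g h).
Proof.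
move=> g0 h0; apply: agree_eq => N.
exists (trunc N f \Po (trunc N g \Po trunc N h)); split; last first.
  apply: agree_comp; rewrite ?fcomp0 //; first exact: agree_trunc.
  by apply: agree_comp => //; exact: agree_trunc.
rewrite comp_polyA; apply: agree_comp => //; last exact: agree_trunc.
by apply: agree_comp => //; exact: agree_trunc.
Qed.

Definition fderiv f : fps := fun n => f n.+1 *+ n.+1.

Lemma agree_deriv N p f : agree N.+1 p f -> agree N p^`() (fderiv f).
Proof. by move=> pf i iN; rewrite coef_deriv pf. Qed.

Lemma agree_le N M p f : (N <= M)%N -> agree M p f -> agree N p f.
Proof. by move=> NM pf i iN; apply: pf; apply: leq_trans NM. Qed.

Lemma fderivD f g : fderiv (f + g) = fderiv f + fderiv g.
Proof. by apply: fpsP => n; rewrite /fderiv !fpsDE mulrnDl. Qed.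

Lemma fderivN f : fderiv (- f) = - fderiv f.
Proof. by apply: fpsP => n; rewrite /fderiv fpsNE mulNrn. Qed.

Lemma fderivC c : fderiv (fpsC c) = 0.
Proof. by apply: fpsP => n; rewrite /fderiv /fpsC mul0rn. Qed.

Lemma fderivX : fderiv fpsX = 1.
Proof. by apply: fpsP => -[|n]; rewrite /fderiv /fpsX /= ?mul0rn. Qed.

Lemma fderivM f g : fderiv (f * g) = fderiv f * g + f * fderiv g.
Proof.
apply: agree_eq => N; exists ((trunc N.+1 f * trunc N.+1 g)^`()); split.
  by apply: agree_deriv; apply: agreeM; exact: agree_trunc.
have aN h : agree N (trunc N.+1 h) h by apply: (@agree_le _ N.+1) => //; exact: agree_trunc.
rewrite derivM; apply: agreeD; apply: agreeM => //; apply: agree_deriv;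
  exact: agree_trunc.
Qed.

Lemma fderiv_comp f g : g 0%N = 0 ->
  fderiv (fcomp f g) = fcomp (fderiv f) g * fderiv g.
Proof.
move=> g0; apply: agree_eq => N; exists ((trunc N.+1 f \Po trunc N.+1 g)^`()); split.
  by apply: agree_deriv; apply: agree_comp => //; exact: agree_trunc.
have aN h : agree N (trunc N.+1 h) h by apply: (@agree_le _ N.+1) => //; exact: agree_trunc.
rewrite deriv_comp; apply: agreeM; last by apply: agree_deriv; exact: agree_trunc.
by apply: agree_comp => //; apply: agree_deriv; exact: agree_trunc.
Qed.

(** The inverse is the geometric series evaluated at [1 - f], which has no constant term. *)
Lemma fps_unit f : f 0%N = 1 -> exists2 h : fps, f * h = 1 & h 0%N = 1.
Proof.
move=> f0; have z0 : (1 - f) 0%N = 0 by rewrite fpsDE fpsNE f0 fps1E subrr.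
pose geo : fps := fun=> 1.
have geoE : (1 - fpsX) * geo = 1.
  apply: fpsP => n; rewrite mulrBl mul1r fpsDE fpsNE fpsXE fps1E.
  by case: n => [|n]; rewrite ?subr0 ?subrr.
exists (fcomp geo (1 - f)); last by rewrite fcomp0.
have := congr1 (fun x => fcomp x (1 - f)) geoE.
by rewrite fcompM // fcompD fcompN !fcomp1 fcompX // subKr.
Qed.

(** The series [u + O(u^2)]: the shape of the Cauchy series of a probability measure, and a group
    under composition. *)
Definition ord1 f := f 0%N = 0 /\ f 1%N = 1.

Lemma ord1_reg f g h : ord1 f -> f * g = f * h -> g = h.
Proof.
case=> f0 f1; rewrite (fpsXP f0) -!mulrA => /fpsX_inj.
have [e fe _] := @fps_unit (fun n => f n.+1) f1.
by move/(congr1 (fun x => e * x)); rewrite !mulrA ![e * _]mulrC fe !mul1r.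
Qed.

(** Course-of-values recursion: [F n] may consult only earlier values, which are stored in the
    growing list [L n]. *)
Lemma rec_seq (F : nat -> (nat -> R) -> R) :
  (forall n h h', (forall i, (i < n)%N -> h i = h' i) -> F n h = F n h') ->
  exists h : nat -> R, forall n, h n = F n h.
Proof.
move=> FE; pose fix L n : seq R := if n is m.+1 then rcons (L m) (F m (nth 0 (L m))) else [::].
have sL n : size (L n) = n by elim: n => //= n IH; rewrite size_rcons IH.
have nL m n i : (i < n <= m)%N -> nth 0 (L m) i = nth 0 (L n) i.
  elim: m => [|m IH]; first by case/andP => ? ?; lia.
  case/andP => ilt; rewrite leq_eqVlt => /orP[/eqP -> //|nm].
  by rewrite /= nth_rcons sL (leq_trans ilt) // IH ?ilt.
exists (fun n => nth 0 (L n.+1) n) => n /=.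
rewrite nth_rcons sL ltnn eqxx; apply: FE => i ilt.
by rewrite (nL n i.+1) // ltnSn.
Qed.

Lemma ord1_exp f n : ord1 f -> (f ^+ n) n = 1.
Proof.
case=> f0 f1; elim: n => [|n IH]; first by rewrite expr0.
rewrite exprS fpsME 2!big_ord_recl /= f0 mul0r add0r f1 mul1r subSS subn0 IH big1 ?addr0 //.
by move=> i _; rewrite fpsX_lt ?mulr0 //= /bump /=; have := ltn_ord i; lia.
Qed.

(** The equations for the coefficients of [h] are triangular, with diagonal entries
    [(f ^+ n) n = 1]. *)
Lemma fcomp_solve f (t : fps) : ord1 f -> exists h : fps, fcomp h f = t.
Proof.
move=> of1; have [|h hE] := @rec_seq (fun n h => t n - \sum_(k < n) h k * (f ^+ k) n).
  by move=> n h h' e; congr (_ - _); apply: eq_bigr => k _; rewrite e.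
exists h; apply: fpsP => n.
by rewrite /fcomp big_ord_recr /= ord1_exp // mulr1 [h n]hE addrC subrK.
Qed.

Lemma fcomp_inj f g h : ord1 f -> fcomp g f = fcomp h f -> g = h.
Proof.
move=> of1 gh; apply: fpsP; apply: ltn_ind => n IH.
have := congr1 (fun x : fps => x n) gh.
rewrite /fcomp !big_ord_recr /= ord1_exp // !mulr1.
rewrite (eq_bigr (fun k : 'I_n => h k * (f ^+ k) n)); last by move=> i _; rewrite IH.
by move/addrI.
Qed.

(** Left inverses suffice: if [h o f = X] and [k o h = X], then [k = k o h o f = f], so [h] is also
    a right inverse. *)
Lemma fcomp_inverse f : ord1 f ->
  exists h, [/\ ord1 h, fcomp h f = fpsX & fcomp f h = fpsX].
Proof.
have left_inv k : ord1 k -> exists2 h, ord1 h & fcomp h k = fpsX.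
  move=> ok; have [h hk] := fcomp_solve fpsX ok; exists h => //; split.
    by have := congr1 (fun x : fps => x 0%N) hk; rewrite fcomp0.
  have := congr1 (fun x : fps => x 1%N) hk; rewrite fcomp1E ?ok.1 //.
  by rewrite ok.2 mulr1.
move=> of1; have [h oh hf] := left_inv f of1; have [k ok kh] := left_inv h oh.
exists h; split => //; suff -> : f = k by [].
by rewrite -[k]fcompXr -hf -fcompA ?oh.1 ?of1.1 // kh fcompX ?of1.1.
Qed.

End FormalPowerSeries.

Arguments fpsX {R}.
Arguments fcomp {R}.
Arguments fpsC {R}.

(** * Non-crossing partitions *)

(** The contexts below are full of facts about blocks; they are cleared so that [lia] sees only
    comparisons of indices. *)
Ltac blia := intros;
  repeat match goal with
  | H : is_true (_ && _) |- _ =>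
      let H1 := fresh in let H2 := fresh in case/andP: H => H1 H2
  end;
  repeat match goal with
  | H : ?T |- _ => lazymatch T with
    | is_true (leq _ _) => fail
    | is_true (~~ (_ && _)) => fail
    | is_true (~~ (_ == _)) => fail
    | is_true (~~ (leq _ _)) => fail
    | nat => fail
    | ordinal _ => fail
    | _ => clear H
    end
  end; lia.

Section NoncrossingRecursion.
Import mathcomp.boot.fintype mathcomp.boot.finset.
Variables (R : comNzRingType) (N : nat) (k : nat -> R).
Local Notation I := 'I_N.
Implicit Types (P Q : {set {set I}}) (V W D : {set I}) (a b c d i j x y : I).

Definition ncpart D P := finset.partition P D && noncrossing P.

(** Disjointness and absence of crossings both take the form of an equality of blocks, so they are
    applied in the same way. *)
Definition ncspec D P :=
  [/\ forall V, V \in P -> exists x, x \in V,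
      forall V x, V \in P -> x \in V -> x \in D,
      forall x, x \in D -> exists2 V, V \in P & x \in V,
      forall V W x, V \in P -> W \in P -> x \in V -> x \in W -> V = W &
      forall V W a b c d, V \in P -> W \in P -> (a < b)%N -> (b < c)%N -> (c < d)%N ->
        a \in V -> c \in V -> b \in W -> d \in W -> V = W].

Lemma ncpartP D P : reflect (ncspec D P) (ncpart D P).
Proof.
apply: (iffP andP).
  case=> /and3P[/eqP cP /trivIsetP tP nP] /forall_inP ncP; split.
  - move=> V VP; have [V0|] := set_0Vmem V; first by move: VP; rewrite V0 (negPf nP).
    by case=> x xV; exists x.
  - by move=> V x VP xV; rewrite -cP /cover; apply/bigcupP; exists V.
  - by move=> x; rewrite -cP => /bigcupP[V VP xV]; exists V.
  - move=> V W x VP WP xV xW; apply/eqP; apply/negPn/negP => VW.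
    by have /pred0P := tP _ _ VP WP VW; move/(_ x); rewrite /= xV xW.
  - move=> V W a b c d VP WP ab bc cd aV cV bW dW; apply/eqP; apply/negPn/negP => VW.
    have /forall_inP/(_ W WP)/implyP/(_ VW)/negP := ncP _ VP; apply.
    apply/existsP; exists a; apply/existsP; exists b; apply/existsP; exists c.
    by apply/existsP; exists d; apply/and5P; split=> //; rewrite cV bW dW.
case=> h1 h2 h3 h4 h5; split.
  apply/and3P; split.
  - apply/eqP/setP => x; apply/bigcupP/idP => [[V VP xV]|/h3[V]]; last by exists V.
    exact: h2 VP xV.
  - apply/trivIsetP => V W VP WP VW; apply/pred0P => x /=; apply/negP => /andP[xV xW].
    by move: VW; rewrite (h4 _ _ _ VP WP xV xW) eqxx.
  - by apply/negP => /h1[x]; rewrite inE.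
apply/forall_inP => V VP; apply/forall_inP => W WP; apply/implyP => VW.
apply/negP => /existsP[a /existsP[b /existsP[c /existsP[d]]]].
case/and5P=> ab bc cd aV /and3P[cV bW dW].
by move: VW; rewrite (h5 V W a b c d) // eqxx.
Qed.

Lemma ncpart_pblock D P V x : ncpart D P -> V \in P -> x \in V -> pblock P x = V.
Proof. by case/andP=> /and3P[_ tP _] _; exact: def_pblock. Qed.

Definition nitv (a b : nat) : {set I} := [set i : I | (a <= i < b)%N].

Lemma in_nitv (a b : nat) x : (x \in nitv a b) = (a <= x < b)%N.
Proof. by rewrite inE. Qed.

(** The block of [a] is counted with [s] further elements: those already removed from its left
    end. *)
Definition wt a s V := k (#|V| + (if a \in V then s else 0)).

Lemma big_bij (J1 J2 : finType) (A : pred J1) (B : pred J2) (h : J2 -> J1) (h' : J1 -> J2)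
    (F : J1 -> R) :
  (forall u : J1, A u -> B (h' u) /\ h (h' u) = u) ->
  (forall v : J2, B v -> A (h v) /\ h' (h v) = v) ->
  \sum_(u | A u) F u = \sum_(v | B v) F (h v).
Proof.
move=> H1 H2; rewrite (reindex_onto h h') => [|i /H1[] //].
apply: eq_bigl => j; apply/andP/idP => [[/H1[Bj _] /eqP <-] //|/H2[-> ->]].
by rewrite eqxx.
Qed.

(** A singleton first block splits off freely, since it crosses nothing. *)
Lemma sum_single a (b : nat) s : (a < b)%N ->
  \sum_(P | ncpart (nitv a b) P && ([set a] \in P)) \prod_(V in P) wt a s V =
  k s.+1 * \sum_(P | ncpart (nitv a.+1 b) P) \prod_(V in P) k #|V|.
Proof.
move=> ab; rewrite big_distrr /=.
rewrite (@big_bij _ _ _ (fun P => ncpart (nitv a.+1 b) P) (fun P => [set a] |: P)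
  (fun P => P :\ [set a])).
- apply: eq_bigr => P /ncpartP[h1 h2 h3 h4 h5].
  have aP : [set a] \notin P.
    by apply/negP => /h2/(_ (set11 a)); rewrite in_nitv ltnn.
  rewrite big_setU1 //= /wt cards1 set11 add1n; congr (_ * _).
  apply: eq_bigr => V VP; case: ifP => aV; last by rewrite addn0.
  by have := h2 _ _ VP aV; rewrite in_nitv ltnn.
- move=> P /andP[/ncpartP[h1 h2 h3 h4 h5] aP].
  have nota V : V \in P -> V != [set a] -> a \notin V.
    move=> VP; apply: contra => aV; apply/eqP; apply: (h4 _ _ a) => //; exact: set11.
  split; last by rewrite setD1K.
  apply/ncpartP; split.
  + by move=> V; rewrite !inE => /andP[_ /h1].
  + move=> V x; rewrite in_setD1 => /andP[Va VP] xV; have := h2 _ _ VP xV.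
    rewrite !in_nitv; suff : x != a by rewrite -val_eqE /=; blia.
    by apply: contraNneq (nota _ VP Va) => <-.
  + move=> x; rewrite in_nitv => xI; have [|V VP xV] := h3 x; first by rewrite in_nitv; blia.
    exists V => //; rewrite in_setD1 VP andbT; apply: contraTneq xV => ->.
    by rewrite in_set1 -val_eqE /=; blia.
  + by move=> V W x; rewrite !in_setD1 => /andP[_ VP] /andP[_ WP]; exact: h4.
  + by move=> V W x y z t; rewrite !in_setD1 => /andP[_ VP] /andP[_ WP]; exact: h5.
- move=> P /ncpartP[h1 h2 h3 h4 h5].
  have aP : [set a] \notin P.
    by apply/negP => /h2/(_ (set11 a)); rewrite in_nitv ltnn.
  have nota V : V \in P -> a \in V -> False.
    by move=> VP aV; have := h2 _ _ VP aV; rewrite in_nitv ltnn.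
  split; last by rewrite setU1K.
  rewrite setU11 andbT; apply/ncpartP; split.
  + by move=> V; rewrite in_setU1 => /orP[/eqP ->|/h1 //]; exists a; rewrite set11.
  + move=> V x; rewrite in_setU1 => /orP[/eqP ->|VP xV].
      by rewrite in_set1 in_nitv => /eqP ->; rewrite leqnn.
    by have := h2 _ _ VP xV; rewrite !in_nitv; blia.
  + move=> x; rewrite in_nitv => xI; have [->|xa] := eqVneq x a.
      by exists [set a]; rewrite ?set11 ?setU11.
    have [|V VP xV] := h3 x; last by exists V => //; rewrite in_setU1 VP orbT.
    by move: xa; rewrite in_nitv -val_eqE /=; blia.
  + move=> V W x; rewrite !in_setU1 => /orP[/eqP ->|VP] /orP[/eqP ->|WP] //.
    * by rewrite in_set1 => /eqP -> /(nota _ WP).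
    * by rewrite in_set1 => + /eqP xa; rewrite xa => /(nota _ VP).
    * exact: h4.
  + move=> V W x y z t; rewrite !in_setU1 => /orP[/eqP ->|VP] /orP[/eqP ->|WP] xy yz zt //.
    * by rewrite !in_set1 => /eqP xa /eqP za; move: xy yz; rewrite xa za; blia.
    * by rewrite !in_set1 => _ _ /eqP xa /eqP za; move: yz zt; rewrite xa za; blia.
    * exact: h5.
Qed.

(** [j] is the successor of [a] in its block; it is only used with [a < j], as [j = a] is not
    excluded here. *)
Definition isnext a j P :=
  [exists V in P, [&& a \in V, j \in V & [forall i in V, (i == a) || (j <= i)%N]]].

Lemma isnextP a j P : reflect
  (exists V, [/\ V \in P, a \in V, j \in V & forall i, i \in V -> i != a -> (j <= i)%N])
  (isnext a j P).
Proof.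
apply: (iffP exists_inP) => [[V VP /and3P[aV jV /forall_inP H]]|[V [VP aV jV H]]].
  by exists V; split => // i iV ia; have := H _ iV; rewrite (negPf ia).
exists V => //; rewrite aV jV; apply/forall_inP => i iV; have [//|ia /=] := eqVneq i a.
exact: H.
Qed.

(* Removing [a] from its block cuts [[a, b)] into the points strictly below the next
   element [j] of that block and the points from [j] on. *)
Definition glue a j (p : {set {set I}} * {set {set I}}) : {set {set I}} :=
  (a |: pblock p.2 j) |: (p.1 :|: (p.2 :\ pblock p.2 j)).

Definition unglue a j (b : nat) P : {set {set I}} * {set {set I}} :=
  ([set V in P | V \subset nitv a.+1 j],
   (pblock P a :\ a) |: [set V in P | V \subset nitv j.+1 b]).

Section Glue.
Variables (a j : I) (b : nat).
Hypotheses (aj : (a < j)%N) (jb : (j < b)%N).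

(** Since [a] and [j] share the block [V0] and nothing of it lies between them, non-crossing forces
    each other block to one side of [j]. This makes the cut reversible. *)
Lemma unglueP P : ncpart (nitv a b) P -> isnext a j P ->
  ncpart (nitv a.+1 j) (unglue a j b P).1 && ncpart (nitv j b) (unglue a j b P).2 /\
  glue a j (unglue a j b P) = P.
Proof.
move=> nP /isnextP[V0 [V0P aV0 jV0 nx]].
have pa : pblock P a = V0 by exact: ncpart_pblock nP V0P aV0.
have /ncpartP[h1 h2 h3 h4 h5] := nP.
have notV0 V : V \in P -> V != V0 -> (a \notin V) && (j \notin V).
  by move=> VP VV0; apply/andP; split; apply: contra VV0 => xV; apply/eqP;
    [exact: (h4 _ _ a)|exact: (h4 _ _ j)].
(* A block with a point [x] in between [a] and [j] and a point [y] beyond [j] would cross [V0] at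
   [a < x < j < y]. *)
have split V : V \in P -> [\/ V = V0, V \subset nitv a.+1 j | V \subset nitv j.+1 b].
  move=> VP; have [->|VV0] := eqVneq V V0; first by constructor 1.
  have /andP[aV jV] := notV0 _ VP VV0.
  have out x : x \in V -> [&& (a < x)%N, (x < b)%N & x != j].
    move=> xV; have := h2 _ _ VP xV; rewrite in_nitv.
    have : x != a by apply: contraNneq aV => <-.
    have -> : x != j by apply: contraNneq jV => <-.
    by rewrite -val_eqE /=; blia.
  case: (boolP (V \subset nitv a.+1 j)) => [|/subsetPn[y yV yI]]; first by constructor 2.
  constructor 3; apply/subsetP => x xV; rewrite in_nitv.
  have := out _ xV; have := out _ yV; move: yI; rewrite in_nitv -!val_eqE /=.
  case: (ltnP x j) => [xj|]; last by blia.
  move=> *; have := h5 V0 V a x j y V0P VP; move/(_ ltac:(blia) ltac:(blia) ltac:(blia)).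
  by move/(_ aV0 jV0 xV yV) => E; rewrite E eqxx in VV0.
have aI x : x \in V0 :\ a -> (j <= x < b)%N.
  rewrite in_setD1 => /andP[xa xV0]; rewrite nx //=.
  by have := h2 _ _ V0P xV0; rewrite in_nitv; blia.
have inP2 V : V \in (unglue a j b P).2 ->
    (V = V0 :\ a) \/ [/\ V \in P, V != V0 & forall x, x \in V -> (j < x < b)%N].
  rewrite in_setU1 pa inE => /orP[/eqP ->|/andP[VP /subsetP VI]]; [by left|right].
  have VI' x : x \in V -> (j < x < b)%N by move=> /VI; rewrite in_nitv.
  split=> //; apply: contraTneq jV0 => <-; apply/negP => /VI'; blia.
have n2 : ncpart (nitv j b) (unglue a j b P).2.
  apply/ncpartP; split.
  - move=> V /inP2[->|[VP _ _]]; last exact: h1.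
    by exists j; rewrite in_setD1 jV0 -val_eqE /= gtn_eqF.
  - by move=> V x /inP2[->|[_ _ VI]]; [move/aI|move/VI]; rewrite in_nitv //; blia.
  - move=> x; rewrite in_nitv => xI; have [|V VP xV] := h3 x; first by rewrite in_nitv; blia.
    have [VV0|VI|VI] := split _ VP.
    + exists (V0 :\ a); first by rewrite /unglue /= pa setU11.
      by rewrite -VV0 in_setD1 xV andbT -val_eqE /=; blia.
    + by have := subsetP VI _ xV; rewrite in_nitv; blia.
    + by exists V => //; rewrite in_setU1 inE VP VI orbT.
  - move=> V W x /inP2[->|[VP VV0 VI]] /inP2[->|[WP WV0 WI]] //.
    + rewrite in_setD1 => /andP[_ xV0] xW; have := h4 _ _ _ V0P WP xV0 xW.
      by move=> E; rewrite E eqxx in WV0.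
    + rewrite in_setD1 => xV /andP[_ xV0]; have := h4 _ _ _ VP V0P xV xV0.
      by move=> E; rewrite E eqxx in VV0.
    + exact: h4.
  - move=> V W x y z t /inP2[->|[VP VV0 VI]] /inP2[->|[WP WV0 WI]] xy yz zt //.
    + rewrite !in_setD1 => /andP[_ xV] /andP[_ zV] yW tW.
      by have E := h5 _ _ _ _ _ _ V0P WP xy yz zt xV zV yW tW; rewrite E eqxx in WV0.
    + rewrite !in_setD1 => xV zV /andP[_ yW] /andP[_ tW].
      by have E := h5 _ _ _ _ _ _ VP V0P xy yz zt xV zV yW tW; rewrite E eqxx in VV0.
    + exact: h5.
split.
  rewrite n2 andbT; apply/ncpartP; split.
  - by move=> V; rewrite inE => /andP[/h1].
  - by move=> V x; rewrite inE => /andP[_ /subsetP]; apply.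
  - move=> x; rewrite in_nitv => xI; have [|V VP xV] := h3 x; first by rewrite in_nitv; blia.
    have [VV0|VI|VI] := split _ VP.
    + suff /aI : x \in V0 :\ a by blia.
      by rewrite -VV0 in_setD1 xV -val_eqE /=; blia.
    + by exists V => //; rewrite inE VP VI.
    + by have := subsetP VI _ xV; rewrite in_nitv; blia.
  - by move=> V W x; rewrite !inE => /andP[VP _] /andP[WP _]; exact: h4.
  - by move=> V W x y z t; rewrite !inE => /andP[VP _] /andP[WP _]; exact: h5.
have jB : j \in V0 :\ a by rewrite in_setD1 jV0 -val_eqE /= gtn_eqF.
have BP : V0 :\ a \in (unglue a j b P).2 by rewrite in_setU1 pa eqxx.
rewrite /glue (ncpart_pblock n2 BP jB) setD1K //.
apply/setP => V; rewrite in_setU1 in_setU in_setD1 /= in_setU1 pa !inE.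
apply/idP/idP.
  by case/or3P => [/eqP -> //|/andP[] //|/andP[/negPf -> /= /andP[]]].
move=> VP; rewrite VP /=; have [-> |->|VI] := split _ VP; rewrite ?eqxx ?orbT //.
rewrite VI orbT andbT; suff -> : V != V0 :\ a by rewrite !orbT.
by apply: contraTneq jB => <-; apply/negP => /(subsetP VI); rewrite in_nitv ltnn.
Qed.

Lemma glueP p : ncpart (nitv a.+1 j) p.1 -> ncpart (nitv j b) p.2 ->
  [/\ ncpart (nitv a b) (glue a j p) && isnext a j (glue a j p),
      unglue a j b (glue a j p) = p &
      forall s, \prod_(V in glue a j p) wt a s V =
        \prod_(V in p.1) k #|V| * \prod_(V in p.2) wt j s.+1 V].
Proof.
case: p => P1 P2 /= n1 n2.
have /ncpartP[u1 u2 u3 u4 u5] := n1; have /ncpartP[v1 v2 v3 v4 v5] := n2.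
have [|B BP jB] := v3 j; first by rewrite in_nitv leqnn.
have pB : pblock P2 j = B by exact: ncpart_pblock n2 BP jB.
have I1 V x : V \in P1 -> x \in V -> (a < x < j)%N by move=> /u2 h /h; rewrite in_nitv.
have I2 V x : V \in P2 -> x \in V -> (j <= x < b)%N by move=> /v2 h /h; rewrite in_nitv.
have I3 V x : V \in P2 -> V != B -> x \in V -> (j < x < b)%N.
  move=> VP VB xV; have := I2 _ _ VP xV; suff : x != j by rewrite -val_eqE /=; blia.
  by apply: contraNneq VB => xj; apply/eqP; apply: (v4 _ _ j) => //; rewrite -xj.
have aB : a \notin B by apply/negP => /(I2 _ _ BP); blia.
have IB x : x \in a |: B -> x = a \/ (j <= x < b)%N /\ x \in B.
  by rewrite in_setU1 => /orP[/eqP ->|xB]; [left|right; split=> //; exact: I2 BP xB].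
have gE : glue a j (P1, P2) = (a |: B) |: (P1 :|: (P2 :\ B)) by rewrite /glue /= pB.
have inG V : V \in (a |: B) |: (P1 :|: (P2 :\ B)) ->
    [\/ V = a |: B, V \in P1 | V \in P2 /\ V != B].
  rewrite in_setU1 in_setU in_setD1 => /or3P[/eqP ->|VP|/andP[VB VP]];
  by [constructor 1|constructor 2|constructor 3].
have GaB : a |: B \in (a |: B) |: (P1 :|: (P2 :\ B)) by rewrite setU11.
have nG : ncpart (nitv a b) (glue a j (P1, P2)).
  rewrite gE; apply/ncpartP; split.
  - move=> V /inG[->|/u1 //|[/v1 //]]; by exists a; rewrite setU11.
  - move=> V x /inG[->|VP|[VP _]]; rewrite in_nitv.
    + by case/IB => [->|[]]; blia.
    + by move/(I1 _ _ VP); blia.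
    + by move/(I2 _ _ VP); blia.
  - move=> x; rewrite in_nitv => xI; have [xa|xa] := eqVneq x a.
      by exists (a |: B) => //; rewrite xa setU11.
    have {}xa : (a < x)%N by move: xa; rewrite -val_eqE /=; blia.
    case: (ltnP x j) => xj.
      have [|V VP xV] := u3 x; first by rewrite in_nitv xa.
      by exists V => //; rewrite in_setU1 in_setU VP /= orbT.
    have [|V VP xV] := v3 x; first by rewrite in_nitv xj; blia.
    have [VB|VB] := eqVneq V B.
      by exists (a |: B) => //; rewrite in_setU1 -VB xV orbT.
    by exists V => //; rewrite in_setU1 in_setU in_setD1 VP VB /= !orbT.
  - move=> V W x /inG[->|VP|[VP VB]] /inG[->|WP|[WP WB]] //.
    + by case/IB => [->|[xI _]] /(I1 _ _ WP); blia.
    + case/IB => [->|[_ xB] xW]; first by move/(I2 _ _ WP); blia.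
      by rewrite (v4 _ _ _ BP WP xB xW) eqxx in WB.
    + by move=> xV /IB xB; have := I1 _ _ VP xV; case: xB => [->|[xI _]]; blia.
    + exact: u4.
    + by move=> /(I1 _ _ VP) ? /(I2 _ _ WP); blia.
    + move=> xV /IB[xa|[_ xB]]; first by have := I2 _ _ VP xV; rewrite xa; blia.
      by rewrite (v4 _ _ _ VP BP xV xB) eqxx in VB.
    + by move=> /(I2 _ _ VP) ? /(I1 _ _ WP); blia.
    + exact: v4.
  - move=> V W x y z t /inG[->|VP|[VP VB]] /inG[->|WP|[WP WB]] xy yz zt //.
    + move=> /IB xV /IB zV yW tW; have := I1 _ _ WP yW; have := I1 _ _ WP tW.
      by case: xV => [?|[? _]]; case: zV => [?|[? _]]; subst; blia.
    + move=> /IB xV /IB zV yW tW.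
      have zB : z \in B.
        by case: zV => [za|[]//]; have := I3 _ _ WP WB yW; move: yz; rewrite za; blia.
      (* The new point [a] does not belong to [B]; its role in a crossing is taken over by [j],
         which lies in [B] and is below [y]. *)
      case: xV => [xa|[_ xB]].
        have jy : (j < y)%N by have := I3 _ _ WP WB yW; blia.
        by have E := v5 _ _ _ _ _ _ BP WP jy yz zt jB zB yW tW; rewrite E eqxx in WB.
      by have E := v5 _ _ _ _ _ _ BP WP xy yz zt xB zB yW tW; rewrite E eqxx in WB.
    + move=> xV zV /IB yB /IB tB; have := I1 _ _ VP xV; have := I1 _ _ VP zV.
      by case: yB => [E|[? _]]; first (move: xy yz; rewrite E); blia.
    + exact: u5.
    + by move=> /(I1 _ _ VP) ? /(I1 _ _ VP) ? /(I2 _ _ WP) ? /(I2 _ _ WP) ?; blia.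
    + move=> xV zV /IB yB /IB tB.
      have xI := I2 _ _ VP xV; have zI := I2 _ _ VP zV.
      case: yB => [E|[? yB]]; first by move: xy; rewrite E; blia.
      case: tB => [E|[? tB]]; first by move: zt; rewrite E; blia.
      by have E := v5 _ _ _ _ _ _ VP BP xy yz zt xV zV yB tB; rewrite E eqxx in VB.
    + by move=> /(I2 _ _ VP) ? /(I2 _ _ VP) ? /(I1 _ _ WP) ? /(I1 _ _ WP) ?; blia.
    + exact: v5.
have aBP1 : a |: B \notin P1.
  by apply/negP => VP; have := I1 _ _ VP (setU11 a B); blia.
have aBP2 : a |: B \notin P2.
  by apply/negP => VP; have := I2 _ _ VP (setU11 a B); blia.
split.
- rewrite nG; apply/isnextP; exists (a |: B); rewrite gE GaB setU11 in_setU1 jB orbT.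
  by split=> // i /IB[->|[/andP[ji _] _ _] //]; rewrite eqxx.
- have paB : pblock (glue a j (P1, P2)) a = a |: B.
    by apply: (ncpart_pblock nG); rewrite ?gE ?setU11.
  rewrite /unglue paB gE setU1K //; congr (_, _); apply/setP => V.
    rewrite inE; apply/andP/idP => [[/inG[->|//|[VP _]] /subsetP VI]|VP].
    + by have := VI _ (setU11 a B); rewrite in_nitv ltnn.
    + by have [x xV] := v1 _ VP; have := VI _ xV; have := I2 _ _ VP xV; rewrite in_nitv; blia.
    split; first by rewrite in_setU1 in_setU VP /= orbT.
    by apply/subsetP => x /(I1 _ _ VP); rewrite in_nitv.
  rewrite in_setU1 inE; apply/orP/idP.
    case=> [/eqP -> //|/andP[/inG[->|VP|[] //] /subsetP VI]].
    + by have := VI _ (setU11 a B); rewrite in_nitv; blia.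
    + by have [x xV] := u1 _ VP; have := VI _ xV; have := I1 _ _ VP xV; rewrite in_nitv; blia.
  move=> VP; have [->|VB] := eqVneq V B; [by left|right].
  rewrite in_setU1 in_setU in_setD1 VP VB /= !orbT /=.
  by apply/subsetP => x /(I3 _ _ VP VB); rewrite in_nitv.
- move=> s; rewrite gE big_setU1 /=; last first.
    by rewrite in_setU in_setD1 negb_or aBP1 (negPf aBP2) andbF.
  rewrite (eq_bigl [predU P1 & P2 :\ B]); last by move=> V; rewrite in_setU.
  rewrite bigU /=; last first.
    rewrite -setI_eq0; apply/eqP/setP => V; rewrite !inE; apply/negP => /and3P[VP1 _ VP2].
    by have [x xV] := u1 _ VP1; have := I1 _ _ VP1 xV; have := I2 _ _ VP2 xV; blia.
  rewrite [X in _ = _ * X](big_setD1 B) //= /wt setU11 jB cardsU1 aB /=.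
  rewrite mulrCA; congr (_ * (_ * _)).
  + by apply: eq_bigr => V VP; case: ifP => aV; rewrite ?addn0 //; have := I1 _ _ VP aV; blia.
  + by congr (k _); rewrite add1n addSn addnS.
  + apply: eq_bigr => V; rewrite in_setD1 => /andP[VB VP].
    case: ifP => aV; first by have := I2 _ _ VP aV; blia.
    by case: ifP => // jV; have := I3 _ _ VP VB jV; blia.
Qed.

End Glue.

Lemma sum_next a j (b : nat) s : (a < j)%N -> (j < b)%N ->
  \sum_(P | ncpart (nitv a b) P && isnext a j P) \prod_(V in P) wt a s V =
  (\sum_(P | ncpart (nitv a.+1 j) P) \prod_(V in P) k #|V|) *
  \sum_(P | ncpart (nitv j b) P) \prod_(V in P) wt j s.+1 V.
Proof.
move=> aj jb.
rewrite (@big_bij _ _ _ (fun p => ncpart (nitv a.+1 j) p.1 && ncpart (nitv j b) p.2)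
  (glue a j) (unglue a j b)).
- rewrite big_distrl /=; under [RHS]eq_bigr do rewrite big_distrr /=.
  rewrite [RHS](pair_big (fun P => ncpart (nitv a.+1 j) P) (fun P => ncpart (nitv j b) P)
    (fun P1 P2 => \prod_(V in P1) k #|V| * \prod_(V in P2) wt j s.+1 V)) /=.
  by apply: eq_bigr => p /andP[n1 n2]; have [_ _ ->] := glueP aj jb n1 n2.
- by move=> P /andP[nP iP]; exact: unglueP.
- by move=> p /andP[n1 n2]; have [-> -> _] := glueP aj jb n1 n2.
Qed.

(** Case distinction on the block of [a]: it is a singleton of weight [k s.+1], or it has a next
    element [j]. In the second case the points between them form an independent partition, and [j]
    becomes the first point with one more removed element on its account. *)
Lemma ncsum_rec a (b : nat) s : (a < b)%N ->
  \sum_(P | ncpart (nitv a b) P) \prod_(V in P) wt a s V =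
  k s.+1 * (\sum_(P | ncpart (nitv a.+1 b) P) \prod_(V in P) k #|V|) +
  \sum_(j : I | (a < j < b)%N)
    (\sum_(P | ncpart (nitv a.+1 j) P) \prod_(V in P) k #|V|) *
    \sum_(P | ncpart (nitv j b) P) \prod_(V in P) wt j s.+1 V.
Proof.
move=> ab; rewrite (bigID (fun P => [set a] \in P)) /= sum_single //; congr (_ + _).
(* The default [a] is never taken when [[set a]] is not a block: the block of [a] then has a least
   other element. *)
pose nx P := odflt a [pick j : I | (a < j < b)%N && isnext a j P].
have nxU P j j' : ncpart (nitv a b) P -> isnext a j P -> isnext a j' P ->
    (a < j)%N -> (a < j')%N -> j = j'.
  move=> /ncpartP[_ _ _ h4 _] /isnextP[V [VP aV jV nV]] /isnextP[W [WP aW jW nW]] aj aj'.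
  have VW := h4 _ _ _ VP WP aV aW; apply: val_inj => /=; apply/eqP; rewrite eqn_leq.
  have j'V : j' \in V by rewrite VW.
  have j2W : j \in W by rewrite -VW.
  by rewrite (nV _ j'V) ?(nW _ j2W) // -val_eqE /= gtn_eqF.
have nxE P : ncpart (nitv a b) P -> [set a] \notin P -> 
    (a < nx P < b)%N && isnext a (nx P) P.
  move=> /ncpartP[h1 h2 h3 h4 h5] aP; rewrite /nx; case: pickP => [j //|no].
  have [|V VP aV] := h3 a; first by rewrite in_nitv leqnn.
  have [z zV za] : exists2 z, z \in V & z != a.
    apply/exists_inP; apply: contraR aP => /exists_inPn H.
    suff <- : V = [set a] by [].
    apply/setP => x; rewrite in_set1; apply/idP/eqP => [/H|-> //]; by rewrite negbK => /eqP.
  have zVa : z \in V :\ a by rewrite in_setD1 za.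
  have [j + jmin] := @arg_minnP _ z (mem (V :\ a)) (fun x : I => x : nat) zVa.
  rewrite [_ j]in_setD1 => /andP[ja jV]; move: (no j).
  have := h2 _ _ VP jV; rewrite in_nitv => jI.
  have -> : (a < j < b)%N by move: ja; rewrite -val_eqE /=; blia.
  move=> /= /negbT/negP[]; apply/isnextP; exists V; split=> // i iV ia.
  by apply: jmin; apply/setD1P.
rewrite (partition_big nx (fun j : I => (a < j < b)%N)) /=; last first.
  by move=> P /andP[nP aP]; case/andP: (nxE _ nP aP).
apply: eq_bigr => j /andP[aj jb]; rewrite -sum_next //; apply: eq_bigl => P.
apply/andP/andP => [[/andP[nP aP] /eqP <-]|[nP iP]].
  by split=> //; case/andP: (nxE _ nP aP).
have aP : [set a] \notin P.
  have /ncpartP[h1 h2 h3 h4 h5] := nP; have /isnextP[V [VP aV jV _]] := iP.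
  apply/negP => aP; have E := h4 _ _ a VP aP aV (set11 a).
  by move: jV; rewrite E in_set1 -val_eqE /= gtn_eqF.
split; first by rewrite nP.
by have /andP[/andP[? _] ?] := nxE _ nP aP; apply/eqP; apply: nxU nP _ _ _ _.
Qed.

Lemma ncsum_empty (a : nat) : \sum_(P | ncpart (nitv a a) P) \prod_(V in P) k #|V| = 1.
Proof.
have E : nitv a a = set0 by apply/setP => x; rewrite in_nitv inE; blia.
rewrite (big_pred1 set0) ?big_set0 // => P /=.
apply/idP/eqP => [/ncpartP[h1 h2 _ _ _]|->].
  apply/setP => V; rewrite inE; apply/negP => VP; have [x xV] := h1 _ VP.
  by have := h2 _ _ VP xV; rewrite E inE.
by apply/ncpartP; split=> [V|V x|x|V W x|V W x y z t]; rewrite ?E inE.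
Qed.

Lemma ncsum_wt0 a (b : nat) :
  \sum_(P | ncpart (nitv a b) P) \prod_(V in P) wt a 0 V =
  \sum_(P | ncpart (nitv a b) P) \prod_(V in P) k #|V|.
Proof.
by apply: eq_bigr => P _; apply: eq_bigr => V _; rewrite /wt; case: ifP; rewrite addn0.
Qed.

End NoncrossingRecursion.

(** * Free cumulants and the functional equation of the Cauchy series *)

Section MomentCumulant.
Variable R : realType.
Implicit Types (m : nat -> R) (C g : fps R).

(** The equation says that [g] is the compositional inverse of [X / (1 + C)]. *)
Lemma lagrange_exists C : C 0%N = 0 ->
  exists2 g, ord1 g & g = fpsX * (1 + fcomp C g).
Proof.
move=> C0; have e0 : (1 + C) 0%N = 1 by rewrite fpsDE C0 addr0 fps1E.
have [e Ce e1] := fps_unit e0.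
have oX : ord1 (fpsX * e) by split; rewrite fpsXE.
have [g [og _ hg]] := fcomp_inverse oX; exists g => //.
rewrite fcompM ?og.1 // fcompX ?og.1 // in hg.
have := congr1 (fun x => fcomp x g) Ce.
rewrite fcompM ?og.1 // fcompD !fcomp1 => Ce'.
by rewrite -hg -mulrA [fcomp e g * _]mulrC Ce' mulr1.
Qed.

Section NCSum.
Variables (k : nat -> R) (g : fps R).
Hypotheses (k0 : k 0%N = 0) (og : ord1 g) (gE : g = fpsX * (1 + fcomp (k : fps R) g)).

(** [A s] is the sum of [k (s + n) g^n] over [n >= 1], the generating series of the weighted
    partition sums in which the first block carries [s] extra elements. *)
Let D s : fps R := fun n => if n is t.+1 then k (s + n)%N else 0.
Let A s : fps R := fcomp (D s) g.

(** Factoring one [g] out of the sum gives [A s = g (k s.+1 + A s.+1)]; its coefficients reproduce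
    the recursion of the partition sums. *)
Let A_rec s n : A s n.+1 =
  k s.+1 * g n.+1 + \sum_(i < n) g i.+1 * A s.+1 (n - i)%N.
Proof.
have DE : D s = fpsX * (fpsC (k s.+1) + D s.+1).
  apply: fpsP => -[|t]; rewrite fpsXE // fpsDE /D /fpsC.
  by case: t => [|t] /=; rewrite ?addr0 ?add0r ?addn1 // addnS addSn.
have -> : A s = g * (fpsC (k s.+1) + A s.+1).
  by rewrite /A DE fcompM ?og.1 // fcompX ?og.1 // fcompD fcompC.
rewrite mulrDr fpsDE mulrC fpsCE; congr (_ + _).
rewrite fpsME big_ord_recl og.1 mul0r add0r big_ord_recr /=.
rewrite subSS subnn {2}/A fcomp0 mulr0 addr0.
by apply: eq_bigr => i _; rewrite /bump /= add1n subSS.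
Qed.

Let gA n : g n.+2 = A 0 n.+1.
Proof.
rewrite {1}gE fpsXE fpsDE fps1E add0r /A /D; congr (fcomp _ g _).
by apply: fpsP => -[|t].
Qed.

(** Induction on the number of points: [ncsum_rec] and [A_rec] are the same recursion. *)
Lemma ncsum_fps N l : forall (a : 'I_N) (b : nat) s, (b <= N)%N -> (a + l.+1 = b)%N ->
  \sum_(P | ncpart (nitv N a b) P) \prod_(V in P) wt k a s V = A s l.+1.
Proof.
elim/ltn_ind: l => l IH a b s bN ab; rewrite ncsum_rec; last by lia.
(* An interval of [l'] points corresponds to the coefficient [l'.+1] of [g]; the empty interval
   gives [g 1 = 1] and must be treated apart. *)
have IH0 (c d l' : nat) : (c <= d <= N)%N -> (d - c <= l)%N -> (d - c = l')%N ->
  \sum_(P | ncpart (nitv N c d) P) \prod_(V in P) k #|V| = g l'.+1.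
  move=> /andP[cd dN] dcl <-; have [->|ncd] := eqVneq c d.
    by rewrite subnn ncsum_empty og.2.
  have cN : (c < N)%N by lia.
  have -> : (d - c = (d - c).-1.+1)%N by lia.
  rewrite gA -(IH (d - c).-1 _ (Ordinal cN) d) ?ncsum_wt0 //=; lia.
rewrite A_rec; congr (_ * _ + _); first by apply: IH0; lia.
rewrite (eq_bigr (fun j : 'I_N => g (j - a.+1).+1 * A s.+1 (b - j)%N)); last first.
  move=> j /andP[aj jb]; congr (_ * _); first by apply: IH0; lia.
  have -> : (b - j = (b - j).-1.+1)%N by lia.
  by apply: IH; lia.
rewrite -(big_mkord (fun i => true) (fun i => g i.+1 * A s.+1 (l - i)%N)).
rewrite -(@big_ord_widen_cond _ _ _ b N (fun j => (a < j)%N)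
  (fun j => g (j - a.+1).+1 * A s.+1 (b - j)%N) bN).
rewrite -(big_mkord (fun j => (a < j)%N) (fun j => g (j - a.+1).+1 * A s.+1 (b - j)%N)).
rewrite (@big_cat_nat _ _ _ a.+1) /=; [|by lia|by lia].
rewrite big_nat_cond big_pred0 ?add0r; last by move=> i; apply/negP; lia.
rewrite -{1}[a.+1]add0n big_addn (_ : b - a.+1 = l)%N; last by lia.
rewrite big_nat_cond [RHS]big_nat_cond; apply: eq_big => [i|i /andP[/andP[_ il] _]].
  by rewrite /=; lia.
by rewrite addnK; congr (_ * A _ _); lia.
Qed.

Lemma ncsum_full n : \sum_(P : {set {set 'I_n}} | NC P) \prod_(V in P) k #|V| = g n.+1.
Proof.
have TE : nitv n 0 n = [set: 'I_n]%SET.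
  by apply/finset.setP => i; rewrite !finset.inE /= ltn_ord.
have E : \sum_(P : {set {set 'I_n}} | NC P) \prod_(V in P) k #|V| =
  \sum_(P | ncpart (nitv n 0 n) P) \prod_(V in P) k #|V|.
  by apply: eq_bigl => P; rewrite /NC /ncpart TE.
rewrite E; case: n TE E => [|n] _ _; first by rewrite ncsum_empty og.2.
by rewrite gA -(@ncsum_fps n.+1 n ord0 n.+1 0) // ncsum_wt0.
Qed.

End NCSum.

Lemma size_kseq m n : size (kseq m n) = n.+1.
Proof. by elim: n => //= n IH; rewrite size_rcons IH. Qed.

Lemma nth_kseq m n i : (i <= n)%N -> nth 0 (kseq m n) i = free_cumulant_seq m i.
Proof.
elim: n => [|n IH]; first by rewrite leqn0 => /eqP ->.
rewrite leq_eqVlt => /orP[/eqP -> //|]; rewrite ltnS => ilt.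
by rewrite /= nth_rcons size_kseq ltnS ilt IH.
Qed.

(** The recursive definition isolates the one-block partition. All other partitions have blocks
    smaller than [n], so the earlier part of the table already holds the cumulants they use. *)
Lemma moment_cumulant m n : (0 < n)%N ->
  m n = \sum_(P : {set {set 'I_n}} | NC P) \prod_(V in P) free_cumulant_seq m #|V|.
Proof.
case: n => // n _.
have NT : NC [set [set: 'I_n.+1]]%SET.
  have -> : NC [set [set: 'I_n.+1]]%SET = ncpart [set: 'I_n.+1]%SET [set [set: 'I_n.+1]]%SET by [].
  apply/ncpartP; split.
  - by move=> V /[1!finset.in_set1] /eqP ->; exists ord0; rewrite finset.in_setT.
  - by move=> V x _ _; rewrite finset.in_setT.
  - by move=> x _; exists [set: 'I_n.+1]%SET; rewrite ?finset.set11 ?finset.in_setT.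
  - by move=> V W x /[!finset.in_set1] /eqP -> /eqP ->.
  - by move=> V W a b c d /[!finset.in_set1] /eqP -> /eqP ->.
rewrite (bigD1 _ NT) /= finset.big_set1 finset.cardsT card_ord.
rewrite {1}/free_cumulant_seq /= nth_rcons size_kseq ltnn eqxx -addrA -[LHS]addr0.
congr (_ + _); rewrite addrC; apply/eqP; rewrite eq_sym subr_eq0; apply/eqP.
apply: eq_bigr => P /andP[NP PT]; apply: eq_bigr => V VP; rewrite nth_kseq //.
suff : V != [set: 'I_n.+1]%SET.
  by rewrite -finset.properT => /proper_card; rewrite finset.cardsT card_ord ltnS.
apply: contraNneq PT => VT; apply/eqP/finset.setP => W; rewrite finset.in_set1.
have /ncpartP[h1 _ _ h4 _] : ncpart [set: 'I_n.+1]%SET P by [].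
apply/idP/eqP => [WP|->]; last by rewrite -VT.
have [x xW] := h1 _ WP; rewrite -VT; apply: (h4 _ _ x) => //.
by rewrite VT finset.in_setT.
Qed.

Definition gser m : fps R := fun n => if n is l.+1 then m l else 0.

Lemma gser_ord1 m : m 0%N = 1 -> ord1 (gser m).
Proof. by move=> m0; split. Qed.

(** The solution of this equation has the non-crossing sums as coefficients, and by the
    moment-cumulant formula so does [gser m]. *)
Lemma cumulant_eq m : m 0%N = 1 ->
  gser m = fpsX * (1 + fcomp (free_cumulant_seq m : fps R) (gser m)).
Proof.
move=> m0; have [g og gE] := @lagrange_exists (free_cumulant_seq m) erefl.
suff -> : gser m = g by [].
apply: fpsP => -[|[|n]] /=; rewrite ?og.1 ?og.2 //.
by rewrite moment_cumulant // (ncsum_full erefl og gE).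
Qed.

(** Cumulants are identified below by exhibiting a functional equation of this form; composition
    with [gser m] can be cancelled. *)
Lemma cumulant_unique m C : m 0%N = 1 ->
  gser m = fpsX * (1 + fcomp C (gser m)) -> free_cumulant_seq m = C.
Proof.
move=> m0; rewrite {1}cumulant_eq // => /fpsX_inj/addrI.
by apply: fcomp_inj; exact: gser_ord1.
Qed.

(* The moments [n] are those of a monotone convolution of [c] with [m]; the right-hand
   side is affine in the cumulants of [m]. *)
Lemma cumulant_comp m n c (gam : fps R) :
  m 0%N = 1 -> n 0%N = 1 -> c 0%N = 1 -> gser n = fcomp (gser c) (gser m) ->
  gam 0%N = 0 -> fcomp gam (gser c) = fpsX -> fcomp (gser c) gam = fpsX ->
  free_cumulant_seq n = (free_cumulant_seq c : fps R)
    + (1 + (free_cumulant_seq c : fps R)) * fcomp (free_cumulant_seq m) gam.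
Proof.
move=> m0 n0 c0 nE gam0 gc cg.
set Km : fps R := free_cumulant_seq m; set Kc : fps R := free_cumulant_seq c.
have gg : fcomp gam (gser n) = gser m by rewrite nE -fcompA // gc fcompX.
(* The functional equation of [c], read after the substitution of [gam]. *)
have wE : fpsX = gam * (1 + Kc).
  rewrite -{1}cg (cumulant_eq c0) fcompM // fcompX // fcompD fcomp1 -/Kc.
  by rewrite fcompA // cg fcompXr.
apply: cumulant_unique => //.
have n00 : gser n 0%N = 0 by [].
have -> : 1 + fcomp (Kc + (1 + Kc) * fcomp Km gam) (gser n) =
   fcomp (1 + Kc) (gser n) * (1 + fcomp Km (gser m)).
  rewrite fcompD fcompM // fcompA // gg !fcompD fcomp1; ring.
have := congr1 (fun x => fcomp x (gser n)) wE.
rewrite fcompX // fcompM // gg => E; rewrite {1}E {1}(cumulant_eq m0) -/Km; ring.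
Qed.

End MomentCumulant.

(** * Reflection, and the moments of the beta law *)

Section Reflection.
Variable R : realType.
Implicit Types (m : nat -> R) (b q : R).

(** The series [u / (1 - b u)], that is, the Cauchy series of the point mass at [b]. *)
Definition moeb b : fps R := fun n => if n is l.+1 then b ^+ l else 0.

Lemma moebE b : (1 - fpsC b * fpsX) * moeb b = fpsX.
Proof.
apply: fpsP => n; rewrite mulrBl mul1r fpsDE fpsNE -mulrA fpsCE fpsXE.
case: n => [|[|n]] /=; rewrite ?mulr0 ?subr0 //.
by rewrite exprS subrr.
Qed.

(** Negative binomial expansion, obtained from Pascal's rule. *)
Lemma moeb_exp b k n : (moeb b ^+ k.+1) n.+1 = 'C(n, k)%:R * b ^+ (n - k).
Proof.
elim: k n => [|k IH] n; first by rewrite expr1 bin0 mul1r subn0.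
elim: n => [|n IHn].
  by rewrite fpsX_lt // bin0n mul0r.
have := congr1 (fun x : fps R => (x * moeb b ^+ k.+1) n.+2) (moebE b).
rewrite /= -mulrA -exprS mulrBl mul1r -mulrA fpsDE fpsNE fpsCE !fpsXE IHn IH => /eqP.
rewrite subr_eq => /eqP ->; rewrite binS natrD mulrDl subSS addrC; congr (_ + _).
case: (ltnP k n) => kn; last by rewrite bin_small // !mul0r mulr0.
by rewrite mulrCA -exprS subnSK.
Qed.

(** For the law of [b - x] one has [G'(z) = - G(b - z)], and [1 / (b - z)] is [- u / (1 - b u)] in
    terms of [u = 1/z]. *)
Lemma gser_reflect m m' b :
  (forall n, m' n = \sum_(k < n.+1) 'C(n, k)%:R * (-1) ^+ k * b ^+ (n - k) * m k) ->
  gser m' = - fcomp (gser m) (- moeb b).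
Proof.
move=> mE; apply: fpsP => -[|n]; rewrite fpsNE; first by rewrite fcomp0 oppr0.
rewrite /= mE /fcomp [in RHS]big_ord_recl mul0r add0r -sumrN; apply: eq_bigr => k _.
have sgnE j : (-1) ^+ j = fpsC ((-1) ^+ j) :> fps R.
  by elim: j => [|j IH]; rewrite ?fpsC1 // !exprS IH fpsCM fpsCN fpsC1.
rewrite /= /bump add1n /= [in RHS]exprNn sgnE.
rewrite fpsCE moeb_exp exprS; ring.
Qed.

Lemma fcomp_oppX (C : fps R) n : fcomp C (- fpsX) n = (-1) ^+ n * C n.
Proof.
have XE k : ((- fpsX : fps R) ^+ k) = fpsC ((-1) ^+ k) * fpsX ^+ k.
  elim: k => [|k IH]; first by rewrite !expr0 fpsC1 mulr1.
  by rewrite !exprS IH mulN1r fpsCN; ring.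
rewrite /fcomp big_ord_recr /= XE fpsCE fpsXnE eqxx mulr1 big1 ?add0r 1?mulrC //.
by move=> k _; rewrite XE fpsCE fpsXnE gtn_eqF // !mulr0.
Qed.

(** After multiplication by [1 - b u], the reflected functional equation has again the form that
    determines cumulants; the translation by [b] is visible only in the first one. *)
Lemma cumulant_reflect m m' b : m 0%N = 1 ->
  (forall n, m' n = \sum_(k < n.+1) 'C(n, k)%:R * (-1) ^+ k * b ^+ (n - k) * m k) ->
  forall n, free_cumulant_seq m' n = (-1) ^+ n * free_cumulant_seq m n + b * (n == 1)%:R.
Proof.
move=> m0 mE.
have m'0 : m' 0%N = 1 by rewrite mE big_ord_recl big_ord0 m0 bin0 !expr0 !mulr1 addr0.
have gE := gser_reflect mE; set g := gser m in gE; set v := moeb b in gE.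
have v0 : (- v) 0%N = 0 by rewrite fpsNE oppr0.
have g'0 : gser m' 0%N = 0 by [].
set K : fps R := free_cumulant_seq m.
suff -> : free_cumulant_seq m' = fcomp K (- fpsX) + fpsC b * fpsX.
  by move=> n; rewrite fpsDE fcomp_oppX fpsCE.
apply: cumulant_unique => //.
have NX : fcomp (- fpsX) (gser m') = - gser m' by rewrite fcompN fcompX.
rewrite fcompD fcompM // fcompC fcompX // fcompA ?fpsNE ?oppr0 // NX.
have h : - gser m' = - v * (1 + fcomp K (- gser m')).
  have := congr1 (fun x => fcomp x (- v)) (cumulant_eq m0).
  by rewrite fcompM // fcompX // fcompD fcomp1 fcompA // -[gser m]/g gE opprK.
have : (1 - fpsC b * fpsX) * gser m' = fpsX * (1 + fcomp K (- gser m')).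
  have h' : gser m' = v * (1 + fcomp K (- gser m')) by apply: oppr_inj; rewrite -mulNr.
  by rewrite {1}h' mulrA moebE.
move/eqP; rewrite mulrBl mul1r subr_eq => /eqP {1}->; ring.
Qed.

(** Successive moments of beta(a, b) have ratio [(a + k) / (a + b + k)], here with [a = 1 - q] and
    [a + b = 2]. *)
Fixpoint bmom q n : R :=
  if n is k.+1 then (k.+1%:R - q) / k.+2%:R * bmom q k else 1.

Lemma bmom_ode q : (1 - fpsX) * fderiv (gser (bmom q)) = 1 - fpsC q * gser (bmom q).
Proof.
apply: fpsP => n; rewrite mulrBl mul1r !fpsDE !fpsNE fpsXE fpsCE fps1E /fderiv.
case: n => [|n] /=; first by rewrite mulr0.
rewrite -[X in X - _]mulr_natr [X in X - _]mulrAC divfK ?pnatr_eq0 // -(mulr_natl (bmom q n)); ring.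
Qed.

Lemma ode_unique q (f : fps R) : f 0%N = 0 ->
  (1 - fpsX) * fderiv f = 1 - fpsC q * f -> f = gser (bmom q).
Proof.
move=> f0 fE; apply: fpsP; elim=> [|n IH] //.
have rec (h : fps R) : (1 - fpsX) * fderiv h = 1 - fpsC q * h ->
    h n.+1 = n.+1%:R^-1 * ((n == 0)%:R - q * h n + h n *+ n).
  move/(congr1 (fun x : fps R => x n)).
  rewrite mulrBl mul1r !fpsDE !fpsNE fpsXE fpsCE fps1E /fderiv.
  move/eqP; rewrite subr_eq => /eqP E.
  apply: (mulfI (x := n.+1%:R)); first by rewrite pnatr_eq0.
  rewrite mulrA divff ?pnatr_eq0 // mul1r mulr_natl E; congr (_ + _).
  by case: (n) => //; rewrite mulr0n.
by rewrite (rec _ fE) (rec _ (bmom_ode q)) IH.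
Qed.

(* beta(1+q, 1-q) is the image of beta(1-q, 1+q) under x |-> 1 - x. *)
Lemma bmom_reflect q n :
  bmom (- q) n = \sum_(k < n.+1) 'C(n, k)%:R * (-1) ^+ k * 1 ^+ (n - k) * bmom q k.
Proof.
pose m' n := \sum_(k < n.+1) 'C(n, k)%:R * (-1) ^+ k * 1 ^+ (n - k) * bmom q k.
suff : gser m' = gser (bmom (- q)) by move/(congr1 (fun x : fps R => x n.+1)).
have gE := @gser_reflect (bmom q) m' 1 (fun=> erefl).
apply: ode_unique => //; rewrite gE; set v := moeb 1; set phi := gser _.
have v0 : (- v) 0%N = 0 by rewrite fpsNE oppr0.
have vE : (1 - fpsX) * v = fpsX by have := moebE 1; rewrite fpsC1 mul1r.
rewrite fderivN fderiv_comp // fderivN.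
have dv : (1 - fpsX) * fderiv v = 1 + v.
  have := congr1 (@fderiv R) vE; rewrite fderivM fderivD fderivN fderivX.
  rewrite -fpsC1 fderivC fpsC1 sub0r mulN1r => /eqP; rewrite addrC subr_eq => /eqP ->.
  by [].
have := congr1 (fun x => fcomp x (- v)) (bmom_ode q); rewrite -/phi.
rewrite fcompM // !fcompD !fcompN fcompX // fcompM // fcompC fcomp1 opprK => E.
transitivity ((1 + v) * fcomp (fderiv phi) (- v)); last by rewrite E fpsCN; ring.
rewrite -dv; ring.
Qed.

End Reflection.

(** * Positive moment sequences *)

Section PositiveSequences.
Variable R : realType.
Implicit Types (m s t : nat -> R) (p r : {poly R}).

(** The functional sending [p] to its integral, whenever [m] is the moment sequence of a measure. *)
Definition Lf m p : R := \sum_(i < size p) p`_i * m i.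

Lemma LfE m p N : (size p <= N)%N -> Lf m p = \sum_(i < N) p`_i * m i.
Proof.
move=> pN; rewrite /Lf (big_ord_widen N (fun i => p`_i * m i)) //.
rewrite [RHS](bigID (fun i : 'I_N => (i < size p)%N)) /= [X in _ + X]big1 ?addr0 //.
by move=> i; rewrite -leqNgt => pi; rewrite nth_default ?mul0r.
Qed.

Lemma LfD m p r : Lf m (p + r) = Lf m p + Lf m r.
Proof.
pose N := maxn (size p) (size r).
rewrite (LfE _ (size_polyD p r)) (@LfE _ p N) ?leq_maxl // (@LfE _ r N) ?leq_maxr //.
by rewrite -big_split; apply: eq_bigr => i _; rewrite coefD mulrDl.
Qed.

Lemma LfZ m c p : Lf m (c *: p) = c * Lf m p.
Proof.
rewrite (LfE _ (size_scale_leq c p)) /Lf big_distrr /=.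
by apply: eq_bigr => i _; rewrite coefZ /= mulrA.
Qed.

Lemma Lf0 m : Lf m 0 = 0. Proof. by rewrite /Lf size_poly0 big_ord0. Qed.

Lemma LfN m p : Lf m (- p) = - Lf m p.
Proof. by rewrite -scaleN1r LfZ mulN1r. Qed.

Lemma LfXn m n : Lf m 'X^n = m n.
Proof.
rewrite /Lf size_polyXn big_ord_recr /= coefXn eqxx mul1r big1 ?add0r // => i _.
by rewrite coefXn ltn_eqF ?mul0r.
Qed.

Lemma Lf1 m : Lf m 1 = m 0%N.
Proof. by rewrite -(expr0 'X) LfXn. Qed.

Lemma LfC m c : Lf m c%:P = c * m 0%N.
Proof. by rewrite -[c%:P]mulr1 mul_polyC LfZ Lf1. Qed.

Lemma Lf_sum m (I : Type) (e : seq I) (P : pred I) (F : I -> {poly R}) :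
  Lf m (\sum_(i <- e | P i) F i) = \sum_(i <- e | P i) Lf m (F i).
Proof. by apply: big_morph; [exact: LfD|exact: Lf0]. Qed.

Definition psd m := forall p, 0 <= Lf m (p * p).

Lemma LfMM m p r :
  Lf m (p * r) = \sum_(i < size p) \sum_(j < size r) p`_i * r`_j * m (i + j)%N.
Proof.
rewrite -{1}[p]coefK poly_def mulr_suml Lf_sum; apply: eq_bigr => i _.
rewrite -{1}[r]coefK poly_def mulr_sumr Lf_sum; apply: eq_bigr => j _.
by rewrite -scalerAl -scalerAr scalerA LfZ -exprD LfXn.
Qed.

(** If the shift [w i |-> w i.+1] is symmetric for a positive form, then
    [m (i + j) = B (w i) (w j)], so the Hankel matrix of [m] is a Gram matrix. *)
Lemma psd_gram m (V : lmodType R) (B : V -> V -> R) (w : nat -> V) :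
  (forall x y z, B (x + y) z = B x z + B y z) ->
  (forall c x y, B (c *: x) y = c * B x y) ->
  (forall x y, B x y = B y x) -> (forall x, 0 <= B x x) ->
  (forall i j, B (w i.+1) (w j) = B (w i) (w j.+1)) ->
  (forall n, m n = B (w n) (w 0)) -> psd m.
Proof.
move=> BD BZ BC B0 Bw mE p.
have mB i j : m (i + j)%N = B (w i) (w j).
  elim: i j => [|i IH] j; first by rewrite add0n mE BC.
  by rewrite addSnnS IH Bw.
have Bsum n (F : 'I_n -> V) y : B (\sum_i F i) y = \sum_i B (F i) y.
  apply: (big_morph (B^~ y)) => [x z|]; first exact: BD.
  by rewrite -(scale0r 0) BZ mul0r.
suff -> : Lf m (p * p) =
    B (\sum_(i < size p) p`_i *: w i) (\sum_(i < size p) p`_i *: w i) by exact: B0.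
rewrite LfMM Bsum; apply: eq_bigr => i _; rewrite BZ BC Bsum big_distrr /=.
by apply: eq_bigr => j _; rewrite BZ BC mB mulrA.
Qed.

(** In Cauchy series this is [g / (1 - x g)], so the reciprocal transform is shifted by [x]. The
    vectors [w n] are the orbit of [1] under multiplication by [X] perturbed by the rank-one
    operator [p |-> x Lf m p], which is symmetric. *)
Lemma psd_boolean m t x : psd m ->
  (forall n, t n = m n + x * \sum_(i < n) t i * m (n.-1 - i)%N) -> psd t.
Proof.
move=> pm tE.
pose w n : {poly R} := 'X^n + x *: \sum_(i < n) t i *: 'X^(n.-1 - i).
have Lw n : Lf m (w n) = t n.
  rewrite LfD LfXn LfZ Lf_sum tE; congr (_ + _ * _).
  by apply: eq_bigr => i _; rewrite LfZ LfXn.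
have wS n : w n.+1 = 'X * w n + (x * t n)%:P.
  rewrite /w big_ord_recr /= subnn expr0 exprS scalerDr mulrDr -scalerAr addrA.
  congr (_ + _ + _); last by rewrite scalerA alg_polyC.
  congr (_ *: _); rewrite mulr_sumr; apply: eq_bigr => i _.
  rewrite -scalerAr -exprS; congr (_ *: 'X^_); have := ltn_ord i; lia.
have w0 : w 0 = 1 by rewrite /w big_ord0 scaler0 addr0 expr0.
clearbody w; apply: (@psd_gram _ _ (fun p r => Lf m (p * r)) w) => //.
- by move=> p r u; rewrite mulrDl LfD.
- by move=> c p r; rewrite -scalerAl LfZ.
- by move=> p r; rewrite mulrC.
- move=> i j; rewrite !wS mulrDl mulrDr !LfD mulrCA mulrA.
  rewrite mul_polyC [w i * _%:P]mulrC mul_polyC !LfZ !Lw; congr (_ + _); ring.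
- by move=> n; rewrite w0 mulr1 Lw.
Qed.

(* [F = z - a - G_s] is the reciprocal of a Cauchy transform. *)
Lemma psd_build s t a : psd s -> t 0%N = 1 ->
  (forall n, t n.+1 = a * t n + \sum_(i < n) t i * s (n.-1 - i)%N) -> psd t.
Proof.
move=> ps t0 tE.
pose p n : {poly R} := \sum_(i < n) t i *: 'X^(n.-1 - i).
have Lp n : Lf s (p n) = \sum_(i < n) t i * s (n.-1 - i)%N.
  by rewrite Lf_sum; apply: eq_bigr => i _; rewrite LfZ LfXn.
have pS n : p n.+1 = 'X * p n + (t n)%:P.
  rewrite /p big_ord_recr /= subnn expr0 alg_polyC; congr (_ + _).
  rewrite mulr_sumr; apply: eq_bigr => i _.
  rewrite -scalerAr -exprS; congr (_ *: 'X^_); have := ltn_ord i; lia.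
have p0 : p 0 = 0 by rewrite /p big_ord0.
clearbody p.
(* The pairs [(t n, p n)] are the orbit of [(1, 0)] under the symmetric operator
   [(c, p) |-> (a c + Lf s p, X p + c)]. *)
apply: (@psd_gram _ (R^o * {poly R})%type (fun x y => x.1 * y.1 + Lf s (x.2 * y.2))
  (fun n => (t n, p n))).
- by move=> x y z /=; rewrite !mulrDl LfD; ring.
- by move=> c x y /=; rewrite -[c *: x.1]/(c * x.1) -[c *: x.2 * y.2]scalerAl LfZ; ring.
- by move=> x y; rewrite mulrC [x.2 * _]mulrC.
- by move=> x; rewrite addr_ge0 // -expr2 sqr_ge0.
- move=> i j /=; rewrite !pS !tE -!Lp.
  have -> : ('X * p i + (t i)%:P) * p j = 'X * p i * p j + t i *: p j.
    by rewrite mulrDl mul_polyC.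
  have -> : p i * ('X * p j + (t j)%:P) = 'X * p i * p j + t j *: p i.
    by rewrite mulrDr mulrCA mulrA [p i * _%:P]mulrC mul_polyC.
  by rewrite !LfD !LfZ; ring.
- by move=> n /=; rewrite t0 p0 mulr0 Lf0 addr0 mulr1.
Qed.

(** Compression to the orthogonal complement of the constants: [w 0] is the projection of [X],
    [w n.+1] that of [X w n], and [s n] is the inner product of [w n] and [w 0]. *)
Lemma psd_strip m s : psd m -> m 0%N = 1 ->
  (forall n, m n.+1 = m 1%N * m n + \sum_(i < n) m i * s (n.-1 - i)%N) -> psd s.
Proof.
move=> pm m0 mE.
pose fix w n : {poly R} := if n is k.+1 then 'X * w k - (s k)%:P else 'X - (m 1%N)%:P.
(* Applied to this expansion, [Lf m] shows inductively that every [w n] is orthogonal to [1]. *)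
have Xw n : 'X^n = (m n)%:P + \sum_(i < n) m i *: w (n.-1 - i)%N.
  elim: n => [|n IH]; first by rewrite big_ord0 addr0 m0 expr0.
  rewrite exprS {}IH mulrDr mulr_sumr [in RHS]big_ord_recr /= subnn /= mE.
  rewrite (eq_bigr (fun i : 'I_n => m i *: w (n - i)%N + (m i * s (n.-1 - i)%N)%:P)); last first.
    move=> i _; have -> : (n - i = (n.-1 - i).+1)%N by have := ltn_ord i; lia.
    by rewrite -scalerAr /= scalerBr scale_polyC subrK.
  rewrite big_split /= polyCD rmorph_sum /= polyCM -[m n *: _]mul_polyC; ring.
have Lw n : Lf m (w n) = 0.
  elim/ltn_ind: n => n IH; have := congr1 (Lf m) (Xw n.+1).
  rewrite LfXn LfD LfC m0 mulr1 Lf_sum big_ord_recl /= subn0 LfZ m0 mul1r.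
  rewrite big1 ?addr0 => [/eqP|i _]; first by rewrite addrC -subr_eq subrr => /eqP.
  by rewrite LfZ IH ?mulr0 //= /bump /=; have := ltn_ord i; lia.
have w0 : w 0 = 'X - (m 1%N)%:P by [].
have wS n : w n.+1 = 'X * w n - (s n)%:P by [].
clearbody w; apply: (@psd_gram _ _ (fun p r => Lf m (p * r)) w) => //.
- by move=> p r u; rewrite mulrDl LfD.
- by move=> c p r; rewrite -scalerAl LfZ.
- by move=> p r; rewrite mulrC.
- move=> i j /=; rewrite !wS mulrBl mulrBr !LfD !LfN mulrCA mulrA.
  by rewrite mul_polyC [w i * _%:P]mulrC mul_polyC !LfZ !Lw !mulr0.
- move=> n /=; rewrite w0 mulrBr mulrC LfD LfN [w n * _%:P]mulrC mul_polyC LfZ Lw mulr0 subr0.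
  have /(congr1 (Lf m)) : 'X * w n = w n.+1 + (s n)%:P by rewrite wS subrK.
  by rewrite LfD Lw LfC m0 mulr1 add0r => <-.
Qed.

(** This is the positivity that integration against a measure gives directly. It is asked of outer
    sequences in compositions, where the polynomial to be integrated is not presented as a
    square. *)
Definition nnegf s := forall p, (forall x, 0 <= p.[x]) -> 0 <= Lf s p.

Lemma psd_nnegf s : nnegf s -> psd s.
Proof. by move=> ns p; apply: ns => x; rewrite hornerM -expr2 sqr_ge0. Qed.

(** Monotone convolution as a mixture: if [s] is the point mass at [x], the composition is
    [g / (1 - x g)], covered by [psd_boolean]. The general case integrates this over [x] against
    [s]. *)
Lemma psd_mix s m n : nnegf s -> psd m ->
  gser n = fcomp (gser s) (gser m) -> psd n.
Proof.
move=> ns pm nE p; set g := gser m in nE; have g0 : g 0%N = 0 by [].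
have nk k : n k = \sum_(j < k.+1) s j * (g ^+ j.+1) k.+1.
  rewrite -[n k]/(gser n k.+1) nE /fcomp big_ord_recl mul0r add0r.
  by apply: eq_bigr => i _; rewrite lift0.
pose t x k := \sum_(j < k.+1) x ^+ j * (g ^+ j.+1) k.+1.
have tE x : gser (t x) = fcomp (moeb x) g.
  apply: fpsP => -[|k]; first by rewrite fcomp0.
  rewrite /= /t /fcomp [RHS]big_ord_recl mul0r add0r.
  by apply: eq_bigr => i _; rewrite lift0.
have pt x : psd (t x).
  apply: (psd_boolean (x := x) pm) => k.
  have : fcomp (moeb x) g = g + fpsC x * (gser (t x) * g).
    have := congr1 (fun f => fcomp f g) (moebE x).
    rewrite fcompM // fcompD fcompN fcompM // fcompC fcompX // fcomp1 -tE => /eqP.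
    by rewrite mulrBl mul1r subr_eq => /eqP E; rewrite {1}E; ring.
  move/(congr1 (fun f : fps R => f k.+1)); rewrite -tE fpsDE fpsCE /= => ->.
  congr (_ + _ * _); rewrite fpsME big_ord_recl mul0r add0r big_ord_recr /=.
  rewrite subSS subnn mulr0 addr0; apply: eq_bigr => i _; rewrite /bump add1n subSS /=.
  by have -> : (k - i = (k.-1 - i).+1)%N by have := ltn_ord i; lia.
(* [Q] is the polynomial in the mixing variable whose value at [x] is [Lf (t x) (p * p)], hence is
   non-negative. *)
pose Q := \sum_(i < size (p * p)) \sum_(j < i.+1) ((p * p)`_i * (g ^+ j.+1) i.+1) *: 'X^j.
have -> : Lf n (p * p) = Lf s Q.
  rewrite Lf_sum {1}/Lf; apply: eq_bigr => i _; rewrite nk Lf_sum big_distrr.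
  by apply: eq_bigr => j _; rewrite LfZ LfXn /=; ring.
apply: ns => x; suff -> : Q.[x] = Lf (t x) (p * p) by exact: pt.
rewrite horner_sum /Lf; apply: eq_bigr => i _; rewrite horner_sum big_distrr.
by apply: eq_bigr => j _; rewrite hornerZ hornerXn /=; ring.
Qed.

End PositiveSequences.

(** * Geometric growth of coefficients *)

Section Growth.
Variable R : realType.
Implicit Types (f g h : fps R) (r : R).

Definition growth (f : nat -> R) := exists K C : R, forall n, `|f n| <= K * C ^+ n.

(** Weighted l1 norm cut at degree [N]. It is submultiplicative, and bounds uniform in [N] express a
    positive radius of convergence without any limit. *)
Definition nrm r N f : R := \sum_(i < N) `|f i| * r ^+ i.

Lemma nrm_ge0 r N f : 0 <= r -> 0 <= nrm r N f.
Proof. by move=> r0; apply: sumr_ge0 => i _; rewrite mulr_ge0 ?exprn_ge0. Qed.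

Lemma nrmD r N f g : 0 <= r -> nrm r N (f + g) <= nrm r N f + nrm r N g.
Proof.
move=> r0; rewrite -big_split; apply: ler_sum => i _ /=.
by rewrite -mulrDl ler_wpM2r ?exprn_ge0 // ler_normD.
Qed.

(** The right-hand side is the value at [r] of a product of polynomials with non-negative
    coefficients; the terms of degree [N] and more are dropped. *)
Lemma nrmM r N f g : 0 <= r -> nrm r N (f * g) <= nrm r N f * nrm r N g.
Proof.
move=> r0; pose F (f : fps R) : {poly R} := \poly_(i < N) `|f i|.
have FE f' : nrm r N f' = (F f').[r] by rewrite horner_poly.
have szF f' : (size (F f') <= N)%N by exact: size_poly.
rewrite (FE f) (FE g) -hornerM (@horner_coef_wide _ (N + N)); last first.
  exact: leq_trans (leq_trans (size_polyMleq _ _) (leq_pred _)) (leq_add (szF f) (szF g)).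
rewrite big_split_ord /= -[nrm _ _ _]addr0 lerD //; last first.
  apply: sumr_ge0 => i _; rewrite mulr_ge0 ?exprn_ge0 // coefM.
  by apply: sumr_ge0 => j _; rewrite mulr_ge0 // coef_poly; case: ifP.
apply: ler_sum => i _; rewrite ler_wpM2r ?exprn_ge0 // fpsME coefM.
apply: (le_trans (ler_norm_sum _ _ _)); apply: ler_sum => j _.
rewrite normrM !coef_poly (leq_ltn_trans _ (ltn_ord i)) //; last by have := ltn_ord j; lia.
by rewrite (leq_ltn_trans (leq_subr _ _) (ltn_ord i)).
Qed.

Lemma nrm1 r N : nrm r N 1 <= 1.
Proof.
case: N => [|N]; first by rewrite /nrm big_ord0.
rewrite /nrm big_ord_recl big1 => [|i _]; last by rewrite fps1E normr0 mul0r.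
by rewrite fps1E normr1 expr0 mulr1 addr0.
Qed.

Lemma nrmX r N : 0 <= r -> nrm r N fpsX <= r.
Proof.
move=> r0; case: N => [|[|N]].
- by rewrite /nrm big_ord0.
- by rewrite /nrm big_ord_recl big_ord0 normr0 mul0r addr0.
rewrite /nrm 2!big_ord_recl big1 => [|i _]; last by rewrite normr0 mul0r.
by rewrite normr0 mul0r add0r normr1 mul1r expr1 addr0.
Qed.

Lemma nrmC r N c : nrm r N (fpsC c) <= `|c|.
Proof.
case: N => [|N]; first by rewrite /nrm big_ord0.
rewrite /nrm big_ord_recl big1 => [|i _]; last by rewrite normr0 mul0r.
by rewrite expr0 mulr1 addr0.
Qed.

Lemma nrm_exp r N f k : 0 <= r -> nrm r N (f ^+ k) <= nrm r N f ^+ k.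
Proof.
move=> r0; elim: k => [|k IH]; first by rewrite expr0; exact: nrm1.
rewrite !exprS; apply: (le_trans (nrmM _ _ _ r0)).
by rewrite ler_wpM2l // nrm_ge0.
Qed.

Lemma nrm_comp r N f g : 0 <= r -> g 0%N = 0 ->
  nrm r N (fcomp f g) <= nrm (nrm r N g) N f.
Proof.
move=> r0 g0; rewrite {1}/nrm.
apply: (@le_trans _ _ (\sum_(i < N) \sum_(k < N) `|f k| * (`|(g ^+ k) i| * r ^+ i))).
  apply: ler_sum => i _; rewrite (fcompE f g0 (ltn_ord i)).
  apply: (le_trans (ler_wpM2r _ (ler_norm_sum _ _ _))); first exact: exprn_ge0.
  rewrite mulr_suml; apply: ler_sum => k _; by rewrite normrM mulrA.
rewrite exchange_big /=; apply: ler_sum => k _.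
by rewrite -mulr_sumr ler_wpM2l //; exact: nrm_exp.
Qed.

Lemma nrm_le r r' N f : 0 <= r <= r' -> nrm r N f <= nrm r' N f.
Proof.
move=> /andP[r0 rr]; apply: ler_sum => i _; rewrite ler_wpM2l //.
by apply: lerXn2r; rewrite ?nnegrE // (le_trans r0).
Qed.

(** For a rate [D] the radius [(2 * D)^-1] leaves a geometric series of ratio 1/2. *)
Lemma growthP f : growth f <-> exists r B, 0 < r /\ forall N, nrm r N f <= B.
Proof.
split=> [[K [C fKC]]|[r [B [r0 fB]]]]; last first.
  exists B, r^-1 => n; rewrite exprVn -ler_pdivrMr ?invr_gt0 ?exprn_gt0 // invrK.
  apply: le_trans (fB n.+1); rewrite /nrm big_ord_recr /= lerDr.
  by apply: nrm_ge0; exact: ltW.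
pose D := 1 + `|C|; have D0 : 0 < D by rewrite ltr_wpDr.
have fD n : `|f n| <= `|K| * D ^+ n.
  apply: (le_trans (fKC n)); apply: (le_trans (ler_norm _)).
  rewrite normrM normrX ler_wpM2l //; apply: lerXn2r; rewrite ?nnegrE ?normr_ge0 ?ltW //.
  by rewrite ltrDr.
exists (2 * D)^-1, (2 * `|K|); split=> [|N]; first by rewrite invr_gt0 mulr_gt0.
apply: (@le_trans _ _ (\sum_(i < N) `|K| * 2^-1 ^+ i)).
  apply: ler_sum => i _; apply: (le_trans (ler_wpM2r _ (fD i))).
    by rewrite exprn_ge0 // invr_ge0 mulr_ge0 ?ltW.
  by rewrite invfM exprMn mulrACA -exprMn divff ?gt_eqF // expr1n mulr1.
rewrite -mulr_sumr mulrC ler_wpM2r //.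
suff -> : \sum_(i < N) 2^-1 ^+ i = 2 - 2 * 2^-1 ^+ N :> R.
  by rewrite gerBl mulr_ge0 // exprn_ge0 // invr_ge0.
elim: N => [|N IH]; first by rewrite big_ord0 expr0 mulr1 subrr.
by rewrite big_ord_recr /= IH exprS; field.
Qed.

(** Without constant term, scaling the radius by [l <= 1] scales the norm by at least the same
    factor. *)
Lemma nrm_small f (e : R) : growth f -> f 0%N = 0 -> 0 < e ->
  exists2 r, 0 < r & forall N, nrm r N f <= e.
Proof.
move=> /growthP[r0 [B [r00 fB]]] f0 e0.
have B0 : 0 <= B by apply: le_trans (fB 0%N); rewrite nrm_ge0 // ltW.
pose l := Num.min 1 (e / (1 + B)).
have l0 : 0 < l by rewrite lt_min ltr01 divr_gt0 // ltr_wpDr.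
exists (l * r0) => [|N]; first exact: mulr_gt0.
apply: (@le_trans _ _ (l * nrm r0 N f)).
  rewrite /nrm mulr_sumr; apply: ler_sum => i _.
  case: i => -[|j] _ /=; first by rewrite f0 normr0 !mul0r mulr0.
  rewrite mulrCA ler_wpM2l // exprMn ler_wpM2r ?exprn_ge0 ?(ltW r00) //.
  by rewrite exprS ger_pMr // exprn_ile1 ?(ltW l0) // ge_min lexx.
apply: (@le_trans _ _ (e / (1 + B) * (1 + B))); last first.
  by rewrite divfK // gt_eqF // ltr_wpDr.
apply: ler_pM; rewrite ?(ltW l0) ?nrm_ge0 ?(ltW r00) //; first by rewrite ge_min lexx orbT.
by apply: (le_trans (fB N)); rewrite lerDr.
Qed.

Lemma growth_comp f g : growth f -> growth g -> g 0%N = 0 -> growth (fcomp f g).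
Proof.
move=> /growthP[r [B [r0 fB]]] gg g0; have [e e0 ge] := nrm_small gg g0 r0.
apply/growthP; exists e, B; split=> // N; apply: (le_trans (nrm_comp _ _ (ltW e0) g0)).
by apply: le_trans (fB N); apply: nrm_le; rewrite nrm_ge0 ?(ltW e0) ?ge.
Qed.

Lemma growth_le (f g : nat -> R) : (forall n, `|f n| <= `|g n|) -> growth g -> growth f.
Proof. by move=> fg [K [C gK]]; exists K, C => n; apply: le_trans (fg n) (gK n). Qed.

Lemma growth_shift (f : nat -> R) : growth f -> growth (fun n => f n.+1).
Proof. by move=> [K [C fK]]; exists (K * C), C => n; rewrite -mulrA -exprS. Qed.

Lemma growth_gser (m : nat -> R) : growth m <-> growth (gser m).
Proof.
split=> [gm|]; last exact: growth_shift.
have /growthP[r [B [r0 mB]]] := gm; apply/growthP; exists r, (r * B); split=> // -[|N].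
  by rewrite /nrm big_ord0 mulr_ge0 ?(ltW r0) // (le_trans _ (mB 0%N)) ?nrm_ge0 ?ltW.
rewrite /nrm big_ord_recl normr0 mul0r add0r.
apply: le_trans (ler_wpM2l (ltW r0) (mB N)); rewrite /nrm mulr_sumr.
by apply: ler_sum => i _; rewrite lift0 exprS mulrCA.
Qed.

Definition geo : fps R := fun=> 1.

Lemma geoE f : f 0%N = 0 -> (1 - f) * fcomp geo f = 1.
Proof.
move=> f0; have E : (1 - fpsX) * geo = 1.
  apply: fpsP => n; rewrite mulrBl mul1r fpsDE fpsNE fpsXE fps1E.
  by case: n => [|n]; rewrite ?subr0 ?subrr.
have := congr1 (fun x => fcomp x f) E.
by rewrite fcompM // fcompD fcompN fcomp1 fcompX.
Qed.

Lemma growth_geo : growth geo.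
Proof. by exists 1, 1 => n; rewrite normr1 expr1n mulr1. Qed.

Lemma nrm_geo r N : 0 <= r <= 2^-1 -> nrm r N geo <= 2.
Proof.
move=> rr; apply: (le_trans (nrm_le N geo rr)).
suff -> : nrm 2^-1 N geo = 2 - 2 * 2^-1 ^+ N.
  by rewrite gerBl mulr_ge0 // exprn_ge0 // invr_ge0.
rewrite /nrm; elim: N => [|N IH]; first by rewrite big_ord0 expr0 mulr1 subrr.
by rewrite big_ord_recr /= IH normr1 exprS; field.
Qed.

End Growth.

(** * Free convolution *)

Section FreeConvolution.
Variable R : realType.
Implicit Types (m s t : nat -> R) (g S : fps R) (a : R).

Lemma gser_conv (a b : nat -> R) n :
  (gser a * gser b) n.+1 = \sum_(i < n) a i * b (n.-1 - i)%N.
Proof.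
rewrite fpsME big_ord_recl mul0r add0r big_ord_recr /= subSS subnn mulr0 addr0.
apply: eq_bigr => i _; rewrite /bump add1n subSS /=.
by have -> : (n - i = (n.-1 - i).+1)%N by have := ltn_ord i; lia.
Qed.

(** Writing [e = 1/m] as series in [u], the reciprocal of the Cauchy series is
    [z + e 1 + e 2 u + ...]. Comparison with [z - a - G_s] gives [a = m 1] and [s n = - e n.+2]. *)
Lemma strip_exists m : m 0%N = 1 -> growth m ->
  exists2 s, growth s &
    gser m = fpsX * (1 + (fpsC (m 1%N) + gser s) * gser m).
Proof.
move=> m0 gm; pose f : fps R := 1 - (m : fps R).
have f0 : f 0%N = 0 by rewrite /f fpsDE fpsNE m0 fps1E subrr.
pose e := fcomp (@geo R) f.
have me : (m : fps R) * e = 1 by have := geoE f0; rewrite subKr.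
have ge : growth e.
  apply: growth_comp => //; first exact: growth_geo.
  apply: growth_le gm => -[|n]; first by rewrite f0 normr0.
  by rewrite /f fpsDE fpsNE fps1E add0r normrN.
exists (fun n => - e n.+2).
  apply: (@growth_le _ _ (fun n => e n.+2)) => [n|]; first by rewrite normrN.
  by apply: (growth_shift (f := fun n => e n.+1)); exact: growth_shift.
set S := gser (fun n => - e n.+2).
have e0 : e 0%N = 1 by rewrite /e fcomp0.
have e1 : e 1%N = - m 1%N.
  have := congr1 (fun x : fps R => x 1%N) me; rewrite fpsM1 m0 mul1r e0 mulr1 fps1E.
  by move/eqP; rewrite addr_eq0 => /eqP.
have eE : e = 1 - fpsX * (fpsC (m 1%N) + S).
  apply: fpsP => n; rewrite fpsDE fpsNE fpsXE fps1E.
  case: n => [|[|n]] /=; rewrite ?subr0 // fpsDE /fpsC /= ?addr0 ?sub0r //.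
  by rewrite ?add0r /S /= opprK.
have -> : gser m = fpsX * (m : fps R) by apply: fpsP => -[|n]; rewrite fpsXE.
have : fpsX * ((m : fps R) * e) = fpsX by rewrite me mulr1.
rewrite {1}eE => /eqP; rewrite mulrBr mulr1 mulrBr subr_eq => /eqP E; rewrite {1}E; ring.
Qed.

Lemma strip_psd m s : psd m -> m 0%N = 1 ->
  gser m = fpsX * (1 + (fpsC (m 1%N) + gser s) * gser m) -> psd s.
Proof.
move=> pm m0 mE; apply: (psd_strip pm m0) => n.
have := congr1 (fun x : fps R => x n.+2) mE.
rewrite fpsXE fpsDE fps1E add0r mulrDl fpsDE fpsCE [gser s * _]mulrC gser_conv.
by [].
Qed.

(** The series [u / (1 - u (a + S))], i.e. the reciprocal of [z - a - S]; it inverts the stripping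
    above. *)
Definition build a S : fps R := fpsX * fcomp (@geo R) (fpsX * (fpsC a + S)).

Lemma buildE a S : build a S = fpsX * (1 + (fpsC a + S) * build a S).
Proof.
rewrite /build; set f := fpsX * (fpsC a + S).
have f0 : f 0%N = 0 by rewrite /f fpsXE.
have /eqP := geoE f0; rewrite mulrBl mul1r subr_eq => /eqP {1}->.
rewrite /f; ring.
Qed.

Lemma build_gser a S : build a S = gser (fun n => build a S n.+1).
Proof. by apply: fpsP => -[|n] //; rewrite /build fpsXE. Qed.

Lemma build0 a S : build a S 0%N = 0.
Proof. by rewrite /build fpsXE. Qed.

Lemma buildS a S n : build a S n.+1 =
  (n == 0)%:R + \sum_(i < n.+1) (fpsC a + S) i * build a S (n - i)%N.
Proof. by rewrite {1}buildE fpsXE fpsDE fps1E fpsME. Qed.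

Lemma build1 a S : build a S 1%N = 1.
Proof. by rewrite buildS big_ord_recl big_ord0 subn0 build0 mulr0 !addr0. Qed.

Lemma build_psd a s : psd s -> psd (fun n => build a (gser s) n.+1).
Proof.
move=> ps; apply: (@psd_build _ s _ a) => // [|n]; first exact: build1.
rewrite {1}buildE fpsXE fpsDE fps1E add0r mulrDl fpsDE fpsCE; congr (_ + _).
by rewrite {1}build_gser mulrC gser_conv.
Qed.

(** The outer factor [fpsX] gains one order; this contraction makes the iteration below stabilise
    coefficientwise. *)
Lemma build_local a S S' n : (forall i, (i <= n)%N -> S i = S' i) ->
  forall i, (i <= n.+1)%N -> build a S i = build a S' i.
Proof.
move=> SS; elim/ltn_ind => -[|i] IH iN; first by rewrite !build0.
rewrite !buildS; congr (_ + _); apply: eq_bigr => j _.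
have jn := ltn_ord j; congr (_ * _); first by rewrite !fpsDE SS //; lia.
by apply: IH; lia.
Qed.

Lemma comp_local S g g' n : (forall i, (i <= n)%N -> g i = g' i) ->
  forall i, (i <= n)%N -> fcomp S g i = fcomp S g' i.
Proof.
move=> gg i iN; apply: eq_bigr => k _; congr (_ * _); apply: fps_eq_low => j ji.
by apply: gg; lia.
Qed.

Lemma nrm_build r N a S : 0 <= r -> S 0%N = 0 -> r * (`|a| + nrm r N S) <= 2^-1 ->
  nrm r N (build a S) <= 2 * r.
Proof.
move=> r0 S0 rS; rewrite [leRHS]mulrC; apply: (le_trans (nrmM _ _ _ r0)).
apply: ler_pM; rewrite ?nrm_ge0 ?nrmX //.
apply: (le_trans (nrm_comp _ _ r0 _)); first by rewrite fpsXE.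
apply: nrm_geo; rewrite nrm_ge0 //=; apply: le_trans rS.
apply: (le_trans (nrmM _ _ _ r0)); apply: ler_pM; rewrite ?nrm_ge0 ?nrmX //.
by apply: (le_trans (nrmD _ _ _ r0)); rewrite lerD2r nrmC.
Qed.

(** * Subordination functions as coefficientwise limits of an iteration *)

Section Subordination.
Variables (a1 a2 : R) (s1 s2 : nat -> R).
Hypotheses (gs1 : growth s1) (gs2 : growth s2).
Hypotheses (ns1 : nnegf s1) (ns2 : nnegf s2).

(** With [F_i = z - a_i - G_(s_i)], subordination asks that [F_1(w1) = F_2(w2) = w1 + w2 - z], that
    is, [w1 = z - a2 - G_(s2)(w2)] and symmetrically. Hence the crossed indices; the iteration acts
    on the reciprocals of [w1], [w2] and starts at [w1 = w2 = z]. *)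
Fixpoint sub_iter k : fps R * fps R :=
  if k is j.+1 then
    (build a2 (fcomp (gser s2) (sub_iter j).2), build a1 (fcomp (gser s1) (sub_iter j).1))
  else (fpsX, fpsX).

Lemma sub_iter0 k : (sub_iter k).1 0%N = 0 /\ (sub_iter k).2 0%N = 0.
Proof. by case: k => [|k] //=; rewrite !build0. Qed.

Lemma sub_iter1 k : (sub_iter k).1 1%N = 1 /\ (sub_iter k).2 1%N = 1.
Proof. by case: k => [|k] //=; rewrite !build1. Qed.

Lemma sub_iter_gser k : (sub_iter k).1 = gser (fun n => (sub_iter k).1 n.+1) /\
  (sub_iter k).2 = gser (fun n => (sub_iter k).2 n.+1).
Proof. by have [h1 h2] := sub_iter0 k; split; apply: fpsP => -[|n]. Qed.

(** The start [fpsX] is the series of the point mass at 0; each step is a composition covered by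
    [psd_mix] followed by [build]. *)
Lemma sub_iter_psd k : psd (fun n => (sub_iter k).1 n.+1) /\
  psd (fun n => (sub_iter k).2 n.+1).
Proof.
elim: k => [|k [IH1 IH2]].
  have pX : psd (fun n => (fpsX : fps R) n.+1).
    move=> p; rewrite /Lf.
    have -> : \sum_(i < size (p * p)) (p * p)`_i * (fpsX : fps R) i.+1 = p`_0 ^+ 2.
      rewrite expr2 -coef0M; case E: (size (p * p)) => [|l].
        by rewrite big_ord0 nth_default ?E.
      rewrite big_ord_recl big1 ?addr0 ?mulr1 // => i _.
      by rewrite /fpsX mulr0.
    exact: sqr_ge0.
  by split.
have mix s (f : fps R) : nnegf s -> f = gser (fun n => f n.+1) -> psd (fun n => f n.+1) ->
    exists2 t, psd t & fcomp (gser s) f = gser t.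
  move=> ns fE pf; exists (fun n => fcomp (gser s) f n.+1); last first.
    by apply: fpsP => -[|n] //; rewrite fcomp0.
  apply: (psd_mix ns pf); rewrite -fE; apply: fpsP => -[|n] //; by rewrite fcomp0.
have [E1 E2] := sub_iter_gser k.
have [t1 pt1 tE1] := mix _ _ ns1 E1 IH1; have [t2 pt2 tE2] := mix _ _ ns2 E2 IH2.
by rewrite /= tE1 tE2; split; exact: build_psd.
Qed.

Lemma sub_iter_stable k i : (i <= k.+1)%N ->
  (sub_iter k.+1).1 i = (sub_iter k).1 i /\ (sub_iter k.+1).2 i = (sub_iter k).2 i.
Proof.
elim: k i => [|k IH] i ik.
  have [e1 e2] := sub_iter0 1; have [d1 d2] := sub_iter1 1.
  by case: i ik => [|[|//]] _; rewrite ?e1 ?e2 ?d1 ?d2.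
by split; apply: (@build_local _ _ _ k.+1) => // j jk; apply: comp_local jk => l lk;
  have [] := IH l lk.
Qed.

Lemma sub_iter_eventually k i : (i <= k.+1)%N -> forall l, (k <= l)%N ->
  (sub_iter l).1 i = (sub_iter k).1 i /\ (sub_iter l).2 i = (sub_iter k).2 i.
Proof.
move=> ik; elim=> [|l IH]; first by rewrite leqn0 => /eqP ->.
rewrite leq_eqVlt => /orP[/eqP <- //|kl]; have [<- <-] := IH kl.
by apply: sub_iter_stable; apply: leq_trans ik _.
Qed.

(** The diagonal is the limit: coefficient [n] no longer changes from step [n] on. *)
Definition sub_lim1 : fps R := fun n => (sub_iter n).1 n.
Definition sub_lim2 : fps R := fun n => (sub_iter n).2 n.

Lemma sub_limE l n : (n <= l)%N ->
  sub_lim1 n = (sub_iter l).1 n /\ sub_lim2 n = (sub_iter l).2 n.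
Proof. by move=> nl; have [-> ->] := @sub_iter_eventually n n (leqnSn n) l nl. Qed.

Lemma sub_lim_eq : sub_lim1 = build a2 (fcomp (gser s2) sub_lim2) /\
  sub_lim2 = build a1 (fcomp (gser s1) sub_lim1).
Proof.
split; apply: fpsP => n; have [E1 E2] := @sub_limE n.+1 n (leqnSn n);
  rewrite ?E1 ?E2 /=; apply: (@build_local _ _ _ n) => // j jn; apply: comp_local jn => i il;
  by have [E3 E4] := sub_limE il; rewrite ?E3 ?E4.
Qed.

Lemma sub_lim_psd : psd (fun n => sub_lim1 n.+1).
Proof.
move=> p; have [h _] := sub_iter_psd (size (p * p)).
suff -> : Lf (fun n => sub_lim1 n.+1) (p * p) =
  Lf (fun n => (sub_iter (size (p * p))).1 n.+1) (p * p) by exact: h.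
by apply: eq_bigr => i _; have [-> _] := sub_limE (ltn_ord i).
Qed.

(** A ball is invariant. At radius [x] both [gser s1] and [gser s2] have norm at most 1; with
    [2 r <= x] and [r (1 + |a1| + |a2|) <= 1/2], each [build] step maps norm [<= x] at radius [r] to
    norm [<= 2 r]. *)
Lemma sub_iter_nrm : exists2 r, 0 < r & exists x, forall k N,
  nrm r N (sub_iter k).1 <= x /\ nrm r N (sub_iter k).2 <= x.
Proof.
have [x1 x10 h1] := nrm_small ((growth_gser s1).1 gs1) erefl ltr01.
have [x2 x20 h2] := nrm_small ((growth_gser s2).1 gs2) erefl ltr01.
pose x := Num.min x1 x2; have x0 : 0 < x by rewrite lt_min x10.
pose D := 1 + `|a1| + `|a2|.
have n1 := normr_ge0 a1; have n2 := normr_ge0 a2.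
have D0 : 0 < D by rewrite /D; lra.
pose r := Num.min (x / 2) (2 * D)^-1.
have r0 : 0 < r by rewrite lt_min divr_gt0 //= invr_gt0 mulr_gt0.
have rx : 2 * r <= x by rewrite mulrC -ler_pdivlMr // /r ge_min lexx.
have rD : r * D <= 2^-1.
  apply: (@le_trans _ _ ((2 * D)^-1 * D)).
    by rewrite ler_wpM2r ?(ltW D0) // /r ge_min lexx orbT.
  by rewrite invfM -mulrA mulVf ?mulr1 // gt_eqF.
exists r => //; exists x; elim=> [|k IH] N.
  have : r <= x by apply: le_trans rx; rewrite ler_peMl ?(ltW r0) // ler1n.
  by move=> h; split; apply: (le_trans (nrmX _ (ltW r0))).
have [k1 k2] := sub_iter0 k; have [N1 N2] := IH N.
have step a s (y : fps R) : (forall N, nrm x N (gser s) <= 1) -> `|a| + 1 <= D ->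
    y 0%N = 0 -> nrm r N y <= x -> nrm r N (build a (fcomp (gser s) y)) <= x.
  move=> sx aD y0 yx; apply: le_trans rx; apply: nrm_build; rewrite ?(ltW r0) ?fcomp0 //.
  apply: le_trans rD; rewrite ler_pM2l //; apply: le_trans aD; rewrite lerD2l.
  apply: (le_trans (nrm_comp _ _ (ltW r0) y0)); apply: le_trans (sx N); apply: nrm_le.
  by rewrite nrm_ge0 ?(ltW r0).
split; apply: step => //.
- by move=> M; apply: le_trans (h2 M); apply: nrm_le; rewrite (ltW x0) /= /x ge_min lexx orbT.
- by rewrite /D; lra.
- by move=> M; apply: le_trans (h1 M); apply: nrm_le; rewrite (ltW x0) /= /x ge_min lexx.
- by rewrite /D; lra.
Qed.

Lemma sub_lim_growth : growth sub_lim1.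
Proof.
have [r r0 [x h]] := sub_iter_nrm; apply/growthP; exists r, x; split=> // N.
have [+ _] := h N N; apply: le_trans; rewrite le_eqVlt; apply/orP; left; apply/eqP.
by apply: eq_bigr => i _; have [-> _] := sub_limE (ltnW (ltn_ord i)).
Qed.

End Subordination.

Lemma subordination_exists a1 a2 s1 s2 :
  growth s1 -> growth s2 -> nnegf s1 -> nnegf s2 ->
  exists g1 g2 : fps R, [/\ ord1 g1, ord1 g2, growth g1 & psd (fun n => g1 n.+1)] /\
    g1 = fpsX * (1 + (fpsC a2 + fcomp (gser s2) g2) * g1) /\
    g2 = fpsX * (1 + (fpsC a1 + fcomp (gser s1) g1) * g2).
Proof.
move=> gs1 gs2 ns1 ns2.
exists (sub_lim1 a1 a2 s1 s2), (sub_lim2 a1 a2 s1 s2).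
have [E1 E2] := sub_lim_eq a1 a2 s1 s2.
split; last by split; [rewrite [LHS]E1 buildE -E1|rewrite [LHS]E2 buildE -E2].
split; [| |exact: sub_lim_growth|exact: sub_lim_psd].
- by rewrite E1; split; [exact: build0|exact: build1].
- by rewrite E2; split; [exact: build0|exact: build1].
Qed.

(** In reciprocals: [1/g = z - y] and [1/G = 1/g - x], so [1/G = z - (x + y)]. The result is
    symmetric in [x] and [y]. *)
Lemma subordination_inverse (g G x y : fps R) :
  g = fpsX * (1 + y * g) -> G = g * (1 + x * G) -> G * (1 - fpsX * (x + y)) = fpsX.
Proof.
move=> gE GE.
have e : g * (1 - fpsX * y) = fpsX by rewrite mulrBr mulr1 {1}gE; ring.
have f : G * (1 - g * x) = g by rewrite mulrBr mulr1 {1}GE; ring.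
transitivity (G * (1 - g * x) * (1 - fpsX * y)); last by rewrite f e.
transitivity (G * (1 - fpsX * y - (g * (1 - fpsX * y)) * x)); last by ring.
by rewrite e; ring.
Qed.

(** Step [H] is [1/g1 + 1/g2 = z + 1/G] with denominators cleared. Since [1 + c_i = G / g_i], adding
    gives [2 + c1 + c2 = z G + 1], the claim; the factors [g1], [g2] are cancelled at the end. *)
Lemma subordination_sum (g1 g2 G x1 x2 c1 c2 : fps R) : ord1 g1 -> ord1 g2 ->
  g1 = fpsX * (1 + x2 * g1) -> g2 = fpsX * (1 + x1 * g2) ->
  G * (1 - fpsX * (x1 + x2)) = fpsX ->
  G = g1 * (1 + c1) -> G = g2 * (1 + c2) -> G = fpsX * (1 + (c1 + c2)).
Proof.
move=> o1 o2 g1E g2E GX k1 k2.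
have h1 : fpsX * (g2 * x1) = g2 - fpsX by rewrite [X in _ = X - _]g2E; ring.
have h2 : fpsX * (g1 * x2) = g1 - fpsX by rewrite [X in _ = X - _]g1E; ring.
have H : G * (fpsX * g1 + fpsX * g2 - g1 * g2) = fpsX * (g1 * g2).
  transitivity (G * (1 - fpsX * (x1 + x2)) * (g1 * g2)); last by rewrite GX.
  transitivity (G * (g1 * g2 - g1 * (fpsX * (g2 * x1)) - g2 * (fpsX * (g1 * x2)))).
    by rewrite h1 h2; ring.
  by ring.
apply: (ord1_reg o1); apply: (ord1_reg o2); apply: (@addrI _ (fpsX * (g1 * g2))).
transitivity (fpsX * (g2 * (g1 * (1 + c1)) + g1 * (g2 * (1 + c2)))); last by ring.
by rewrite -k1 -k2 -H; ring.
Qed.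

(* Subordination: with [F = 1/G] and [s1], [s2] the measures of [z - a_i - F_i], the
   series [g1], [g2] are the reciprocals of the subordination functions. *)
Lemma free_conv_exists m1 m2 s1 s2 :
  m1 0%N = 1 -> m2 0%N = 1 -> growth m1 ->
  growth s1 -> growth s2 -> nnegf m1 -> nnegf s1 -> nnegf s2 ->
  gser m1 = fpsX * (1 + (fpsC (m1 1%N) + gser s1) * gser m1) ->
  gser m2 = fpsX * (1 + (fpsC (m2 1%N) + gser s2) * gser m2) ->
  exists m, [/\ m 0%N = 1, psd m, growth m &
    forall n, free_cumulant_seq m n = free_cumulant_seq m1 n + free_cumulant_seq m2 n].
Proof.
move=> m10 m20 gm1 gs1 gs2 nm1 ns1 ns2 m1E m2E.
have [g1 [g2 [[h1 h2 gg1 pg1] [g1E g2E]]]] :=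
  @subordination_exists (m1 1%N) (m2 1%N) s1 s2 gs1 gs2 ns1 ns2.
have [g10 g11] := h1; have [g20 g21] := h2.
set x2 := fpsC (m2 1%N) + _ in g1E; set x1 := fpsC (m1 1%N) + _ in g2E.
have GE : fcomp (gser m1) g1 = g1 * (1 + x1 * fcomp (gser m1) g1).
  rewrite {1}m1E (fcompM _ _ g10) (fcompX g10) fcompD fcomp1 (fcompM _ _ g10).
  by rewrite fcompD fcompC.
have G2E : fcomp (gser m2) g2 = g2 * (1 + x2 * fcomp (gser m2) g2).
  rewrite {1}m2E (fcompM _ _ g20) (fcompX g20) fcompD fcomp1 (fcompM _ _ g20).
  by rewrite fcompD fcompC.
have k1 : fcomp (gser m1) g1 =
    g1 * (1 + fcomp (free_cumulant_seq m1) (fcomp (gser m1) g1)).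
  rewrite {1}(cumulant_eq m10) (fcompM _ _ g10) (fcompX g10) fcompD fcomp1.
  by rewrite (@fcompA _ _ (gser m1) _ erefl g10).
have k2 : fcomp (gser m2) g2 =
    g2 * (1 + fcomp (free_cumulant_seq m2) (fcomp (gser m2) g2)).
  rewrite {1}(cumulant_eq m20) (fcompM _ _ g20) (fcompX g20) fcompD fcomp1.
  by rewrite (@fcompA _ _ (gser m2) _ erefl g20).
have G0 : fcomp (gser m1) g1 0%N = 0 by rewrite fcomp0.
have G1 : fcomp (gser m1) g1 1%N = 1 by rewrite fcomp1E //= m10 mul1r.
have gG : growth (fcomp (gser m1) g1).
  by apply: growth_comp => //; exact: (growth_gser m1).1.
have pG : psd (fun n => fcomp (gser m1) g1 n.+1).
  have g1G : g1 = gser (fun n => g1 n.+1) by apply: fpsP => -[|n].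
  apply: (psd_mix nm1 pg1); rewrite -g1G.
  by apply: fpsP => -[|n] //; rewrite fcomp0.
have GX := subordination_inverse g1E GE.
have G2X := subordination_inverse g2E G2E; clear GE G2E.
move: (fcomp (gser m1) g1) (fcomp (gser m2) g2) k1 k2 G0 G1 gG pG GX G2X.
move=> G G2 k1 k2 G0 G1 gG pG GX G2X.
(* Both composites are [fpsX] divided by the same unit [1 - X (x1 + x2)]. *)
have GG : G2 = G.
  have [|e Ee _] := @fps_unit R (1 - fpsX * (x1 + x2)).
    by rewrite fpsDE fpsNE fpsXE fps1E subr0.
  have := congr1 (fun x => x * e) (etrans GX (esym G2X)).
  by rewrite [x2 + x1]addrC -!mulrA Ee !mulr1 => <-.
rewrite GG in k2.
exists (fun n => G n.+1).
have GE : gser (fun n => G n.+1) = G by apply: fpsP => -[|n].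
split=> //; first by apply/growth_gser; rewrite GE.
move: (free_cumulant_seq m1 : fps R) (free_cumulant_seq m2 : fps R) k1 k2 => K1 K2 k1 k2.
suff -> : free_cumulant_seq (fun n => G n.+1) = K1 + K2 by [].
apply: (cumulant_unique G1); rewrite GE fcompD.
exact: subordination_sum h1 h2 g1E g2E GX k1 k2.
Qed.

End FreeConvolution.

(** * The moment problem *)

Section Hausdorff.
Variable R : realType.
Implicit Types (m : nat -> R) (p r : {poly R}).

Lemma psd_CS m p r : psd m -> Lf m (p * r) ^+ 2 <= Lf m (p * p) * Lf m (r * r).
Proof.
move=> pm; set A := Lf m (p * p); set B := Lf m (p * r); set D := Lf m (r * r).
have q t : 0 <= A + 2 * t * B + t ^+ 2 * D.
  have := pm (p + t *: r).
  have -> : (p + t *: r) * (p + t *: r) = p * p + (2 * t) *: (p * r) + t ^+ 2 *: (r * r).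
    by rewrite -!mul_polyC rmorphXn rmorphM rmorph_nat /=; ring.
  by rewrite !LfD !LfZ.
have A0 : 0 <= A by exact: pm.
have D0 : 0 <= D by exact: pm.
have [D00|Dn0] := eqVneq D 0.
  rewrite D00 mulr0; have [->|Bn0] := eqVneq B 0; first by rewrite expr0n.
  have := q (- (A + 1) / (2 * B)); rewrite D00 mulr0 addr0.
  have -> : 2 * (- (A + 1) / (2 * B)) * B = - (A + 1) by field.
  lra.
have {Dn0}D0 : 0 < D by rewrite lt_neqAle eq_sym Dn0.
have := q (- B / D).
have -> : A + 2 * (- B / D) * B + (- B / D) ^+ 2 * D = A - B ^+ 2 / D.
  by field; rewrite gt_eqF.
by rewrite subr_ge0 ler_pdivrMr.
Qed.

Lemma bernoulli_ineq (x : R) n : 0 <= x -> 1 + n%:R * x <= (1 + x) ^+ n.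
Proof.
move=> x0; elim: n => [|n IH]; first by rewrite mul0r addr0 expr0.
rewrite exprS; apply: le_trans (_ : (1 + x) * (1 + n%:R * x) <= _); last first.
  by rewrite ler_wpM2l // addr_ge0.
rewrite -subr_ge0 -natr1.
have -> : (1 + x) * (1 + n%:R * x) - (1 + (n%:R + 1) * x) = n%:R * x ^+ 2 by ring.
by rewrite mulr_ge0 // exprn_ge0.
Qed.

Lemma exp_unbounded (x K : R) : 1 < x -> exists n, forall k, (n <= k)%N -> K < x ^+ k.
Proof.
move=> x1; have d0 : 0 < x - 1 by rewrite subr_gt0.
have [n nK] : exists n : nat, K / (x - 1) < n%:R.
  by exists (Num.bound `|K / (x - 1)|); exact: le_lt_trans (ler_norm _) (archi_boundP (normr_ge0 _)).
exists n => k nk; rewrite ltr_pdivrMr // in nK; apply: (lt_le_trans nK).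
have := @bernoulli_ineq (x - 1) k (ltW d0); rewrite [1 + (x - 1)]addrC subrK.
by apply: le_trans; rewrite ler_wpDl // ler_wpM2r ?(ltW d0) // ler_nat.
Qed.

(** With [a k = Lf m (X^k p^2)], Cauchy-Schwarz gives [a k ^ 2 <= a 0 * a (2 k)]. If
    [|a 1| > C a 0], doubling makes [|a (2^n)|] at least [a 0 (C rho)^(2^n)] with [rho > 1], against
    the growth rate [C]. So the functional lives on [[-C, C]]. *)
Lemma psd_support m (K C : R) p : psd m -> 0 < C -> (forall n, `|m n| <= K * C ^+ n) ->
  `|Lf m ('X * (p * p))| <= C * Lf m (p * p).
Proof.
move=> pm C0 mK; pose a k := Lf m ('X^k * (p * p)).
have aE0 : Lf m (p * p) = a 0%N by rewrite /a expr0 mul1r.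
have aE1 : Lf m ('X * (p * p)) = a 1%N by rewrite /a expr1.
rewrite aE0 aE1 leNgt; apply/negP => big.
have a00 : 0 <= a 0%N by rewrite -aE0; exact: pm.
pose K' := \sum_(i < size (p * p)) `|(p * p)`_i| * (K * C ^+ i).
have aK k : `|a k| <= K' * C ^+ k.
  have -> : a k = \sum_(i < size (p * p)) (p * p)`_i * m (k + i)%N.
    rewrite /a -{1}[p * p]coefK poly_def mulr_sumr Lf_sum; apply: eq_bigr => i _.
    by rewrite -scalerAr -exprD LfZ LfXn.
  apply: (le_trans (ler_norm_sum _ _ _)); rewrite /K' mulr_suml; apply: ler_sum => i _.
  rewrite normrM -mulrA ler_wpM2l // -mulrA -exprD addnC; exact: mK.
have CS k : a k ^+ 2 <= a 0%N * a (k + k)%N.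
  have := @psd_CS m p ('X^k * p) pm.
  rewrite mulrCA -aE0 -[Lf m ('X^k * (p * p))]/(a k).
  have -> : 'X^k * p * ('X^k * p) = 'X^(k + k) * (p * p) by rewrite exprD; ring.
  by [].
have a0p : 0 < a 0%N.
  rewrite lt_neqAle a00 andbT eq_sym; apply/eqP => a0.
  have := CS 1%N; rewrite a0 mul0r => h.
  have /eqP : a 1%N ^+ 2 = 0 by apply/le_anti; rewrite h sqr_ge0.
  by rewrite sqrf_eq0 => /eqP a1; move: big; rewrite a1 a0 mulr0 normr0 ltxx.
pose rho := `|a 1%N| / (C * a 0%N).
have Ca : 0 < C * a 0%N by rewrite mulr_gt0.
have rho1 : 1 < rho by rewrite ltr_pdivlMr // mul1r.
have low n : a 0%N * (C * rho) ^+ (2 ^ n) <= `|a (2 ^ n)%N|.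
  elim: n => [|n IH].
    rewrite expn0 expr1 /rho le_eqVlt; apply/orP; left; apply/eqP.
    by field; rewrite !gt_eqF.
  rewrite -(ler_pM2l a0p) expnS mul2n -addnn.
  apply: (@le_trans _ _ (`|a (2 ^ n)%N| ^+ 2)); last first.
    rewrite real_normK ?num_real //; apply: (le_trans (CS _)).
    by rewrite ler_wpM2l // ler_norm.
  have -> : a 0%N * (a 0%N * (C * rho) ^+ (2 ^ n + 2 ^ n)) = (a 0%N * (C * rho) ^+ (2 ^ n)) ^+ 2.
    by rewrite exprD; ring.
  apply: lerXn2r => //; rewrite nnegrE //.
  by rewrite mulr_ge0 // exprn_ge0 // mulr_ge0 // ltW // (lt_trans ltr01).
have [n nK] := @exp_unbounded rho (K' / a 0%N) rho1.
have := le_trans (low n) (aK _); rewrite exprMn mulrCA.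
rewrite [K' * _]mulrC ler_pM2l ?exprn_gt0 // leNgt => /negP; apply.
by rewrite mulrC -ltr_pdivrMr // nK // ltnW // ltn_expl.
Qed.

Lemma bin_ffact_mul n i j : (i + j <= n)%N ->
  ('C(n, i + j) * (i + j) ^_ j = n ^_ j * 'C(n - j, i))%N.
Proof.
move=> ijn; have jn : (j <= n)%N by lia.
have inj : (i <= n - j)%N by lia.
apply/eqP; rewrite -(eqn_pmul2r (fact_gt0 i)) -(eqn_pmul2r (fact_gt0 (n - (i + j)))).
have h1 := ffact_fact (leq_addl i j); rewrite addnK in h1.
have h2 := bin_fact ijn; have h3 := ffact_fact jn; have h4 := bin_fact inj.
rewrite -subnDA [(j + i)%N]addnC in h4.
by rewrite -[('C(n, i + j) * _ * _)%N]mulnA h1 -mulnA h2 -!mulnA h4 h3.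
Qed.

(** * Bernstein weights of a positive functional on [[-C, C]] *)

Section Weights.
Variables (m : nat -> R) (K C : R).
Hypotheses (pm : psd m) (C0 : 0 < C) (mK : forall n, `|m n| <= K * C ^+ n) (m0 : m 0%N = 1).

(** [Y] maps [[-C, C]] affinely onto [[0, 1]], and [Z = 1 - Y]. *)
Let Y : {poly R} := (2 * C)^-1 *: ('X + C%:P).
Let Z : {poly R} := (2 * C)^-1 *: (C%:P - 'X).

Lemma YZ1 : Y + Z = 1.
Proof.
rewrite /Y /Z -scalerDr.
have -> : 'X + C%:P + (C%:P - 'X) = C%:P + C%:P by ring.
rewrite -polyCD -mul_polyC -polyCM -polyC1.
by congr _%:P; field; rewrite gt_eqF.
Qed.

Lemma Y_ge0 p : 0 <= Lf m (Y * (p * p)).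
Proof.
rewrite -scalerAl LfZ mulr_ge0 ?invr_ge0 ?mulr_ge0 ?(ltW C0) // mulrDl LfD mul_polyC LfZ.
have := @psd_support m K C p pm C0 mK; rewrite ler_norml => /andP[h _].
by rewrite -subr_ge0 opprK addrC in h; rewrite addrC.
Qed.

Lemma Z_ge0 p : 0 <= Lf m (Z * (p * p)).
Proof.
rewrite -scalerAl LfZ mulr_ge0 ?invr_ge0 ?mulr_ge0 ?(ltW C0) //.
rewrite mulrBl LfD LfN mul_polyC LfZ subr_ge0.
by have := @psd_support m K C p pm C0 mK; rewrite ler_norml => /andP[].
Qed.

(** Even powers are absorbed into squares, so only the parities of [i] and [j] matter. *)
Lemma YZ_ge0 i j : 0 <= Lf m (Y ^+ i * Z ^+ j).
Proof.
have split_half (A : {poly R}) k : A ^+ k = A ^+ odd k * (A ^+ k./2 * A ^+ k./2).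
  by rewrite -!exprD addnn odd_double_half.
rewrite [Y ^+ i]split_half [Z ^+ j]split_half.
set u := Y ^+ i./2; set v := Z ^+ j./2.
case: (odd i); case: (odd j); rewrite ?expr1 ?expr0 ?mul1r.
(* When both exponents are odd, multiplication by [Y + Z = 1] turns the product [Y Z] into
   [Z Y^2 + Y Z^2]. *)
- have -> : Y * (u * u) * (Z * (v * v)) =
    Z * ((Y * (u * v)) * (Y * (u * v))) + Y * ((Z * (u * v)) * (Z * (u * v))).
    transitivity ((Y + Z) * (Y * (u * u) * (Z * (v * v)))); last by ring.
    by rewrite YZ1 mul1r.
  by rewrite LfD addr_ge0 // ?Y_ge0 ?Z_ge0.
- have -> : Y * (u * u) * (v * v) = Y * ((u * v) * (u * v)) by ring.
  exact: Y_ge0.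
- have -> : u * u * (Z * (v * v)) = Z * ((u * v) * (u * v)) by ring.
  exact: Z_ge0.
- have -> : u * u * (v * v) = (u * v) * (u * v) by ring.
  exact: pm.
Qed.

(** The probability of [k] successes in [n] trials whose success probability is the random variable
    [Y]. *)
Definition hweight n k : R := 'C(n, k)%:R * Lf m (Y ^+ k * Z ^+ (n - k)).

Lemma hweight_ge0 n k : 0 <= hweight n k.
Proof. by rewrite mulr_ge0 // YZ_ge0. Qed.

Definition hmom j : R := Lf m (Y ^+ j).

Lemma hmom0 : hmom 0 = 1.
Proof. by rewrite /hmom expr0 Lf1. Qed.

Lemma hmom_ge0 j : 0 <= hmom j.
Proof. by rewrite /hmom -[Y ^+ j]mulr1 -(expr0 Z) YZ_ge0. Qed.

(** Factorial moments of a binomial mixture are exact; ordinary moments would only be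
    approximate. *)
Lemma hweight_ffact n j : \sum_(k < n.+1) hweight n k * (k ^_ j)%:R = (n ^_ j)%:R * hmom j.
Proof.
have [jn|nj] := leqP j n; last first.
  rewrite ffact_small // mul0r big1 // => k _; rewrite ffact_small ?mulr0 //.
  by apply: leq_trans nj; exact: ltn_ord.
rewrite -(big_mkord xpredT (fun k => hweight n k * (k ^_ j)%:R)).
rewrite (big_cat_nat _ (n := j)) //= ?leqW // big_nat_cond big1 ?add0r; last first.
  by move=> k /andP[/andP[_ kj] _]; rewrite ffact_small ?mulr0.
rewrite -{1}[j]add0n big_addn subSn // big_mkord.
have YE : Y ^+ j = \sum_(i < (n - j).+1) 'C(n - j, i)%:R *: (Y ^+ (i + j) * Z ^+ (n - (i + j))).
  transitivity (Y ^+ j * (Z + Y) ^+ (n - j)).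
    by rewrite [Z + Y]addrC YZ1 expr1n mulr1.
  rewrite exprDn mulr_sumr; apply: eq_bigr => i _; rewrite mulrnAr -scaler_nat.
  by congr (_ *: _); rewrite exprD addnC subnDA; ring.
rewrite /hmom YE Lf_sum mulr_sumr; apply: eq_bigr => i _; have ij := ltn_ord i.
rewrite /hweight LfZ [RHS]mulrA mulrAC -!natrM.
congr (_%:R * _).
by apply: bin_ffact_mul; lia.
Qed.

(** Each further factor costs at most [j / n.+1], and [j^2 + j <= (j + 1)^2] closes the
    induction. *)
Lemma ffact_approx n k j : (k <= n.+1)%N ->
  `|(k ^_ j)%:R / n.+1%:R ^+ j - (k%:R / n.+1%:R) ^+ j| <= (j ^ 2)%:R / n.+1%:R :> R.
Proof.
move=> kn; have n0 : 0 < n.+1%:R :> R by rewrite ltr0n.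
elim: j => [|j IH]; first by rewrite ffactn0 !expr0 divr1 subrr normr0 divr_ge0.
have q1 : 0 <= (k%:R / n.+1%:R : R) <= 1.
  by apply/andP; split; [exact: divr_ge0|rewrite ler_pdivrMr // mul1r ler_nat].
have f1 : 0 <= ((k ^_ j)%:R / n.+1%:R ^+ j : R) <= 1.
  apply/andP; split; first by rewrite divr_ge0 // exprn_ge0.
  rewrite ler_pdivrMr ?exprn_gt0 // mul1r -natrX ler_nat.
  apply: (@leq_trans (k ^ j)); last first.
    by case: (j) => // l; rewrite leq_exp2r.
  by elim: (j) => // l IHl; rewrite ffactnSr expnSr leq_mul // leq_subr.
have [jk|kj] := leqP j k; last first.
  rewrite (@ffact_small k j.+1) ?mul0r ?sub0r ?normrN; last exact: ltnW.
  rewrite normrX ger0_norm; last by case/andP: q1.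
  apply: (@le_trans _ _ (j.+1%:R / n.+1%:R)).
    rewrite exprS; apply: (@le_trans _ _ (k%:R / n.+1%:R)).
      by case/andP: q1 => q0 q1; apply: ler_piMr => //; exact: exprn_ile1.
    by rewrite ler_pM2r ?invr_gt0 // ler_nat; lia.
  by rewrite ler_pM2r ?invr_gt0 // ler_nat; lia.
set q := k%:R / _ in q1 IH *; set f := (k ^_ j)%:R / _ in f1 IH *.
have -> : (k ^_ j.+1)%:R / n.+1%:R ^+ j.+1 - q ^+ j.+1 = q * (f - q ^+ j) - j%:R / n.+1%:R * f.
  by rewrite ffactnSr natrM natrB // !exprS /q /f; field; rewrite !gt_eqF ?exprn_gt0.
apply: (@le_trans _ _ ((j ^ 2)%:R / n.+1%:R + j%:R / n.+1%:R)).
  apply: (le_trans (ler_normB _ _)); apply: lerD.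
    rewrite normrM; apply: le_trans IH; rewrite ger0_norm; last by case/andP: q1.
    by rewrite ler_piMl //; case/andP: q1.
  rewrite normrM ger0_norm ?divr_ge0 //; rewrite ger0_norm; last by case/andP: f1.
  by rewrite ler_piMr ?divr_ge0 //; case/andP: f1.
by rewrite -mulrDl -natrD ler_pM2r ?invr_gt0 // ler_nat; lia.
Qed.

Lemma hweight_moment n j :
  `|\sum_(k < n.+2) hweight n.+1 k * (k%:R / n.+1%:R) ^+ j - hmom j|
    <= (j ^ 2)%:R / n.+1%:R * (1 + hmom j).
Proof.
have n0 : 0 < n.+1%:R ^+ j :> R by rewrite exprn_gt0 // ltr0n.
have h0 i : \sum_(k < n.+2) hweight n.+1 k * ((k ^_ i)%:R / n.+1%:R ^+ j) =
   (n.+1 ^_ i)%:R / n.+1%:R ^+ j * hmom i.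
  by rewrite mulrAC -hweight_ffact mulr_suml; apply: eq_bigr => k _; rewrite mulrA.
have w1 : \sum_(k < n.+2) hweight n.+1 k = 1.
  have := @hweight_ffact n.+1 0; rewrite ffactn0 mul1r hmom0 => <-.
  by apply: eq_bigr => k _; rewrite ffactn0 mulr1.
rewrite mulrDr mulr1; apply: (@le_trans _ _
  (`|\sum_(k < n.+2) hweight n.+1 k * ((k%:R / n.+1%:R) ^+ j - (k ^_ j)%:R / n.+1%:R ^+ j)| +
   `|((n.+1 ^_ j)%:R / n.+1%:R ^+ j - 1) * hmom j|)).
  rewrite -[X in X - hmom j](subrK (\sum_(k < n.+2) hweight n.+1 k * ((k ^_ j)%:R / n.+1%:R ^+ j))).
  rewrite -sumrB -addrA; under eq_bigr do rewrite -mulrBr.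
  by apply: (le_trans (ler_normD _ _)); rewrite h0 mulrBl mul1r.
apply: lerD.
  apply: (le_trans (ler_norm_sum _ _ _)); rewrite -[leRHS]mul1r -[X in _ <= X * _]w1 mulr_suml.
  apply: ler_sum => k _; rewrite normrM ger0_norm ?hweight_ge0 // ler_wpM2l ?hweight_ge0 //.
  by rewrite distrC; apply: ffact_approx; rewrite -ltnS.
rewrite normrM [`|hmom j|]ger0_norm ?hmom_ge0 // ler_wpM2r ?hmom_ge0 //.
by have := @ffact_approx n n.+1 j (leqnn _); rewrite divff ?expr1n // pnatr_eq0.
Qed.

End Weights.
End Hausdorff.

(** * Quantile functions of discrete laws and their limit *)

Section QuantileLimit.
Variable R : realType.
Local Open Scope classical_set_scope.

(** Along an ultrafilter every bounded sequence converges, so a family of functions has a pointwise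
    limit without extracting subsequences. *)
Lemma bounded_ultra_cvg (U : set_system nat) (f : nat -> R) (a b : R) :
  UltraFilter U -> (forall n, a <= f n <= b) -> exists2 l, a <= l <= b & f @ U --> l.
Proof.
move=> UU fab.
have [|l [lab lc]] := @segment_compact R a b (f @ U) _.
  suff : U (f @^-1` `[a, b]) by [].
  have -> : f @^-1` `[a, b] = setT; last exact: filterT.
  by apply/seteqP; split=> // n _; rewrite /= in_itv /= fab.
exists l; first by move: lab; rewrite /= in_itv.
move=> V lV; have [//|nV] := in_ultra_setVsetC (f @^-1` V) UU.
have [|x [] //] := lc (~` V) V _ lV.
exact: nV.
Qed.

Lemma monotone_cut (P : pred nat) d : (forall i j, (i <= j)%N -> P j -> P i) ->
  exists2 l, (l <= d)%N & forall k, (k < d)%N -> P k = (k < l)%N.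
Proof.
move=> mP; elim: d => [|d [l ld lP]]; first by exists 0%N.
case Pd: (P d).
  exists d.+1 => // k kd; rewrite kd; apply: mP Pd; lia.
exists l; first by lia.
by move=> k; rewrite ltnS leq_eqVlt => /orP[/eqP ->|/lP //]; rewrite Pd; apply/esym; lia.
Qed.

Lemma telescope_cut (g : nat -> R) l d : (l <= d)%N ->
  \sum_(k < d) (g k.+1 - g k) * (k < l)%N%:R = g l - g 0%N.
Proof.
elim: d l => [|d IH] l; first by rewrite leqn0 => /eqP ->; rewrite big_ord0 subrr.
rewrite leq_eqVlt => /orP[/eqP ->|ld]; rewrite big_ord_recr /=.
  rewrite ltnSn mulr1 (eq_bigr (fun k : 'I_d => (g k.+1 - g k) * (k < d)%N%:R)).
    by rewrite IH // addrC addrA subrK.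
  by move=> k _; rewrite !ltn_ord ltnS ltnW.
by rewrite IH // ltnNge -ltnS ld mulr0 addr0.
Qed.

(** A Riemann sum of the indicator of [u > a] misses its integral by at most one cell. *)
Lemma count_riemann (a : R) N : 0 <= a <= 1 ->
  `|(\sum_(i < N.+1) (a < i.+1%:R / N.+1%:R)%R%:R) / N.+1%:R - (1 - a)| <= N.+1%:R^-1.
Proof.
move=> /andP[a0 a1]; have N0 : 0 < N.+1%:R :> R by rewrite ltr0n.
have [|l lN lP] := @monotone_cut (fun i => i.+1%:R / N.+1%:R <= a) N.+1.
  by move=> i j ij; apply: le_trans; rewrite ler_pM2r ?invr_gt0 // ler_nat.
have -> : \sum_(i < N.+1) (a < i.+1%:R / N.+1%:R)%R%:R = N.+1%:R - l%:R :> R.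
  rewrite (eq_bigr (fun i : 'I__ => 1 - (i.+1%:R - i%:R) * (i < l)%N%:R)); last first.
    by move=> i _; rewrite ltNge lP // -natr1 addrAC subrr add0r mul1r; case: (i < l)%N;
       rewrite ?subrr ?subr0.
  by rewrite sumrB sumr_const card_ord telescope_cut // subr0.
have h1 : l%:R <= a * N.+1%:R.
  case: l lN lP => [|l] lN lP; first by rewrite mulr_ge0 // ltW.
  by rewrite -ler_pdivrMr // lP.
have h2 : a * N.+1%:R <= l%:R + 1.
  rewrite natr1; case: (ltnP l N.+1) => [lN'|Nl].
    by rewrite -ler_pdivlMr // ltW // ltNge lP // ltnn.
  have -> : l = N.+1 by lia.
  by apply: (@le_trans _ _ N.+1%:R); rewrite ?ler_nat // ger_pMl.
have hl : l%:R / N.+1%:R <= a by rewrite ler_pdivrMr.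
have hu : a <= l%:R / N.+1%:R + N.+1%:R^-1.
  by rewrite -[X in _ + X]mul1r -mulrDl ler_pdivlMr.
have hi : 0 < N.+1%:R^-1 :> R by rewrite invr_gt0.
rewrite mulrBl divff ?gt_eqF //.
set x := l%:R / N.+1%:R in hl hu *; set y := N.+1%:R^-1 in hu hi *; clearbody x y.
by rewrite ler_norml; apply/andP; split; lra.
Qed.

Section Discrete.
Variables (d : nat) (w : nat -> R).
Hypotheses (w0 : forall k, 0 <= w k) (w1 : \sum_(k < d.+2) w k = 1).

Let F k : R := \sum_(i < k.+1) w i.

(** Generalised inverse of the distribution function [F] of the law with mass [w k] at [k / d.+1]:
    it counts the grid points whose cumulated mass stays below [u]. *)
Definition quantile (u : R) : R := (\sum_(k < d.+1) (F k < u)%R%:R) / d.+1%:R.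

Let F_homo i j : (i <= j)%N -> F i <= F j.
Proof.
move=> ij; rewrite /F -!(big_mkord xpredT w) [leRHS](big_cat_nat _ (n := i.+1)) //=.
by rewrite lerDl; apply: sumr_ge0.
Qed.

Lemma quantile_homo u v : u <= v -> quantile u <= quantile v.
Proof.
move=> uv; rewrite ler_pM2r ?invr_gt0 ?ltr0n //; apply: ler_sum => k _.
by case: ltP => [Fu|//]; rewrite (lt_le_trans Fu uv).
Qed.

Let quantile_cut u : exists2 l, (l <= d.+1)%N &
  quantile u = l%:R / d.+1%:R /\ forall k, (k < d.+1)%N -> (F k < u) = (k < l)%N.
Proof.
have [|l ld lP] := @monotone_cut (fun k => F k < u) d.+1.
  by move=> i j ij; apply: le_lt_trans; exact: F_homo.
exists l => //; split=> //; rewrite /quantile; congr (_ / _).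
have := @telescope_cut (fun k => k%:R) l d.+1 ld; rewrite subr0 => <-.
by apply: eq_bigr => k _; rewrite lP // -natr1 addrAC subrr add0r mul1r.
Qed.

Lemma quantile01 u : 0 <= quantile u <= 1.
Proof.
have [l ld [-> _]] := quantile_cut u; rewrite divr_ge0 //=.
by rewrite ler_pdivrMr ?ltr0n // mul1r ler_nat.
Qed.

(** Abel summation writes the power as a sum of indicators with increments of total 1, so the
    one-cell error carries over. The bound is independent of [d], hence survives the limit in [d] at
    fixed [N]; the exponent [j.+1] makes the boundary term at 0 vanish. *)
Lemma quantile_riemann j N :
  `|(\sum_(i < N.+1) quantile (i.+1%:R / N.+1%:R) ^+ j.+1) / N.+1%:R
    - \sum_(k < d.+2) w k * (k%:R / d.+1%:R) ^+ j.+1| <= N.+1%:R^-1.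
Proof.
pose g k : R := (k%:R / d.+1%:R) ^+ j.+1.
have g0 : g 0%N = 0 by rewrite /g mul0r expr0n.
have gd : g d.+1 = 1 by rewrite /g divff ?expr1n // pnatr_eq0.
have D0 k : 0 <= g k.+1 - g k.
  rewrite subr_ge0; apply: lerXn2r; rewrite ?nnegrE ?divr_ge0 //.
  by rewrite ler_pM2r ?invr_gt0 ?ltr0n // ler_nat.
have F01 k : (k < d.+1)%N -> 0 <= F k <= 1.
  move=> kd; rewrite sumr_ge0 //= -w1 -[\sum_(i < d.+2) _]/(F d.+1); apply: F_homo; lia.
have QE u : quantile u ^+ j.+1 = \sum_(k < d.+1) (g k.+1 - g k) * (F k < u)%R%:R.
  have [l ld [-> lP]] := quantile_cut u.
  rewrite -[LHS]/(g l) -[LHS]subr0 -{1}g0 -(telescope_cut g ld).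
  by apply: eq_bigr => k _; rewrite lP.
have E1 : \sum_(k < d.+2) w k * g k = \sum_(k < d.+1) (g k.+1 - g k) * (1 - F k).
  rewrite (eq_bigr (fun k : 'I__ => \sum_(i < d.+1) w k * ((g i.+1 - g i) * (i < k)%N%:R))).
    rewrite exchange_big /=; apply: eq_bigr => i _.
    rewrite (eq_bigr (fun k : 'I__ => (g i.+1 - g i) * (w k * (i < k)%N%:R))); last first.
      by move=> k _; rewrite mulrCA.
    rewrite -mulr_sumr; congr (_ * _); rewrite -[X in _ = X - _]w1 /F.
    rewrite [X in _ - X](big_ord_widen d.+2 w); last by have := ltn_ord i; lia.
    rewrite [X in _ - X]big_mkcond -sumrB; apply: eq_bigr => k _; rewrite ltnS.
    by case: leqP; rewrite ?subrr ?subr0 ?mulr0 ?mulr1.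
  move=> k _; rewrite -mulr_sumr telescope_cut ?g0 ?subr0 //.
  by rewrite -ltnS.
rewrite -[X in _ - X]/(\sum_(k < d.+2) w k * g k) E1.
have -> : (\sum_(i < N.+1) quantile (i.+1%:R / N.+1%:R) ^+ j.+1) / N.+1%:R =
  \sum_(k < d.+1) (g k.+1 - g k) * ((\sum_(i < N.+1) (F k < i.+1%:R / N.+1%:R)%R%:R) / N.+1%:R).
  under eq_bigr do rewrite QE.
  rewrite exchange_big /= mulr_suml; apply: eq_bigr => k _.
  by rewrite -mulr_sumr mulrA.
rewrite -sumrB; under eq_bigr do rewrite -mulrBr.
apply: (le_trans (ler_norm_sum _ _ _)).
apply: (@le_trans _ _ (\sum_(k < d.+1) (g k.+1 - g k) * (k < d.+1)%N%:R * N.+1%:R^-1)).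
  apply: ler_sum => k _; rewrite ltn_ord mulr1 normrM ger0_norm // ler_wpM2l //.
  by apply: count_riemann; exact: F01.
by rewrite -mulr_suml telescope_cut // gd g0 subr0 mul1r.
Qed.

End Discrete.

(** The limit is taken of quantile functions rather than of measures. For fixed [N] a Riemann sum
    involves finitely many values of [Q], so the estimate passes to the pointwise limit. *)
Lemma hausdorff_limit (w : nat -> nat -> R) (c : nat -> R) (B : nat -> R) :
  (forall n k, 0 <= w n k) -> (forall n, \sum_(k < n.+2) w n k = 1) -> c 0%N = 1 ->
  (forall n j, `|\sum_(k < n.+2) w n k * (k%:R / n.+1%:R) ^+ j - c j| <= B j / n.+1%:R) ->
  exists Q : R -> R, [/\ {homo Q : x y / x <= y}, forall u, 0 <= Q u <= 1 &
    forall j N, `|(\sum_(i < N.+1) Q (i.+1%:R / N.+1%:R) ^+ j) / N.+1%:R - c j| <= N.+1%:R^-1].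
Proof.
move=> w0 w1 c0 wc; have [U [UU sU]] := ultraFilterLemma eventually_filter.
pose q n u := quantile n (w n) u.
have q01 n u : 0 <= q n u <= 1 by exact: quantile01.
have lim u : exists l : R, 0 <= l <= 1 /\ (q ^~ u) @ U --> l.
  by have [l l01 lU] := bounded_ultra_cvg UU (fun n => q01 n u); exists l.
pose Q u := projT1 (cid (lim u)).
have Q01 u : 0 <= Q u <= 1 by rewrite /Q; case: cid => /= l [].
have Qlim u : (q ^~ u) @ U --> Q u by rewrite /Q; case: cid => /= l [].
exists Q; split=> //.
  move=> u v uv; apply: ler_cvg_to (Qlim u) (Qlim v) _.
  by apply: filterS (@filterT _ U _) => n _; exact: quantile_homo.
move=> [|j] N.
  under eq_bigr do rewrite expr0.
  by rewrite sumr_const card_ord c0 divff ?pnatr_eq0 // subrr normr0 invr_ge0.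
have Slim : (fun n => `|(\sum_(i < N.+1) q n (i.+1%:R / N.+1%:R) ^+ j.+1) / N.+1%:R - c j.+1|) @ U
   --> `|(\sum_(i < N.+1) Q (i.+1%:R / N.+1%:R) ^+ j.+1) / N.+1%:R - c j.+1|.
  apply: cvg_norm; apply: cvgB; last exact: cvg_cst.
  apply: cvgMl; apply: cvg_big; first by move=> x; exact: add_continuous.
  move=> i _; apply: (@cvg_comp _ _ _ (fun n => q n (i.+1%:R / N.+1%:R)) (fun x : R => x ^+ j.+1)
    _ _ _ (Qlim _)).
  exact: (@exprn_continuous R j.+1).
apply/ler_addgt0Pr => e e0; apply: (cvgr_to_le Slim).
apply: sU; near=> n.
rewrite -[X in `|X - _|](subrK (\sum_(k < n.+2) w n k * (k%:R / n.+1%:R) ^+ j.+1)) -addrA.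
apply: (le_trans (ler_normD _ _)); apply: lerD; first exact: quantile_riemann.
apply: (le_trans (wc n j.+1)); rewrite ler_pdivrMr ?ltr0n //.
rewrite -ler_pdivrMl //; near: n; exists (Num.bound `|e^-1 * B j.+1|) => // n /= nb.
apply: (le_trans (ler_norm _)); apply: (le_trans (ltW (archi_boundP (normr_ge0 _)))).
by rewrite ler_nat; apply: leq_trans nb _.
Unshelve. all: by end_near.
Qed.

End QuantileLimit.

(** * Compactly supported probability measures *)

Section CompactSupport.
Variable R : realType.
Local Open Scope classical_set_scope.
Local Notation prob := (probability (measurableTypeR R) R).
Variables (mu : prob) (M : R).
Hypothesis muM : mu [set x : R | M < `|x|] = 0%E.
Implicit Types f g : R -> R.

Let K := [set x : R | `|x| <= M].

Let mN : measurable [set x : R | M < `|x|].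
Proof.
rewrite -[X in measurable X]setTI.
rewrite (_ : [set x | _] = Num.norm @^-1` `]M, +oo[); last first.
  by apply/seteqP; split=> x /=; rewrite in_itv /= andbT.
exact: normr_measurable.
Qed.

Let KE : setT `\` [set x : R | M < `|x|] = K.
Proof.
by apply/seteqP; split=> x /=; rewrite /K /= leNgt; [case=> _ /negP|move=> /negP].
Qed.

Let mK : measurable K.
Proof. by rewrite -KE; exact: measurableD. Qed.

Lemma csupp_integrable f B : measurable_fun setT f ->
  (forall x, `|x| <= M -> `|f x| <= B) -> mu.-integrable setT (EFin \o f).
Proof.
move=> mf fB; have mf' : measurable_fun setT (EFin \o f) by exact/measurable_EFinP.
have [_] := @negligible_integrable _ (measurableTypeR R) R mu setT _ _ mN measurableT mf' muM.
apply.
rewrite KE; apply: measurable_bounded_integrable => //.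
- exact: le_lt_trans (probability_le1 mu mK) (ltry _).
- exact: measurable_funTS.
- exists B; split; first exact: num_real.
  by move=> x Bx y /fB fy; apply: le_trans fy (ltW Bx).
Qed.

Lemma csupp_Rintegral f : mu.-integrable setT (EFin \o f) ->
  Rintegral mu setT f = Rintegral mu K f.
Proof.
move=> fi; congr fine; rewrite (@negligible_integral _ (measurableTypeR R) R mu _ _ _ mN measurableT fi muM).
by rewrite KE.
Qed.

Lemma csupp_le f g : mu.-integrable setT (EFin \o f) -> mu.-integrable setT (EFin \o g) ->
  (forall x, `|x| <= M -> f x <= g x) -> Rintegral mu setT f <= Rintegral mu setT g.
Proof.
move=> fi gi fg; rewrite !csupp_Rintegral //; apply: le_Rintegral => //.
- exact: integrableS fi.
- exact: integrableS gi.
Qed.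

Lemma Rintegral_prob_cst c : Rintegral mu setT (fun=> c) = c.
Proof.
transitivity (c * fine (mu [set: measurableTypeR R])).
  exact: (@Rintegral_cst _ (measurableTypeR R) R mu setT measurableT).
by rewrite (probability_setT mu) mulr1.
Qed.

Lemma csupp_norm f B : measurable_fun setT f ->
  (forall x, `|x| <= M -> `|f x| <= B) -> `|Rintegral mu setT f| <= B.
Proof.
move=> mf fB; have fi := csupp_integrable mf fB.
have ci c : mu.-integrable setT (EFin \o (fun=> c : R)).
  by apply: (@csupp_integrable _ `|c|).
rewrite ler_norml; apply/andP; split.
  rewrite -[leLHS]Rintegral_prob_cst; apply: csupp_le => // x /fB.
  by rewrite ler_norml => /andP[].
rewrite -[leRHS]Rintegral_prob_cst; apply: csupp_le => // x /fB.
by rewrite ler_norml => /andP[].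
Qed.

Lemma horner_measurable (p : {poly R}) : measurable_fun setT (fun x : R => p.[x]).
Proof.
apply: continuous_measurable_fun; rewrite -[X in continuous X]/(horner p).
exact: continuous_horner.
Qed.

Lemma csupp_horner_bound (p : {poly R}) : exists B, forall x, `|x| <= M -> `|p.[x]| <= B.
Proof.
exists (\sum_(i < size p) `|p`_i| * `|M| ^+ i) => x xM.
rewrite horner_coef; apply: (le_trans (ler_norm_sum _ _ _)); apply: ler_sum => i _.
rewrite normrM normrX ler_wpM2l //; apply: lerXn2r; rewrite ?nnegrE //.
exact: le_trans xM (ler_norm _).
Qed.

Lemma csupp_horner_integrable (p : {poly R}) : mu.-integrable setT (EFin \o (fun x => p.[x])).
Proof.
have [B pB] := csupp_horner_bound p; exact: csupp_integrable (horner_measurable p) pB.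
Qed.

Lemma csupp_Xn_integrable c k : mu.-integrable setT (EFin \o (fun x => c * x ^+ k)).
Proof.
have := csupp_horner_integrable (c *: 'X^k).
by under eq_fun do rewrite hornerZ hornerXn.
Qed.

Lemma csupp_moment_sum (c : nat -> R) n :
  Rintegral mu setT (fun x => \sum_(i < n) c i * x ^+ i) = \sum_(i < n) c i * moment mu i.
Proof.
have ii k : mu.-integrable setT (EFin \o (fun x => \sum_(i < k) c i * x ^+ i)).
  have := csupp_horner_integrable (\poly_(i < k) c i).
  by under eq_fun do rewrite horner_poly.
elim: n => [|n IH].
  rewrite big_ord0; under eq_Rintegral do rewrite big_ord0.
  exact: Rintegral_prob_cst.
transitivity (Rintegral mu setT (fun x => (\sum_(i < n) c i * x ^+ i) + c n * x ^+ n)).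
  by apply: eq_Rintegral => x _; rewrite big_ord_recr.
rewrite RintegralD //; last exact: csupp_Xn_integrable.
rewrite IH big_ord_recr; congr (_ + _); rewrite /moment -RintegralZl //.
have := csupp_Xn_integrable 1 n; by under eq_fun do rewrite mul1r.
Qed.

Lemma csupp_Lf (p : {poly R}) : Rintegral mu setT (fun x => p.[x]) = Lf (moment mu) p.
Proof.
under eq_Rintegral do rewrite horner_coef.
exact: csupp_moment_sum.
Qed.

Lemma csupp_nnegf : nnegf (moment mu).
Proof. by move=> p p0; rewrite -csupp_Lf; apply: Rintegral_ge0 => x _; exact: p0. Qed.

Lemma csupp_moment_bound n : `|moment mu n| <= `|M| ^+ n.
Proof.
apply: csupp_norm => [|x xM]; first exact: exprn_measurable.
by rewrite normrX; apply: lerXn2r; rewrite ?nnegrE //; exact: le_trans xM (ler_norm _).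
Qed.

Lemma moment0 : moment mu 0 = 1.
Proof. exact: Rintegral_prob_cst. Qed.

Lemma csupp_growth : growth (moment mu).
Proof. by exists 1, `|M| => n; rewrite mul1r; exact: csupp_moment_bound. Qed.

End CompactSupport.

(** * Existence of a measure with given moments *)

Section MomentProblem.
Variable R : realType.
Local Open Scope classical_set_scope.
Local Notation prob := (probability (measurableTypeR R) R).
Local Notation leb := (@lebesgue_measure R).

Section Riemann.
Variable f : R -> R.
Hypotheses (fhomo : {homo f : x y / x <= y}) (f01 : forall u, 0 <= f u <= 1).

Let mf : measurable_fun setT f.
Proof. exact: nondecreasing_measurable. Qed.

Let fi (i : interval R) : (leb [set` i] < +oo)%E -> leb.-integrable [set` i] (EFin \o f).
Proof.
move=> ifin; apply: measurable_bounded_integrable => //; first exact: measurable_funTS.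
exists 1; split; first exact: num_real.
move=> x x1 y _ /=; rewrite ger0_norm; last by case/andP: (f01 y).
by apply: le_trans (ltW x1); case/andP: (f01 y).
Qed.

Let itv_fin (b0 b1 : bool) (a b : R) :
  (leb [set` Interval (BSide b0 a) (BSide b1 b)] < +oo)%E.
Proof. by rewrite lebesgue_measure_itv /=; case: ifP => // _; rewrite -EFinB ltry. Qed.

Let piece (a b : R) : a < b ->
  f a * (b - a) <= Rintegral leb `]a, b] f <= f b * (b - a).
Proof.
move=> ab; have mab : fine (leb `]a, b]) = b - a.
  by rewrite lebesgue_measure_itv /= lte_fin ab.
have ci c : leb.-integrable `]a, b] (EFin \o (fun=> c : R)).
  apply: measurable_bounded_integrable => //; first exact: itv_fin.
  exact: bounded_cst.
have cE c : Rintegral leb `]a, b] (fun=> c) = c * (b - a).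
  by rewrite Rintegral_cst // mab.
apply/andP; split; rewrite -cE; apply: le_Rintegral => //; try (exact/fi/itv_fin);
  move=> x /=; rewrite in_itv /= => /andP[ax xb]; apply: fhomo => //; exact: ltW.
Qed.

(** For a monotone function the lower and upper sums differ by [(f 1 - f 0) / N.+1]. *)
Lemma mono_riemann N :
  `|Rintegral leb `[0, 1] f - (\sum_(i < N.+1) f (i.+1%:R / N.+1%:R)) / N.+1%:R|
    <= N.+1%:R^-1.
Proof.
set M : R := N.+1%:R; have M0 : 0 < M by rewrite ltr0n.
pose I l := Rintegral leb `[0, l%:R / M] f.
have IS l : f (l%:R / M) / M <= I l.+1 - I l <= f (l.+1%:R / M) / M.
  have ll : l%:R / M < l.+1%:R / M by rewrite ltr_pM2r ?invr_gt0 // ltr_nat.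
  have := piece ll; have -> : l.+1%:R / M - l%:R / M = M^-1.
    by rewrite -mulrBl -natr1 addrAC subrr add0r mul1r.
  suff -> : I l.+1 - I l = Rintegral leb `]l%:R / M, l.+1%:R / M] f by [].
  apply: Rintegral_itvB; first exact/fi/itv_fin.
  - by rewrite bnd_simp divr_ge0 // ltW.
  - by rewrite bnd_simp ltW.
have bounds l : (\sum_(i < l) f (i%:R / M)) / M <= I l <= (\sum_(i < l) f (i.+1%:R / M)) / M.
  elim: l => [|l /andP[h1 h2]].
    by rewrite !big_ord0 /I !mul0r set_itv1 Rintegral_set1 lexx.
  have /andP[s1 s2] := IS l; rewrite !big_ord_recr /= !mulrDl.
  rewrite -[I l.+1](subrK (I l)) [X in X <= _ <= _]addrC [X in _ <= _ <= X]addrC.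
  by rewrite !lerD.
have /andP[] := bounds N.+1; rewrite -/M.
have -> : Rintegral leb `[0, 1] f = I N.+1 by rewrite /I divff ?gt_eqF.
set s := \sum_(i < N.+1) f (i.+1%:R / M).
have -> : \sum_(i < N.+1) f (i%:R / M) = s - (f 1 - f 0).
  rewrite /s [LHS]big_ord_recl [in RHS]big_ord_recr /= mul0r -/M divff ?gt_eqF //.
  by rewrite opprB -addrA [f 1 + (_ - _)]addrC subrK addrC.
move=> h1 h2; have h3 : (f 1 - f 0) / M <= M^-1.
  rewrite -[leRHS]mul1r ler_pM2r ?invr_gt0 //.
  by have /andP[? ?] := f01 1; have /andP[? ?] := f01 0; lra.
have h4 : 0 < M^-1 by rewrite invr_gt0.
rewrite mulrBl in h1; rewrite ler_norml; apply/andP.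
move: (s / M) ((f 1 - f 0) / M) (M^-1) (I N.+1) h1 h2 h3 h4 => *; split; lra.
Qed.

End Riemann.

Lemma le_invn_eq (x y K : R) : (forall n : nat, `|x - y| <= K / n.+1%:R) -> x = y.
Proof.
move=> h; apply/eqP; rewrite -subr_eq0 -normr_eq0; apply/negPn/negP => n0.
have x0 : 0 < `|x - y| by rewrite lt_neqAle eq_sym n0 normr_ge0.
have := h (Num.bound `|K / `|x - y| |); rewrite leNgt => /negP; apply.
rewrite ltr_pdivrMr ?ltr0n // mulrC -ltr_pdivrMr //.
apply: le_lt_trans (ler_norm _) _; apply: lt_le_trans (archi_boundP (normr_ge0 _)) _.
by rewrite ler_nat.
Qed.

(** For every [N], the integral and [c j] are both within [1 / N.+1] of the same Riemann sum. *)
Lemma monotone_rearrangement (w : nat -> nat -> R) (c : nat -> R) (B : nat -> R) :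
  (forall n k, 0 <= w n k) -> (forall n, \sum_(k < n.+2) w n k = 1) -> c 0%N = 1 ->
  (forall n j, `|\sum_(k < n.+2) w n k * (k%:R / n.+1%:R) ^+ j - c j| <= B j / n.+1%:R) ->
  exists2 Q : R -> R, {homo Q : x y / x <= y} /\ (forall u, 0 <= Q u <= 1) &
    forall j, Rintegral leb `[0, 1] (fun u => Q u ^+ j) = c j.
Proof.
move=> w0 w1 c0 wc; have [Q [Qh Q01 Qr]] := hausdorff_limit w0 w1 c0 wc.
exists Q => // j; apply: (@le_invn_eq _ _ 2) => N.
have Qj : {homo (fun u => Q u ^+ j) : x y / x <= y}.
  move=> x y xy; apply: lerXn2r; rewrite ?nnegrE; last exact: Qh.
    by case/andP: (Q01 x).
  by case/andP: (Q01 y).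
have Qj01 u : 0 <= Q u ^+ j <= 1.
  by have /andP[? ?] := Q01 u; rewrite exprn_ge0 //= exprn_ile1.
have h1 := mono_riemann Qj Qj01 N; have h2 := Qr j N.
rewrite -[X in `|X - _|](subrK ((\sum_(i < N.+1) Q (i.+1%:R / N.+1%:R) ^+ j) / N.+1%:R)).
rewrite -addrA; apply: (le_trans (ler_normD _ _)); rewrite mulrDl !mul1r.
exact: lerD.
Qed.

(** The measure is the image of the uniform law on [[0, 1]] under [C (2 Q - 1)], where [Q] is the
    limit quantile function of the moments rescaled to [[0, 1]]. *)
Lemma moment_problem (m : nat -> R) : psd m -> growth m -> m 0%N = 1 ->
  exists2 mu : prob, compact_supp mu & forall n, moment mu n = m n.
Proof.
move=> pm [K0 [C0 mK0]] m0.
pose C := `|C0| + 1; pose K := `|K0|; have C0' : 0 < C by rewrite ltr_wpDl.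
have mK n : `|m n| <= K * C ^+ n.
  apply: (le_trans (mK0 n)); apply: (le_trans (ler_norm _)); rewrite normrM normrX.
  by rewrite ler_wpM2l //; apply: lerXn2r; rewrite ?nnegrE ?(ltW C0') // /C lerDl.
(* Level [n.+1], so that the grid points [k / n.+1] are meaningful for every [n]. *)
pose w n k := hweight m C n.+1 k.
have [||||Q [Qh Q01] Qm] := @monotone_rearrangement w (hmom m C)
    (fun j => (j ^ 2)%:R * (1 + hmom m C j)).
- by move=> n k; exact: (hweight_ge0 pm C0' mK).
- move=> n; have := hweight_ffact m C0' n.+1 0.
  rewrite ffactn0 mul1r hmom0 // => <-.
  by apply: eq_bigr => k _; rewrite ffactn0 mulr1.
- exact: hmom0.
- by move=> n j; rewrite mulrAC; exact: (hweight_moment pm C0' mK m0).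
pose U := uniform_prob (@ltr01 R).
pose X (u : R) : R := C * (2 * Q u - 1).
have XC u : `|X u| <= C.
  have /andP[? ?] := Q01 u; rewrite /X normrM (gtr0_norm C0') ger_pMr //.
  by rewrite ler_norml; apply/andP; split; lra.
have mQ : measurable_fun setT Q by exact: nondecreasing_measurable.
have mX : measurable_fun setT X.
  apply: nondecreasing_measurable => // u v uv; rewrite ler_pM2l // lerB // ler_pM2l //.
  exact: Qh.
pose XX : {mfun measurableTypeR R >-> measurableTypeR R} :=
  MeasurableFun.Pack (MeasurableFun.Class (isMeasurableFun.Build _ _ (measurableTypeR R) (measurableTypeR R) X mX)).
pose mu : prob := distribution U XX.
have bint (g : R -> R) (B : R) : measurable_fun setT g -> (forall u, `|g u| <= B) ->
    U.-integrable setT (EFin \o g).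
  move=> mg gB; apply: measurable_bounded_integrable => //.
  - exact: le_lt_trans (probability_le1 U measurableT) (ltry _).
  - exists B; split; first exact: num_real.
    by move=> x Bx y _; apply: le_trans (gB y) (ltW Bx).
have QU j : Rintegral U setT (fun u => Q u ^+ j) = hmom m C j.
  rewrite -Qm /Rintegral; congr fine.
  rewrite integral_uniform ?subr0 ?invr1 ?mul1e //.
  - by apply/measurable_EFinP; exact: measurable_funX.
  - by move=> u; rewrite lee_fin exprn_ge0 //; case/andP: (Q01 u).
exists mu.
  exists C; rewrite /= /mu /distribution /pushforward /=.
  rewrite (_ : X @^-1` _ = set0) ?measure0 //.
  by apply/seteqP; split=> // u /=; rewrite ltNge XC.
move=> n.
have -> : moment mu n = Rintegral U setT (fun u => X u ^+ n).
  rewrite /moment /Rintegral; congr fine.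
  rewrite /mu integral_distribution //.
  - by apply/measurable_EFinP; exact: exprn_measurable.
  - apply: (@bint (fun u => X u ^+ n) (C ^+ n)); first exact: measurable_funX.
    by move=> u; rewrite normrX; apply: lerXn2r; rewrite ?nnegrE ?(ltW C0').
(* The inverse of the affine rescaling: composing it with that map gives [X] back. *)
pose p : {poly R} := C *: (2 *: 'X - 1).
have lin (k : nat) (a : nat -> R) :
    Rintegral U setT (fun u => \sum_(i < k) a i * Q u ^+ i) = \sum_(i < k) a i * hmom m C i.
  have Qi (b : R) i : U.-integrable setT (EFin \o (fun u => b * Q u ^+ i)).
    apply: (@bint _ `|b|); first by apply: measurable_funM => //; exact: measurable_funX.
    move=> u; rewrite normrM ler_piMr // normrX exprn_ile1 //.
    by have /andP[? ?] := Q01 u; rewrite ger0_norm.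
  have Si l : U.-integrable setT (EFin \o (fun u => \sum_(i < l) a i * Q u ^+ i)).
    apply: (@bint _ (\sum_(i < l) `|a i|)) => [|u].
      rewrite (_ : (fun u => _) = (fun x : R => (\poly_(i < l) a i).[x]) \o Q).
        exact: measurableT_comp (horner_measurable _) mQ.
      by apply/funext => u /=; rewrite horner_poly.
    apply: (le_trans (ler_norm_sum _ _ _)); apply: ler_sum => i _.
    rewrite normrM ler_piMr // normrX exprn_ile1 //.
    by have /andP[? ?] := Q01 u; rewrite ger0_norm.
  elim: k => [|k IH].
    rewrite big_ord0; under eq_Rintegral do rewrite big_ord0.
    by rewrite Rintegral_cst // mul0r.
  transitivity (Rintegral U setT (fun u => (\sum_(i < k) a i * Q u ^+ i) + a k * Q u ^+ k)).
    by apply: eq_Rintegral => x _; rewrite big_ord_recr.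
  rewrite RintegralD // IH big_ord_recr; congr (_ + _).
  rewrite RintegralZl ?QU //.
  by have := Qi 1 k; under eq_fun do rewrite mul1r.
transitivity (\sum_(i < size (p ^+ n)) (p ^+ n)`_i * hmom m C i).
  rewrite -lin; apply: eq_Rintegral => u _; rewrite -horner_coef horner_exp.
  by rewrite /p hornerZ hornerD hornerN hornerZ hornerX hornerC.
transitivity (Lf m ((p ^+ n) \Po ((2 * C)^-1 *: ('X + C%:P)))).
  rewrite comp_polyE Lf_sum; apply: eq_bigr => i _.
  by rewrite LfZ.
have -> : (p ^+ n) \Po ((2 * C)^-1 *: ('X + C%:P)) = 'X^n.
  rewrite rmorphXn /=; congr (_ ^+ _).
  rewrite /p !linearZ /= linearB /= linearZ /= comp_polyX rmorph1 scalerA -!mul_polyC.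
  have -> : 2 * (2 * C)^-1 = C^-1 by field; rewrite gt_eqF.
  rewrite mulrBr mulr1 mulrDr mulrDr mulrA -polyCM divff ?gt_eqF // mul1r mulrA -polyCM.
  by rewrite divff ?gt_eqF // mul1r addrK.
exact: LfXn.
Qed.

End MomentProblem.

(** * Moments determine a compactly supported measure *)

Section Determinacy.
Variable R : realType.
Local Open Scope classical_set_scope.
Local Notation prob := (probability (measurableTypeR R) R).

Lemma bernoulli_sub (t : R) n : 0 <= t <= 1 -> 1 - n%:R * t <= (1 - t) ^+ n.
Proof.
move=> /andP[t0 t1]; elim: n => [|n IH]; first by rewrite mul0r subr0 expr0.
rewrite exprS; apply: le_trans (_ : (1 - t) * (1 - n%:R * t) <= _); last first.
  by rewrite ler_wpM2l // subr_ge0.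
rewrite -subr_ge0 -natr1.
have -> : (1 - t) * (1 - n%:R * t) - (1 - (n%:R + 1) * t) = n%:R * t ^+ 2 by ring.
by rewrite mulr_ge0 // exprn_ge0.
Qed.

(** With [y] the affine image of [x] in [[0, 1]] that sends the midpoint of [a], [b] to 1/2, the
    polynomial [(1 - y^n)^(2^n)] works. It is at least [1 - (2 y)^n] by Bernoulli, and at most
    [1 / (1 + y^n)^(2^n) <= 1 / (2 y)^n]; these decide the sides [y < 1/2] and [y > 1/2]. *)
Lemma poly_cutoff (M a b e : R) : 0 <= M -> a < b -> 0 < e ->
  exists p : {poly R}, forall x, `|x| <= M ->
    [/\ 0 <= p.[x] <= 1, x <= a -> 1 - e <= p.[x] & b <= x -> p.[x] <= e].
Proof.
move=> M0 ab e0; pose L := M + `|a| + `|b| + 1.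
have na := normr_ge0 a; have nb := normr_ge0 b.
have [la lb] := (ler_norm a, ler_norm b).
have [la' lb'] : - `|a| <= a /\ - `|b| <= b by rewrite !lerNnormlW.
have L0 : 0 < L by rewrite /L; lra.
pose c := (a + b) / 2.
pose Y : {poly R} := (2^-1)%:P + (4 * L)^-1 *: ('X - c%:P).
have YE x : Y.[x] = 2^-1 + (x - c) / (4 * L).
  by rewrite /Y !hornerE mulrC.
pose d := (b - a) / (8 * L).
have d0 : 0 < d by rewrite divr_gt0 ?subr_gt0 // mulr_gt0.
have dL : d * (4 * L) = (b - a) / 2 by rewrite /d; field; rewrite gt_eqF.
have dle : d <= 4^-1.
  by rewrite ler_pdivrMr ?mulr_gt0 // /L; lra.
have [|n1 hn1] := @exp_unbounded R (1 - 2 * d)^-1 e^-1.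
  by rewrite invf_gt1; lra.
have [|n2 hn2] := @exp_unbounded R (1 + 2 * d) e^-1.
  by lra.
pose n := (maxn n1 n2).+1.
have {}hn1 : (1 - 2 * d) ^+ n <= e.
  have := hn1 n (leqW (leq_maxl _ _)); rewrite exprVn ltf_pV2 ?posrE ?exprn_gt0 //; last by lra.
  exact: ltW.
have {}hn2 : ((1 + 2 * d) ^+ n)^-1 <= e.
  have := hn2 n (leqW (leq_maxr _ _)); rewrite -[e in X in _ -> X]invrK.
  rewrite lef_pV2 ?posrE ?invr_gt0 ?exprn_gt0 //; last by lra.
  exact: ltW.
exists ((1 - Y ^+ n) ^+ (2 ^ n)) => x xM.
have xM1 := ler_norm x; have xM2 : - `|x| <= x by rewrite lerNnormlW.
have L4 : 0 < 4 * L by rewrite mulr_gt0.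
rewrite horner_exp hornerD hornerN hornerC horner_exp.
set y := Y.[x].
have y01 : 0 <= y <= 1.
  apply/andP; split; rewrite /y YE -subr_ge0 ?subr0.
    rewrite -(pmulr_rge0 _ L4) mulrDr mulrCA divff ?gt_eqF // mulr1 /L /c; lra.
  rewrite opprD addrA -(pmulr_rge0 _ L4) mulrBr mulrCA divff ?gt_eqF // mulr1 /L /c; lra.
have /andP[y0 y1] := y01.
have yn01 : 0 <= y ^+ n <= 1 by rewrite exprn_ge0 //= exprn_ile1.
have /andP[yn0 yn1] := yn01.
split.
- by rewrite exprn_ge0 ?subr_ge0 //= exprn_ile1 ?subr_ge0 // gerBl.
- move=> xa; apply: le_trans (bernoulli_sub _ yn01).
  rewrite lerB // natrX -exprMn; apply: le_trans hn1.
  apply: lerXn2r; rewrite ?nnegrE; [by rewrite mulr_ge0|by lra|].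
  suff : y <= 2^-1 - d by lra.
  by rewrite /y YE lerD2l ler_pdivrMr // mulNr dL /c; lra.
- move=> bx; apply: le_trans hn2.
  have y2 : 1 + 2 * d <= 2 * y.
    suff : 2^-1 + d <= y by lra.
    by rewrite /y YE lerD2l ler_pdivlMr // dL /c; lra.
  have p0 : 0 < (1 + 2 * d) ^+ n by rewrite exprn_gt0 //; lra.
  rewrite -[leRHS]mul1r ler_pdivlMr //.
  have t0 : 0 <= (1 - y ^+ n) ^+ (2 ^ n) by rewrite exprn_ge0 // subr_ge0.
  apply: (@le_trans _ _ ((1 - y ^+ n) ^+ (2 ^ n) * (1 + y ^+ n) ^+ (2 ^ n))).
    rewrite ler_wpM2l //; apply: le_trans (bernoulli_ineq (2 ^ n) yn0).
    rewrite ler_wpDl // natrX -exprMn; apply: lerXn2r; rewrite ?nnegrE //; last by rewrite mulr_ge0.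
    by lra.
  rewrite -exprMn -subr_sqr expr1n exprn_ile1 // ?subr_ge0 ?gerBl ?exprn_ge0 //.
  by rewrite exprn_ile1.
Qed.

Lemma Rintegral_prob_indic (mu : prob) (A : set R) : measurable A ->
  Rintegral mu setT (\1_A : R -> R) = fine (mu A).
Proof. by move=> mA; rewrite /Rintegral integral_indic // setIT. Qed.

(** A cutoff polynomial fits, up to [e / 2], between the indicators of the two half-lines, and has
    the same integral for both measures. *)
Lemma moments_le (mu nu : prob) a b : compact_supp mu -> compact_supp nu ->
  (forall n, moment mu n = moment nu n) -> a < b ->
  (mu `]-oo, a] <= nu `]-oo, b[)%E.
Proof.
move=> [M1 hM1] [M2 hM2] mn ab.
have widen (P : prob) M M' : M <= M' -> P [set x : R | M < `|x|] = 0%E ->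
    P [set x : R | M' < `|x|] = 0%E.
  move=> MM PM; apply/eqP; rewrite eq_le measure_ge0 andbT -PM.
  have mS c : measurable [set x : R | c < `|x|].
    rewrite -[X in measurable X]setTI.
    rewrite (_ : [set x | _] = Num.norm @^-1` `]c, +oo[); last first.
      by apply/seteqP; split=> x /=; rewrite in_itv /= andbT.
    exact: normr_measurable.
  apply: le_measure; [apply/mem_set; exact: mS|apply/mem_set; exact: mS|].
  by move=> x /=; exact: le_lt_trans.
pose M := `|M1| + `|M2|.
have hM1' : mu [set x : R | M < `|x|] = 0%E.
  by apply: widen hM1; apply: le_trans (ler_norm _) _; rewrite lerDl.
have hM2' : nu [set x : R | M < `|x|] = 0%E.
  by apply: widen hM2; apply: le_trans (ler_norm _) _; rewrite lerDr.
have fin (P : prob) A : measurable A -> P A \is a fin_num.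
  by move=> mA; exact: fin_num_measure.
rewrite -(fineK (fin mu `]-oo, a] (measurable_itv _))).
rewrite -(fineK (fin nu `]-oo, b[ (measurable_itv _))) lee_fin.
apply/ler_addgt0Pr => e e0.
have e2 : 0 < e / 2 by rewrite divr_gt0.
have [p hp] := @poly_cutoff M a b (e / 2) (addr_ge0 (normr_ge0 _) (normr_ge0 _)) ab e2.
have ipm : Rintegral mu setT (fun x => p.[x]) = Rintegral nu setT (fun x => p.[x]).
  by rewrite (csupp_Lf hM1') (csupp_Lf hM2'); apply: eq_bigr => i _; rewrite mn.
have i1 (P : prob) (A : set R) c : measurable A -> P [set x : R | M < `|x|] = 0%E ->
    P.-integrable setT (EFin \o (fun x => \1_A x - c : R)).
  move=> mA hP; apply: (csupp_integrable hP (B := 1 + `|c|)).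
    by apply: measurable_funB => //; exact: measurable_indic.
  move=> x _; apply: (le_trans (ler_normB _ _)); rewrite lerD2r indicE.
  by case: (_ \in _); rewrite ?normr1 ?normr0.
have E (P : prob) (A : set R) c : measurable A -> P [set x : R | M < `|x|] = 0%E ->
    Rintegral P setT (fun x => \1_A x - c : R) = fine (P A) - c.
  move=> mA hP; rewrite RintegralB //.
  - by rewrite Rintegral_prob_indic // Rintegral_prob_cst.
  - have := i1 P A 0 mA hP; congr (_.-integrable _ _).
    by apply/funext => x /=; rewrite subr0.
  - exact: (csupp_integrable hP (B := `|c|)).
suff : fine (mu `]-oo, a]) - e / 2 <= fine (nu `]-oo, b[) - - (e / 2) by lra.
rewrite -(E mu) // -(E nu) //.
apply: (@le_trans _ _ (Rintegral mu setT (fun x => p.[x]))).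
  apply: (csupp_le hM1'); [exact: i1|exact: (csupp_horner_integrable hM1')|].
  move=> x /hp[/andP[p0 p1] pa _]; rewrite indicE; case: (boolP (x \in _)).
    by rewrite inE /= in_itv /= => /pa.
  by move=> _; rewrite sub0r; apply: le_trans p0; rewrite oppr_le0 ltW.
rewrite ipm; apply: (csupp_le hM2'); [exact: (csupp_horner_integrable hM2')|exact: i1|].
move=> x /hp[/andP[p0 p1] _ pb]; rewrite opprK indicE; case: (boolP (x \in _)).
  by move=> _; apply: le_trans p1 _; rewrite lerDl ltW.
by rewrite notin_setE /= in_itv /= => /negP; rewrite -leNgt add0r; exact: pb.
Qed.

(** Open half-lines are increasing unions of closed ones with smaller endpoint, so the previous
    inequality, used both ways, gives equality on them; they form a generating family stable under
    intersection. *)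
Lemma moments_unique (mu nu : prob) : compact_supp mu -> compact_supp nu ->
  (forall n, moment mu n = moment nu n) -> meas_eq mu nu.
Proof.
move=> cm cn mn.
have le (P Q : prob) x : compact_supp P -> compact_supp Q ->
    (forall n, moment P n = moment Q n) -> (P `]-oo, x[ <= Q `]-oo, x[)%E.
  move=> cP cQ PQ; pose F n : set R := `]-oo, x - n.+1%:R^-1].
  have UF : \bigcup_n F n = `]-oo, x[.
    apply/seteqP; split=> y /=; rewrite /F.
      move=> [n _]; rewrite /= !in_itv /= => yn; apply: le_lt_trans yn _.
      by rewrite gtrBl invr_gt0 ltr0n.
    rewrite in_itv /= => yx; have /ltr_add_invr[n] := yx => h.
    by exists n => //; rewrite /= in_itv /= lerBrDr ltW.
  have cv : P \o F @ \oo --> P (\bigcup_n F n).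
    apply: nondecreasing_cvg_mu.
    - by move=> n; exact: measurable_itv.
    - by rewrite UF; exact: measurable_itv.
    - move=> n l nl; apply/subsetPset => y; rewrite /F /= !in_itv /= => h; apply: le_trans h _.
      by rewrite lerB // lef_pV2 ?posrE ?ltr0n // ler_nat.
  rewrite -UF; apply: (cvge_to_le cv); apply: nearW => n /=.
  apply: le_trans (moments_le (b := x) cP cQ PQ _) _; first by rewrite gtrBl invr_gt0 ltr0n.
  by rewrite UF.
move=> S mS.
apply: (@measure_unique _ R (measurableTypeR R) (@RGenInftyO.G R) (fun n => `]-oo, n%:R[)
  _ _ _ _ mu nu) => //.
- exact: RGenInftyO.measurableE.
- move=> A B [x ->] [y ->]; exists (Num.min x y).
  by apply/seteqP; split=> z /=; rewrite !in_itv /= lt_min; [case=> -> ->|move=> /andP[]].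
- by move=> n; exists n%:R.
- apply/seteqP; split=> // x _; exists (Num.bound `|x|) => //=; rewrite in_itv /=.
  exact: le_lt_trans (ler_norm _) (archi_boundP (normr_ge0 _)).
- by move=> A [x ->]; apply/eqP; rewrite eq_le !le.
- by move=> n; exact: le_lt_trans (probability_le1 mu (measurable_itv _)) (ltry _).
Qed.

(** Instead of decomposing [p] into squares, [s] divided by its mass is realised as the moments of a
    measure, against which [p] is integrated. If the mass is zero, Cauchy-Schwarz makes [s]
    vanish. *)
Lemma psd_growth_nnegf (s : nat -> R) : psd s -> growth s -> nnegf s.
Proof.
move=> ps gs p p0; have s0 : 0 <= s 0%N by have := ps 1; rewrite mulr1 Lf1.
have [s00|sn0] := eqVneq (s 0%N) 0.
  suff sz n : s n = 0 by rewrite /Lf big1 // => i _; rewrite sz mulr0.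
  have := psd_CS 1 'X^n ps; rewrite mul1r mulr1 LfXn Lf1 s00 mul0r => h.
  by apply/eqP; rewrite -sqrf_eq0; apply/eqP/le_anti; rewrite h sqr_ge0.
have {}s0 : 0 < s 0%N by rewrite lt_neqAle eq_sym sn0.
pose t n := (s 0%N)^-1 * s n.
have tE r : Lf t r = (s 0%N)^-1 * Lf s r.
  by rewrite /Lf mulr_sumr; apply: eq_bigr => i _; rewrite mulrCA.
have [|||mu [M muM] tm] := @moment_problem R t.
- by move=> r; rewrite tE mulr_ge0 ?invr_ge0 ?(ltW s0).
- have [K [C sK]] := gs; exists ((s 0%N)^-1 * K), C => n.
  by rewrite normrM ger0_norm ?invr_ge0 ?(ltW s0) // -mulrA ler_pM2l ?invr_gt0.
- by rewrite /t mulVf.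
have := csupp_nnegf muM p0; rewrite (_ : Lf (moment mu) p = Lf t p); last first.
  by apply: eq_bigr => i _; rewrite tm.
by rewrite tE pmulr_rge0 // invr_gt0.
Qed.

End Determinacy.

(** * Moments of the beta density *)

Section BetaMoments.
Variable R : realType.
Local Open Scope classical_set_scope.
Local Notation leb := (@lebesgue_measure R).

Section OpenUnitInterval.
Implicit Types F f : R -> R.

(** Endpoints are kept inside the open interval: the beta density is unbounded at 0 for [q > 0] and
    at 1 for [q < 0]. *)
Lemma FTC_unit F f (a b : R) : 0 < a -> a < b -> b < 1 ->
  (forall x : R, 0 < x < 1 -> is_derive x 1 F (f x)) ->
  (forall x : R, 0 < x < 1 -> {for x, continuous f}) ->
  Rintegral leb `[a, b] f = F b - F a.
Proof.
move=> a0 ab b1 dF cf.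
have cF (x : R) : 0 < x < 1 -> {for x, continuous F}.
  by move=> /dF d; apply: differentiable_continuous; apply/derivable1_diffP; case: d.
have inab (x : R) : a <= x <= b -> 0 < x < 1.
  by move=> /andP[ax xb]; rewrite (lt_le_trans a0 ax) (le_lt_trans xb b1).
have ina : 0 < a < 1 by rewrite a0 (lt_trans ab).
have inb : 0 < b < 1 by rewrite b1 (lt_trans a0).
rewrite /Rintegral (@continuous_FTC2 _ f F) //.
- apply/continuous_within_itvP => //; split.
  + by move=> x; rewrite in_itv /= => /andP[/ltW ax /ltW xb]; apply/cf/inab/andP.
  + by apply: cvg_at_right_filter; exact: cf.
  + by apply: cvg_at_left_filter; exact: cf.
- split.
  + by move=> x; rewrite in_itv /= => /andP[/ltW ax /ltW xb]; case: (dF x) => //; apply/inab/andP.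
  + by apply: cvg_at_right_filter; exact: cF.
  + by apply: cvg_at_left_filter; exact: cF.
- move=> x; rewrite in_itv /= => /andP[/ltW ax /ltW xb].
  by rewrite derive1E; case: (dF x) => //; apply/inab/andP.
Qed.

Lemma cont_unit_integrable f (a b : R) : 0 < a -> a < b -> b < 1 ->
  (forall x : R, 0 < x < 1 -> {for x, continuous f}) -> leb.-integrable `[a, b] (EFin \o f).
Proof.
move=> a0 ab b1 cf; apply: continuous_compact_integrable; first exact: segment_compact.
apply/continuous_within_itvP => //; split.
- move=> x; rewrite in_itv /= => /andP[ax xb]; apply: cf.
  by rewrite (lt_trans a0 ax) (lt_trans xb b1).
- by apply: cvg_at_right_filter; apply: cf; rewrite a0 (lt_trans ab).
- by apply: cvg_at_left_filter; apply: cf; rewrite b1 (lt_trans a0).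
Qed.

(** Margins of the intervals exhausting the open unit interval; starting at 1/3 keeps them
    non-degenerate. *)
Definition eun (n : nat) : R := n.+3%:R^-1.

Lemma eun_bounds n : [/\ 0 < eun n, eun n < 1 - eun n & 1 - eun n < 1].
Proof.
have e0 : 0 < eun n by rewrite invr_gt0 ltr0n.
have e3 : eun n <= 3^-1 by rewrite lef_pV2 ?posrE ?ltr0n // ler_nat.
by split => //; lra.
Qed.

Let E n : set R := `[eun n, 1 - eun n].

Lemma eun_nonincr n l : (n <= l)%N -> eun l <= eun n.
Proof. by move=> nl; rewrite lef_pV2 ?posrE ?ltr0n // ler_nat !ltnS. Qed.

Lemma eun_small (e : R) : 0 < e -> exists N, forall n, (N <= n)%N -> eun n < e.
Proof.
move=> e0; exists (Num.bound `|e^-1|) => n Nn.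
rewrite -[e]invrK ltf_pV2 ?posrE ?invr_gt0 ?ltr0n //.
apply: le_lt_trans (ler_norm _) _; apply: lt_le_trans (archi_boundP (normr_ge0 _)) _.
by rewrite ler_nat; apply: leq_trans Nn _; rewrite !leqW.
Qed.

Let EU : \bigcup_n E n = `]0, 1[.
Proof.
apply/seteqP; split=> x /=.
  move=> [n _]; rewrite /E /= !in_itv /= => /andP[h1 h2]; have [? ? ?] := eun_bounds n.
  by apply/andP; split; lra.
rewrite in_itv /= => /andP[x0 x1].
have [N1 h1] := eun_small x0; have [|N2 h2] := @eun_small (1 - x); first by lra.
exists (maxn N1 N2) => //; rewrite /E /= in_itv /=.
have := h1 _ (leq_maxl N1 N2); have := h2 _ (leq_maxr N1 N2).
by move=> ? ?; apply/andP; split; lra.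
Qed.

Lemma improper_unit f : (forall x, 0 <= f x) -> measurable_fun setT f ->
  (\int[leb]_(x in E n) (f x)%:E @[n --> \oo] --> \int[leb]_(x in `[0%R, 1%R]) (f x)%:E)%E.
Proof.
move=> f0 mf.
have -> : (\int[leb]_(x in `[0%R, 1%R]) (f x)%:E = \int[leb]_(x in \bigcup_n E n) (f x)%:E)%E.
  rewrite EU -integral_itv_bndo_bndc; last by apply/measurable_EFinP; exact: measurable_funTS.
  by rewrite -integral_itv_obnd_cbnd //; apply/measurable_EFinP; exact: measurable_funTS.
apply: ge0_nondecreasing_set_cvg_integral.
- move=> n l nl; apply/subsetPset => x; rewrite /E /= !in_itv /= => /andP[h1 h2].
  by have := eun_nonincr nl => h; apply/andP; split; lra.
- by move=> n; exact: measurable_itv.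
- by move=> n; apply/measurable_EFinP; exact: measurable_funTS.
- by move=> n x _; rewrite lee_fin.
Qed.

End OpenUnitInterval.

Variable q : R.
Hypothesis q1 : -1 < q < 1.

Let qa : 0 < 1 - q. Proof. by case/andP: q1 => ? ?; lra. Qed.
Let qb : 0 < 1 + q. Proof. by case/andP: q1 => ? ?; lra. Qed.

Let D : R -> R := beta_density_unnorm (1 - q) (1 + q).
Let g k : R -> R := fun x => x ^+ k * D x.
Let E n : set R := `[eun n, 1 - eun n].

Let D_ge0 x : 0 <= D x.
Proof. by rewrite mulr_ge0 ?powR_ge0. Qed.

Let mD : measurable_fun setT D.
Proof.
apply: measurable_funM; first exact: measurable_powR.
apply: measurableT_comp (measurable_powR _) _.
by apply: measurable_funB.
Qed.

Let mg k : measurable_fun setT (g k).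
Proof. by apply: measurable_funM => //; exact: exprn_measurable. Qed.

Let dpow1 (r x : R) : x < 1 -> is_derive x 1 (fun y : R => (1 - y) `^ r) (- (r * (1 - x) `^ (r - 1))).
Proof.
move=> x1; have x0 : 0 < 1 - x by rewrite subr_gt0.
have d1 : is_derive x 1 (fun y : R => 1 - y) (-1).
  by have := is_deriveB (is_derive_cst (1 : R) x 1) (is_derive_id x (1 : R)); rewrite sub0r.
have := @is_derive1_comp R (@powR R ^~ r) (fun y : R => 1 - y) x _ _ (is_derive1_powR r x0) d1.
by rewrite mulrN1.
Qed.

Let cpow1 (r x : R) : x < 1 -> {for x, continuous (fun y : R => (1 - y) `^ r)}.
Proof.
by move=> /(dpow1 r) d; apply: differentiable_continuous; apply/derivable1_diffP; case: d.
Qed.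

Let cpow0 (r x : R) : 0 < x -> {for x, continuous (@powR R ^~ r)}.
Proof.
move=> /(is_derive1_powR r) d.
by apply: differentiable_continuous; apply/derivable1_diffP; case: d.
Qed.

Let cD (x : R) : 0 < x < 1 -> {for x, continuous D}.
Proof.
by move=> /andP[x0 x1]; apply: cvgM; [exact: cpow0|exact: cpow1].
Qed.

Let cg k (x : R) : 0 < x < 1 -> {for x, continuous (g k)}.
Proof. by move=> x01; apply: cvgM; [exact: exprn_continuous|exact: cD]. Qed.

(** Vanishing at both ends, this function has as derivative the combination of [g k] and [g k.+1]
    that encodes the moment recursion. *)
Let Fk (k : nat) (x : R) : R := x `^ (k.+1%:R - q) * (1 - x) `^ (1 + q).

Let dFk k (x : R) : 0 < x < 1 ->
  is_derive x 1 (Fk k) ((k.+1%:R - q) * g k x - k.+2%:R * g k.+1 x).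
Proof.
move=> /andP[x0 x1]; have x1' : 0 < 1 - x by rewrite subr_gt0.
have d1 := is_derive1_powR (k.+1%:R - q) x0; have d2 := dpow1 (1 + q) x1.
have xn0 : x != 0 by rewrite gt_eqF.
have yn0 : 1 - x != 0 by rewrite gt_eqF.
have e1 : x `^ (k.+1%:R - q) = x ^+ k.+1 * x `^ (1 - q - 1).
  have -> : k.+1%:R - q = k.+1%:R + (1 - q - 1) by ring.
  by rewrite powRD ?xn0 ?implybT // powR_mulrn // ltW.
have e2 : x `^ (k.+1%:R - q - 1) = x ^+ k * x `^ (1 - q - 1).
  have -> : k.+1%:R - q - 1 = k%:R + (1 - q - 1) by rewrite -natr1; ring.
  by rewrite powRD ?xn0 ?implybT // powR_mulrn // ltW.
have e3 : (1 - x) `^ (1 + q) = (1 - x) * (1 - x) `^ (1 + q - 1).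
  have -> : (1 - x) `^ (1 + q) = (1 - x) `^ (1 + (1 + q - 1)) by congr (_ `^ _); ring.
  by rewrite powRD ?yn0 ?implybT // powRr1 // ltW.
rewrite [X in is_derive _ _ _ X](_ : _ = x `^ (k.+1%:R - q) * - ((1 + q) * (1 - x) `^ (1 + q - 1))
  + (1 - x) `^ (1 + q) * ((k.+1%:R - q) * x `^ (k.+1%:R - q - 1))).
  exact: (is_deriveM d1 d2).
by rewrite /g /D /beta_density_unnorm e1 e2 e3 !exprS -!natr1; ring.
Qed.

(** A primitive of [x^(-q) + (1 - x)^q]. This sum dominates the density, because one of the two
    factors is at most 1 on the interval. *)
Let G (x : R) : R := x `^ (1 - q) / (1 - q) - (1 - x) `^ (1 + q) / (1 + q).

Let dG (x : R) : 0 < x < 1 -> is_derive x 1 G (x `^ (1 - q - 1) + (1 - x) `^ (1 + q - 1)).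
Proof.
move=> /andP[x0 x1].
have d1 := is_derive1_powR (1 - q) x0; have d2 := dpow1 (1 + q) x1.
have q1n : 1 - q != 0 by rewrite gt_eqF.
have q2n : 1 + q != 0 by rewrite gt_eqF.
have d3 := is_deriveB (is_deriveZ (1 - q)^-1 d1) (is_deriveZ (1 + q)^-1 d2).
have GE : (1 - q)^-1 \*: (@powR R ^~ (1 - q)) - (1 + q)^-1 \*: (fun y : R => (1 - y) `^ (1 + q)) = G.
  by apply/funext => y; rewrite /G /= -[LHS]/(_ * _ - _ * _) ![_^-1 * _]mulrC.
rewrite -GE [X in is_derive _ _ _ X](_ : _ = (1 - q)^-1 * ((1 - q) * x `^ (1 - q - 1)) -
  (1 + q)^-1 * - ((1 + q) * (1 - x) `^ (1 + q - 1))); first exact: d3.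
by field; rewrite q1n q2n.
Qed.

Let J k n := Rintegral leb (E n) (g k).

Let gi k n : leb.-integrable (E n) (EFin \o g k).
Proof. by have [? ? ?] := eun_bounds n; apply: cont_unit_integrable => //; exact: cg. Qed.

Let J_rec k n : (k.+1%:R - q) * J k n - k.+2%:R * J k.+1 n = Fk k (1 - eun n) - Fk k (eun n).
Proof.
have [e0 e1 e2] := eun_bounds n.
pose f x := (k.+1%:R - q) * g k x - k.+2%:R * g k.+1 x.
have cf (x : R) : 0 < x < 1 -> {for x, continuous f}.
  by move=> x01; apply: cvgB; apply: cvgMr; exact: cg.
rewrite -(FTC_unit e0 e1 e2 (@dFk k) cf) /f RintegralB //.
- have Z c j := @RintegralZl _ _ R leb (E n) (g j) c (measurable_itv _) (gi j n).
  by rewrite -[_ * J k n]Z -[_ * J k.+1 n]Z.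
- by apply: cont_unit_integrable => // x x01; apply: cvgMr; exact: cg.
- by apply: cont_unit_integrable => // x x01; apply: cvgMr; exact: cg.
Qed.

Let J_bound n : J 0 n <= (1 - q)^-1 + (1 + q)^-1.
Proof.
have [e0 e1 e2] := eun_bounds n; set e := eun n in e0 e1 e2 *.
have e01 : 0 < e < 1 by rewrite e0; lra.
have le1 (y r : R) : 0 < y <= 1 -> 0 <= r -> y `^ r <= 1.
  by move=> y01 r0; have := ger_powR y01 r0; rewrite powRr0.
pose h x := x `^ (1 - q - 1) + (1 - x) `^ (1 + q - 1).
have ch x : 0 < x < 1 -> {for x, continuous h}.
  by move=> /andP[x0 x1]; apply: cvgD; [exact: cpow0|exact: cpow1].
have hi : leb.-integrable `[e, 1 - e] (EFin \o h) by apply: cont_unit_integrable.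
apply: (@le_trans _ _ (Rintegral leb `[e, 1 - e] h)).
  apply: le_Rintegral; [exact: measurable_itv|exact: (gi 0 n)|exact: hi|].
  move=> x; rewrite /E /= in_itv /= -/e => /andP[ex xe].
  have x01 : 0 < x <= 1 by apply/andP; split; lra.
  have y01 : 0 < 1 - x <= 1 by apply/andP; split; lra.
  rewrite /g expr0 mul1r /D /beta_density_unnorm /h.
  have [q0|q0] := leP 0 q.
    have y1 : (1 - x) `^ (1 + q - 1) <= 1.
      by apply: le1 => //; lra.
    by apply: (@le_trans _ _ (x `^ (1 - q - 1))); rewrite ?lerDl ?powR_ge0 // ler_piMr ?powR_ge0.
  have x1 : x `^ (1 - q - 1) <= 1.
    by apply: le1 => //; lra.
  by apply: (@le_trans _ _ ((1 - x) `^ (1 + q - 1))); rewrite ?lerDr ?powR_ge0 // ler_piMl ?powR_ge0.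
rewrite (FTC_unit e0 e1 e2 dG ch).
have t1 : (1 - e) `^ (1 - q) / (1 - q) <= (1 - q)^-1.
  by rewrite ler_piMl ?invr_ge0 ?(ltW qa) // le1 ?(ltW qa) //; apply/andP; split; lra.
have t2 : (1 - e) `^ (1 + q) / (1 + q) <= (1 + q)^-1.
  by rewrite ler_piMl ?invr_ge0 ?(ltW qb) // le1 ?(ltW qb) //; apply/andP; split; lra.
have t3 : 0 <= e `^ (1 - q) / (1 - q) by rewrite divr_ge0 ?powR_ge0 // ltW.
have t4 : 0 <= (1 - (1 - e)) `^ (1 + q) / (1 + q) by rewrite divr_ge0 ?powR_ge0 // ltW.
by rewrite /G; lra.
Qed.

Let g_le k x : 0 <= x <= 1 -> g k x <= g 0 x.
Proof.
by move=> /andP[x0 x1]; rewrite /g expr0 ler_wpM2r // exprn_ile1.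
Qed.

Let g_ge0 k x : 0 <= x <= 1 -> 0 <= g k x.
Proof. by move=> /andP[x0 x1]; rewrite mulr_ge0 // exprn_ge0. Qed.

Let gabs k x : 0 <= `|g k x|. Proof. exact: normr_ge0. Qed.

Let I k := Rintegral leb `[0, 1] (g k).

(** [improper_unit] asks for non-negativity on the whole line, where odd powers are negative; the
    absolute value changes nothing on [[0, 1]]. *)
Let int_abs k (A : set R) : A `<=` `[0, 1] ->
  (\int[leb]_(x in A) (`|g k x|)%:E = \int[leb]_(x in A) (g k x)%:E)%E.
Proof.
move=> A01; apply: eq_integral => x /set_mem /A01 /=; rewrite in_itv /= => x01.
by rewrite ger0_norm // g_ge0.
Qed.

Let E01 n : E n `<=` `[0, 1].
Proof.
move=> x; rewrite /E /= !in_itv /= => /andP[? ?]; have [? ? ?] := eun_bounds n.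
by apply/andP; split; lra.
Qed.

Let J_cvg_ereal k :
  (\int[leb]_(x in E n) (g k x)%:E @[n --> \oo] --> \int[leb]_(x in `[0%R, 1%R]) (g k x)%:E)%E.
Proof.
have := @improper_unit (fun x => `|g k x|) (gabs k).
move/(_ (measurableT_comp (@normr_measurable R setT) (mg k))).
rewrite (@int_abs k `[0, 1]) //.
by under eq_cvg do rewrite (@int_abs k _ (@E01 _)).
Qed.

Let J_fin k n : (\int[leb]_(x in E n) (g k x)%:E = (J k n)%:E)%E.
Proof.
rewrite /J /Rintegral fineK //.
by apply: integrable_fin_num; [exact: measurable_itv|exact: gi].
Qed.

Let I_fin k : (\int[leb]_(x in `[0%R, 1%R]) (g k x)%:E)%E \is a fin_num.
Proof.
rewrite ge0_fin_numE; last first.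
  by apply: integral_ge0 => x; rewrite /= in_itv /= => /g_ge0; rewrite lee_fin.
apply: (@le_lt_trans _ _ ((1 - q)^-1 + (1 + q)^-1)%:E); last exact: ltry.
apply: (cvge_to_le (@J_cvg_ereal k)); apply: nearW => n; rewrite J_fin lee_fin.
apply: le_trans (J_bound n); apply: le_Rintegral; try exact: gi.
  exact: measurable_itv.
by move=> x /E01; rewrite /= in_itv /=; exact: g_le.
Qed.

Let J_cvg k : J k @ \oo --> I k.
Proof.
have := @J_cvg_ereal k; rewrite -(fineK (I_fin k)) => /fine_cvg.
by apply: cvg_trans; apply: near_eq_cvg; apply: nearW => n /=.
Qed.

Let pow_small (y r e : R) : 0 < r -> 0 < e -> 0 < y -> y < e `^ r^-1 -> y `^ r < e.
Proof.
move=> r0 e0 y0 ye; have := gt0_ltr_powR r0 _ _ ye; rewrite -powRrM mulVf ?gt_eqF // powRr1 ?(ltW e0) //.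
by apply; rewrite nnegrE ?powR_ge0 // ltW.
Qed.

Let Fk_cvg k : (fun n => Fk k (1 - eun n) - Fk k (eun n)) @ \oo --> (0 : R).
Proof.
have le1 (y r : R) : 0 < y <= 1 -> 0 <= r -> y `^ r <= 1.
  by move=> y01 r0; have := ger_powR y01 r0; rewrite powRr0.
have ka : 0 < k.+1%:R - q.
  by rewrite -natr1; have := ler0n R k; have := qa; lra.
apply/cvgrPdist_le => e e0.
have e2 : 0 < e / 2 by rewrite divr_gt0.
have [N1 h1] := eun_small (powR_gt0 (k.+1%:R - q)^-1 e2).
have [N2 h2] := eun_small (powR_gt0 (1 + q)^-1 e2).
exists (maxn N1 N2) => // n /= Nn.
have [n0 n1 n2] := eun_bounds n; set x := eun n in n0 n1 n2 *.
have x1 : x `^ (k.+1%:R - q) < e / 2.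
  by apply: pow_small => //; apply: h1; apply: leq_trans Nn; exact: leq_maxl.
have x2 : x `^ (1 + q) < e / 2.
  by apply: pow_small => //; apply: h2; apply: leq_trans Nn; exact: leq_maxr.
rewrite sub0r normrN /Fk (_ : 1 - (1 - x) = x); last by ring.
set A := (1 - x) `^ _; set B := x `^ (1 + q); set C := x `^ (_ - q); set D' := (1 - x) `^ (1 + q).
have A01 : 0 <= A <= 1 by rewrite powR_ge0 le1 ?(ltW ka) //; apply/andP; split; lra.
have D01 : 0 <= D' <= 1 by rewrite powR_ge0 le1 ?(ltW qb) //; apply/andP; split; lra.
have B0 : 0 <= B by exact: powR_ge0.
have C0 : 0 <= C by exact: powR_ge0.
case/andP: A01 => A0 A1; case/andP: D01 => D0 D1.
apply: (le_trans (ler_normB _ _)); rewrite !ger0_norm ?mulr_ge0 //.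
have h3 : A * B <= e / 2 by apply: le_trans (ltW x2); rewrite ler_piMl.
have h4 : C * D' <= e / 2 by apply: le_trans (ltW x1); rewrite ler_piMr.
by lra.
Qed.

Let I_rec k : (k.+1%:R - q) * I k = k.+2%:R * I k.+1.
Proof.
have c1 : (fun n => (k.+1%:R - q) * J k n - k.+2%:R * J k.+1 n) @ \oo -->
    (k.+1%:R - q) * I k - k.+2%:R * I k.+1.
  by apply: cvgB; apply: cvgMr; exact: J_cvg.
have := Fk_cvg k; under eq_cvg do rewrite -J_rec.
move=> c2; have := cvg_lim (@Rhausdorff R) c1; rewrite (cvg_lim (@Rhausdorff R) c2).
by move=> /(_ eventually_filter)/esym/eqP; rewrite subr_eq0 => /eqP.
Qed.

Let I0_gt0 : 0 < I 0.
Proof.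
have [e0 e1 e2] := eun_bounds 0.
have e3 : eun 0 = 3^-1 by [].
have /andP[qq1 qq2] := q1.
(* On the middle third, of length 1/3, the density is at least [x (1 - x)], which exceeds 1/9
   there. *)
have : 27^-1 <= J 0 0.
  have ci : leb.-integrable (E 0) (EFin \o (fun=> 9^-1 : R)).
    by apply: cont_unit_integrable => // x _; exact: cvg_cst.
  apply: (@le_trans _ _ (Rintegral leb (E 0) (fun=> 9^-1))).
    have mab : fine (leb (E 0)) = 1 - eun 0 - eun 0.
      by rewrite /E lebesgue_measure_itv /= lte_fin e1.
    rewrite Rintegral_cst; last exact: measurable_itv.
    rewrite mab e3; lra.
  apply: le_Rintegral; [exact: measurable_itv|exact: ci|exact: gi|].
  move=> x; rewrite /E /= in_itv /= e3 => /andP[x0 x1].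
  have x01 : 0 < x <= 1 by apply/andP; split; lra.
  have y01 : 0 < 1 - x <= 1 by apply/andP; split; lra.
  rewrite /g expr0 mul1r /D /beta_density_unnorm.
  have h1 : x <= x `^ (1 - q - 1) by apply: ger1_powR => //; lra.
  have h2 : 1 - x <= (1 - x) `^ (1 + q - 1) by apply: ger1_powR => //; lra.
  apply: (@le_trans _ _ (x * (1 - x))); last by apply: ler_pM => //; lra.
  by nra.
move=> h; suff : J 0 0 <= I 0 by lra.
rewrite -lee_fin -J_fin /I /Rintegral fineK //.
apply: ge0_subset_integral => //; first exact: measurable_itv.
- by apply/measurable_EFinP; exact: (measurable_funTS (mg 0)).
- by move=> x; rewrite /= in_itv /= => /g_ge0; rewrite lee_fin.
Qed.

Lemma beta_moment_bmom k : beta_moment (1 - q) (1 + q) k = bmom q k.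
Proof.
have -> : beta_moment (1 - q) (1 + q) k = I k / I 0.
  rewrite /beta_moment /I /g; congr (_ / _).
  by apply: eq_Rintegral => x _; rewrite expr0 mul1r.
elim: k => [|k IH] /=; first by rewrite divff // gt_eqF.
rewrite -IH mulrA; congr (_ / _); apply: (mulfI (x := k.+2%:R)); first by rewrite pnatr_eq0.
by rewrite -I_rec [RHS]mulrA; congr (_ * _); rewrite mulrC divfK // pnatr_eq0.
Qed.

Lemma bmom_growth : growth (bmom q).
Proof.
exists 1, 1 => n; rewrite expr1n mulr1; elim: n => [|n IH] /=; first by rewrite normr1.
rewrite normrM -[leRHS]mulr1; apply: ler_pM => //.
have n0 := ler0n R n; have /andP[qq1 qq2] := q1.
rewrite ger0_norm; last by rewrite divr_ge0 // -natr1; lra.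
by rewrite ler_pdivrMr ?ltr0n // mul1r -!natr1; lra.
Qed.

Lemma bmom_nnegf : nnegf (bmom q).
Proof.
move=> p p0.
have gint k : leb.-integrable `[0, 1] (EFin \o g k).
  apply/integrableP; split; first by apply/measurable_EFinP; exact: (measurable_funTS (mg k)).
  have := I_fin k; rewrite ge0_fin_numE; last first.
    by apply: integral_ge0 => x; rewrite /= in_itv /= => /g_ge0; rewrite lee_fin.
  apply: le_lt_trans; rewrite le_eqVlt; apply/orP; left; apply/eqP.
  exact: (@int_abs k `[0, 1]).
have lin n : leb.-integrable `[0, 1] (EFin \o (fun x => \sum_(i < n) p`_i * g i x)) /\
    Rintegral leb `[0, 1] (fun x => \sum_(i < n) p`_i * g i x) = \sum_(i < n) p`_i * I i.
  elim: n => [|n [IHi IH]].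
    have zE : (fun x : R => \sum_(i < 0) p`_i * g i x) = (fun=> 0).
      by apply/funext => x; rewrite big_ord0.
    rewrite zE big_ord0; split; last by rewrite Rintegral_cst // mul0r.
    exact: integrable0.
  have sE : (fun x : R => \sum_(i < n.+1) p`_i * g i x) =
     (fun x => (\sum_(i < n) p`_i * g i x) + p`_n * g n x).
    by apply/funext => x; rewrite big_ord_recr.
  have ign : leb.-integrable `[0, 1] (EFin \o (fun x => p`_n * g n x)).
    have -> : EFin \o (fun x => p`_n * g n x) = (fun x => (p`_n)%:E * (EFin \o g n) x)%E by [].
    by apply: integrableZl => //; exact: gint.
  rewrite sE big_ord_recr /= -IH; split.
    pose u x := \sum_(i < n) p`_i * g i x; pose v x := p`_n * g n x.
    have -> : EFin \o (fun x => u x + v x) = ((EFin \o u) \+ (EFin \o v))%E by [].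
    by apply: integrableD.
  by rewrite RintegralD // RintegralZl.
have -> : Lf (bmom q) p = Rintegral leb `[0, 1] (fun x => \sum_(i < size p) p`_i * g i x) / I 0.
  rewrite (lin _).2 mulr_suml; apply: eq_bigr => i _; rewrite -mulrA; congr (_ * _).
  rewrite -beta_moment_bmom /beta_moment /I /g; congr (_ / _).
  by apply: eq_Rintegral => x _; rewrite expr0 mul1r.
rewrite divr_ge0 ?(ltW I0_gt0) //; apply: Rintegral_ge0 => x _.
rewrite (_ : \sum_(i < _) _ = p.[x] * D x); last first.
  by rewrite horner_coef mulr_suml; apply: eq_bigr => i _; rewrite /g mulrA.
by rewrite mulr_ge0.
Qed.

End BetaMoments.

(** * The Stieltjes transform at infinity *)

Section Stieltjes.
Variable R : realType.
Local Open Scope classical_set_scope.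
Local Notation prob := (probability (measurableTypeR R) R).
Implicit Types (mu nu : prob) (z w : R[i]).

Lemma cabsE z : cabs z = Normc.normc z.
Proof. by case: z. Qed.

Lemma cabs_ge0 z : 0 <= cabs z.
Proof. exact: sqrtr_ge0. Qed.

Lemma cabsV z : cabs z^-1 = (cabs z)^-1.
Proof. by rewrite !cabsE Normc.normcV. Qed.

Lemma cabsM z w : cabs (z * w) = cabs z * cabs w.
Proof. by rewrite !cabsE Normc.normcM. Qed.

Lemma cabsX z n : cabs (z ^+ n) = cabs z ^+ n.
Proof.
elim: n => [|n ih]; last by rewrite !exprS cabsM ih.
by rewrite !expr0 cabsE Normc.normc1.
Qed.

Lemma cabs_real (t : R) : cabs (Complex t 0) = `|t|.
Proof. by rewrite /cabs /= expr0n /= addr0 sqrtr_sqr. Qed.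

Lemma norm_Re_le z : `|complex.Re z| <= cabs z.
Proof. by rewrite -sqrtr_sqr ler_wsqrtr // lerDl sqr_ge0. Qed.

Lemma norm_Im_le z : `|complex.Im z| <= cabs z.
Proof. by rewrite -sqrtr_sqr ler_wsqrtr // lerDr sqr_ge0. Qed.

Lemma resolvent_bound z (t M : R) : 0 <= M -> 2 * M < cabs z -> `|t| <= M ->
  z - Complex t 0 != 0 /\ cabs (z - Complex t 0)^-1 <= 2 * cabs z^-1.
Proof.
move=> M0 zM tM.
have h : cabs z <= cabs (z - Complex t 0) + M.
  apply: le_trans (lerD (lexx _) tM); rewrite -cabs_real !cabsE.
  by rewrite -[X in Normc.normc X](subrK (Complex t 0)) le_normcD.
have z0 : 0 < cabs z by lra.
have h2 : cabs z / 2 <= cabs (z - Complex t 0) by lra.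
have p2 : 0 < cabs (z - Complex t 0) by lra.
split.
  by apply: contraTneq p2 => ->; rewrite cabsE Normc.normc0 ltxx.
rewrite !cabsV (_ : 2 * (cabs z)^-1 = (cabs z / 2)^-1); last by rewrite invf_div.
by rewrite lef_pV2 // posrE; lra.
Qed.

Lemma resolvent_expand z (t : R) N : z != 0 -> z - Complex t 0 != 0 ->
  (z - Complex t 0)^-1 - \sum_(i < N) Complex (t ^+ i) 0 * z^-1 ^+ i.+1 =
  Complex (t ^+ N) 0 * (z^-1 ^+ N * (z - Complex t 0)^-1).
Proof.
move=> z0 zt0; elim: N => [|N ih].
  by rewrite big_ord0 subr0 !expr0 mul1r (_ : Complex 1 0 = 1) // mul1r.
rewrite big_ord_recr /= opprD addrA ih.
rewrite (_ : Complex (t ^+ N.+1) 0 = Complex t 0 * Complex (t ^+ N) 0); last first.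
  by rewrite exprS; congr Complex; rewrite /= ?mulr0 ?mul0r ?subr0 ?addr0.
set T := Complex t 0 in zt0 *; set U := Complex _ 0.
rewrite !exprS; set V := z^-1 ^+ N; move: U V => U V.
by field; rewrite z0 zt0.
Qed.

Lemma resolvent_measurable z :
  measurable_fun setT (fun t : R => complex.Re (z - Complex t 0)^-1) /\
  measurable_fun setT (fun t : R => complex.Im (z - Complex t 0)^-1).
Proof.
case: z => x y.
pose n2 (t : R) := (x - t) ^+ 2 + (y - 0) ^+ 2.
have mx : measurable_fun setT (fun t : R => x - t) by exact: measurable_funB.
have mV : measurable_fun setT (fun t : R => (n2 t)^-1).
  rewrite (_ : (fun t => _) = (fun y : R => powR y (-1)) \o n2); last first.
    by apply/funext=> t /=; rewrite powR_inv1 // addr_ge0 ?sqr_ge0.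
  apply: measurableT_comp; first exact: measurable_powR.
  by apply: measurable_funD => //; exact: measurable_funX.
split.
  rewrite (_ : (fun t => _) = fun t => (x - t) * (n2 t)^-1) //.
  exact: measurable_funM.
rewrite (_ : (fun t => _) = fun t => (- (y - 0)) * (n2 t)^-1); last first.
  by apply/funext=> t /=; rewrite /n2 mulNr.
exact: measurable_funM.
Qed.

(* [F] will be the real or the imaginary part. *)
Lemma resolvent_integral mu (M : R) z N (F : R[i] -> R) :
  (forall u v, F (u - v) = F u - F v) ->
  (forall c u, F (Complex c 0 * u) = c * F u) ->
  (forall u, `|F u| <= cabs u) ->
  measurable_fun setT (fun t : R => F (z - Complex t 0)^-1) ->
  mu [set x : R | M < `|x|] = 0%E -> 2 * `|M| < cabs z ->
  `|Rintegral mu setT (fun t : R => F (z - Complex t 0)^-1) -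
    \sum_(i < N) moment mu i * F (z^-1 ^+ i.+1)| <=
  `|M| ^+ N * cabs z^-1 ^+ N * (2 * cabs z^-1).
Proof.
move=> FB FZ Fle mF muM zM.
have z0 : z != 0.
  apply: contraTneq zM => ->; rewrite cabsE Normc.normc0 -leNgt.
  by rewrite mulr_ge0.
have F0 : F 0 = 0 by have := FB 0 0; rewrite !subrr.
have FN u : F (- u) = - F u by have := FB 0 u; rewrite !sub0r F0 sub0r.
have FD u v : F (u + v) = F u + F v by rewrite -[v in LHS]opprK FB FN opprK.
have MM t : `|t| <= M -> `|t| <= `|M| by move=> /le_trans; apply; exact: ler_norm.
under eq_bigr do rewrite mulrC.
rewrite -(csupp_moment_sum muM (fun i => F (z^-1 ^+ i.+1))).
have mp : measurable_fun setT (fun x : R => \sum_(i < N) F (z^-1 ^+ i.+1) * x ^+ i).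
  rewrite (_ : (fun x => _) = horner (\poly_(i < N) F (z^-1 ^+ i.+1))); last first.
    by apply/funext=> x; rewrite horner_poly.
  exact: horner_measurable.
have iF : mu.-integrable setT (EFin \o fun t : R => F (z - Complex t 0)^-1).
  apply: (csupp_integrable (B := 2 * cabs z^-1) muM) => // t /MM tM.
  by apply: le_trans (Fle _) _; have [] := resolvent_bound (normr_ge0 M) zM tM.
have ip : mu.-integrable setT
    (EFin \o fun x : R => \sum_(i < N) F (z^-1 ^+ i.+1) * x ^+ i).
  rewrite (_ : (fun x => _) = horner (\poly_(i < N) F (z^-1 ^+ i.+1))); last first.
    by apply/funext=> x; rewrite horner_poly.
  exact: (csupp_horner_integrable muM).
rewrite -(@RintegralB _ (measurableTypeR R) R mu) //.
apply: (csupp_norm muM); first exact: measurable_funB.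
move=> t /MM tM.
have [zt0 ztB] := resolvent_bound (normr_ge0 M) zM tM.
have -> : \sum_(i < N) F (z^-1 ^+ i.+1) * t ^+ i =
   F (\sum_(i < N) Complex (t ^+ i) 0 * z^-1 ^+ i.+1).
  rewrite (big_morph F FD F0); apply: eq_bigr => i _.
  by rewrite FZ mulrC.
rewrite -FB resolvent_expand // FZ normrM normrX -mulrA.
apply: ler_pM => //; first by rewrite lerXn2r // nnegrE.
apply: le_trans (Fle _) _; rewrite cabsM cabsX.
by apply: ler_pM => //; rewrite ?exprn_ge0 ?cabs_ge0.
Qed.

Lemma stieltjes_expand mu (M : R) z N :
  mu [set x : R | M < `|x|] = 0%E -> 2 * `|M| < cabs z ->
  let e := `|M| ^+ N * cabs z^-1 ^+ N * (2 * cabs z^-1) in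
  `|complex.Re (stieltjes mu z) -
    \sum_(i < N) moment mu i * complex.Re (z^-1 ^+ i.+1)| <= e /\
  `|complex.Im (stieltjes mu z) -
    \sum_(i < N) moment mu i * complex.Im (z^-1 ^+ i.+1)| <= e.
Proof.
move=> muM zM; have [mR mI] := resolvent_measurable z.
split; apply: resolvent_integral => //.
- by case=> [a b] [c d].
- by move=> c [a b] /=; rewrite mul0r subr0.
- exact: norm_Re_le.
- by case=> [a b] [c d].
- by move=> c [a b] /=; rewrite mul0r addr0.
- exact: norm_Im_le.
Qed.

Lemma complex_realX (u : R) n : Complex u 0 ^+ n = Complex (u ^+ n) 0.
Proof.
elim: n => [//|n ih]; rewrite !exprS ih.
by congr Complex; rewrite /= ?mulr0 ?mul0r ?subr0 ?addr0.
Qed.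

Lemma complex_realV (x : R) : (Complex x 0)^-1 = Complex x^-1 0.
Proof.
congr Complex; rewrite /= ?mul0r ?oppr0 // expr0n /= addr0.
have [->|x0] := eqVneq x 0; first by rewrite mul0r invr0.
by rewrite expr2 invfM mulrA mulfV // mul1r.
Qed.

Lemma stieltjes_real mu (x : R) :
  stieltjes mu (Complex x 0) = Complex (complex.Re (stieltjes mu (Complex x 0))) 0.
Proof.
congr Complex; rewrite /= (_ : (fun t : R => _) = fun=> 0) ?Rintegral_prob_cst //.
by apply/funext=> t; rewrite /= subrr mul0r oppr0.
Qed.

Lemma stieltjes_real_expand mu (M : R) x N :
  mu [set x : R | M < `|x|] = 0%E -> 2 * `|M| < x ->
  `|complex.Re (stieltjes mu (Complex x 0)) -
    \sum_(i < N) moment mu i * x^-1 ^+ i.+1| <= 2 * `|M| ^+ N * x^-1 ^+ N.+1.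
Proof.
move=> muM xM; have x0 : 0 < x by apply: le_lt_trans xM; rewrite mulr_ge0.
have := @stieltjes_expand mu M (Complex x 0) N muM.
rewrite cabsV cabs_real (gtr0_norm x0) => /(_ xM)/= -[h _].
apply: le_trans (_ : _ <= _) _; last first.
  rewrite (_ : 2 * _ * _ = `|M| ^+ N * x^-1 ^+ N * (2 * x^-1)); first exact: h.
  by rewrite exprS; ring.
rewrite le_eqVlt; apply/orP; left; apply/eqP; congr (`| _ - _ |).
by apply: eq_bigr => i _; rewrite complex_realV complex_realX.
Qed.

Lemma stieltjes_small mu : compact_supp mu -> forall e : R, 0 < e ->
  exists r : R, forall x, r < x -> `|complex.Re (stieltjes mu (Complex x 0))| <= e.
Proof.
move=> [M muM] e e0; exists (Num.max (2 * `|M|) (2 / e)) => x.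
rewrite gt_max => /andP[xM xe].
have x0 : 0 < x by apply: lt_trans xe; rewrite divr_gt0.
have := stieltjes_real_expand 0 muM xM.
rewrite big_ord0 subr0 expr0 mulr1 expr1 => /le_trans; apply.
by rewrite ler_pdivrMr // mulrC -ler_pdivrMr // ltW.
Qed.

(** Induction on [n]: once the lower moments agree, subtracting the two expansions and multiplying
    by [x^(n+1)] bounds the difference of the [n]-th moments by [K / x], with [K] the sum of the two
    remainder constants. *)
Lemma stieltjes_real_inj mu nu (r : R) : compact_supp mu -> compact_supp nu ->
  (forall x, r < x -> complex.Re (stieltjes mu (Complex x 0)) =
     complex.Re (stieltjes nu (Complex x 0))) ->
  forall n, moment mu n = moment nu n.
Proof.
move=> [M muM] [M' nuM] h n; have [N] := ubnP n.
elim: N n => // N ih n nN.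
have {}ih i : (i < n)%N -> moment mu i = moment nu i.
  by move=> /leq_trans /(_ (ltnSE nN)) /ih.
pose K := 2 * `|M| ^+ n.+1 + 2 * `|M'| ^+ n.+1.
pose r0 := Num.bound (`|r| + 2 * `|M| + 2 * `|M'|).
have r0P : `|r| + 2 * `|M| + 2 * `|M'| < r0%:R.
  by apply: archi_boundP; rewrite !addr_ge0 ?mulr_ge0.
apply: (@le_invn_eq _ _ _ K) => k.
pose x : R := r0%:R + k.+1%:R.
have rx : r0%:R < x by rewrite /x ltrDl ltr0Sn.
have [R1 R2 R3 R4] : [/\ 0 <= `|r|, 0 <= `|M|, 0 <= `|M'| & r <= `|r| ].
  by split; rewrite ?normr_ge0 ?ler_norm.
have xM : 2 * `|M| < x by lra.
have xM' : 2 * `|M'| < x by lra.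
have xr : r < x by lra.
have x0 : 0 < x by lra.
have h1 := stieltjes_real_expand n.+1 muM xM.
have h2 := stieltjes_real_expand n.+1 nuM xM'.
move: h1 h2; rewrite -(h x xr); set G := complex.Re _; rewrite !big_ord_recr /= => h1 h2.
rewrite (eq_bigr (fun i : 'I_n => moment nu i * x^-1 ^+ i.+1)) in h1; last first.
  by move=> i _; rewrite ih.
have u0 : 0 < x^-1 ^+ n.+1 by rewrite exprn_gt0 // invr_gt0.
have h3 : `|moment mu n - moment nu n| * x^-1 ^+ n.+1 <= K * x^-1 ^+ n.+2.
  rewrite -[X in _ * X](gtr0_norm u0) -normrM /K [X in _ <= X]mulrDl.
  set S := \sum_(i < n) _ in h1 h2.
  rewrite (_ : (_ - _) * _ = (G - (S + moment nu n * x^-1 ^+ n.+1)) -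
    (G - (S + moment mu n * x^-1 ^+ n.+1))); last by ring.
  by apply: le_trans (ler_normB _ _) _; rewrite addrC lerD.
rewrite [X in _ <= _ * X]exprSr mulrA mulrAC ler_pM2r // in h3.
apply: le_trans h3 _; apply: ler_wpM2l; first by rewrite /K addr_ge0 // mulr_ge0 ?exprn_ge0.
by rewrite lef_pV2 ?posrE ?ltr0Sn // /x lerDr ler0n.
Qed.

End Stieltjes.

(** * Power series and principal powers *)

Section PrincipalPower.
Variable R : realType.
Local Open Scope classical_set_scope.
Local Notation fps := (fps R).
Implicit Types (r t : R) (f x y : nat -> R).

Definition geobnd r f := forall n, `|f n| <= r ^+ n.

Lemma geobnd_diffs r f : 0 <= r <= 1 -> geobnd r f -> geobnd (2 * r) (pseries_diffs f).
Proof.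
move=> /andP[r0 r1] rf n; rewrite /pseries_diffs normrM normr_nat exprMn.
apply: ler_pM => //; first by rewrite -natrX ler_nat ltn_expl.
by apply: le_trans (rf _) _; rewrite exprS ler_piMl ?exprn_ge0.
Qed.

Lemma geobnd_scale r t f : geobnd r f -> geobnd (r * `|t|) (fun n => f n * t ^+ n).
Proof. by move=> rf n; rewrite normrM normrX exprMn ler_wpM2r ?exprn_ge0. Qed.

Lemma geobnd_le r r' f : 0 <= r <= r' -> geobnd r f -> geobnd r' f.
Proof.
move=> /andP[r0 rr'] rf n; apply: le_trans (rf n) _.
by rewrite lerXn2r // nnegrE // (le_trans r0 rr').
Qed.

Lemma geobnd_cvg r f : 0 <= r < 1 -> geobnd r f -> cvgn (series f).
Proof.
move=> /andP[r0 r1] rf; apply: normed_cvg.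
apply: (@series_le_cvg _ _ (geometric 1 r)) => //= n.
- by rewrite mul1r exprn_ge0.
- by rewrite mul1r.
- by apply: is_cvg_geometric_series; rewrite ger0_norm.
Qed.

Lemma geobnd_pseries_cvg r t f : 0 <= r -> r * `|t| < 1 -> geobnd r f ->
  cvgn (pseries f t).
Proof.
move=> r0 rt rf; apply: (@geobnd_cvg (r * `|t|)); first by rewrite mulr_ge0.
exact: geobnd_scale.
Qed.

(** Termwise differentiation asks for the convergence of two further formal derivatives at the point
    2. Each derivative doubles the ratio, and [4 * 16^-1 * 2 < 1]. *)
Lemma pseries_derive f t : geobnd 16^-1 f -> `|t| < 2 ->
  is_derive t 1 (fun s : R => limn (pseries f s)) (limn (pseries (pseries_diffs f) t)).
Proof.
move=> f16 t2.
have f8 := geobnd_diffs (_ : 0 <= 16^-1 <= 1) f16.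
have f4 := geobnd_diffs (_ : 0 <= 2 * 16^-1 <= 1) (f8 ltac:(lra)).
have t2' : `|t| < `|2 : R| by rewrite [X in _ < X]ger0_norm.
refine (@pseries_snd_diffs R f 2 t _ _ _ t2').
- by apply: (@geobnd_pseries_cvg 16^-1) => //; rewrite ger0_norm //; lra.
- apply: (@geobnd_pseries_cvg (2 * 16^-1)); [lra|by rewrite ger0_norm //; lra|].
  by apply: f8; lra.
- apply: (@geobnd_pseries_cvg (2 * (2 * 16^-1))); [lra|by rewrite ger0_norm //; lra|].
  by apply: f4; lra.
Qed.

(** The product of partial sums exceeds the partial sum of the product by the coefficients of degree
    [N] to [2 N - 1] of the truncated product: at most [2 N^2 8^(-N) <= 2 * 2^(-N)]. *)
Lemma fps_sumM x y : geobnd 8^-1 x -> geobnd 8^-1 y ->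
  series ((x : fps) * (y : fps)) @ \oo --> limn (series x) * limn (series y).
Proof.
move=> xb yb.
have r8 : 0 <= (8^-1 : R) < 1 by lra.
have cx := geobnd_cvg r8 xb; have cy := geobnd_cvg r8 yb.
pose D N := series x N * series y N - series ((x : fps) * (y : fps)) N.
have Dle N : `|D N| <= 2 * (2^-1) ^+ N.
  pose F (f : nat -> R) : {poly R} := \poly_(i < N) f i.
  have FE (f : nat -> R) : series f N = (F f).[1].
    rewrite horner_poly seriesEord /=; apply: eq_bigr => i _.
    by rewrite expr1n mulr1.
  have szF (f : nat -> R) : (size (F f) <= N)%N by exact: size_poly.
  have -> : D N = \sum_(i < N) (F x * F y)`_(N + i).
    rewrite /D !FE -hornerM (@horner_coef_wide _ (N + N)); last first.
      exact: leq_trans (leq_trans (size_polyMleq _ _) (leq_pred _)) (leq_add (szF x) (szF y)).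
    rewrite big_split_ord /= addrAC -[RHS]add0r; congr (_ + _); last first.
      by apply: eq_bigr => i _; rewrite expr1n mulr1.
    apply/eqP; rewrite subr_eq0 -FE seriesEord /=; apply/eqP/eq_bigr => i _.
    rewrite expr1n mulr1 fpsME coefM; apply: eq_bigr => j _.
    rewrite !coef_poly (leq_ltn_trans _ (ltn_ord i)) //; last by have := ltn_ord j; lia.
    by rewrite (leq_ltn_trans (leq_subr _ _) (ltn_ord i)).
  apply: le_trans (ler_norm_sum _ _ _) _.
  have cf (f : nat -> R) j : geobnd 8^-1 f -> `|(F f)`_j| <= 8^-1 ^+ j.
    by move=> fb; rewrite coef_poly; case: ifP => _ //; rewrite normr0 exprn_ge0.
  apply: (@le_trans _ _ (\sum_(i < N) (2 * N)%:R * 8^-1 ^+ N)).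
    apply: ler_sum => i _; rewrite coefM.
    apply: le_trans (ler_norm_sum _ _ _) _.
    apply: (@le_trans _ _ (\sum_(j < (N + i).+1) 8^-1 ^+ N)).
      apply: ler_sum => j _; rewrite normrM.
      apply: (@le_trans _ _ (8^-1 ^+ j * 8^-1 ^+ (N + i - j))).
        by apply: ler_pM => //; exact: cf.
      rewrite -exprD subnKC; last by rewrite -ltnS.
      by rewrite exprD ler_piMr ?exprn_ge0 // exprn_ile1 //; lra.
    rewrite sumr_const card_ord -[X in X <= _]mulr_natl ler_wpM2r ?exprn_ge0 // ler_nat.
    by have := ltn_ord i; lia.
  rewrite sumr_const card_ord -[X in X <= _]mulr_natl natrM mulrA mulrCA -!mulrA ler_wpM2l //.
  rewrite mulrA (_ : 2^-1 = 2 * 2 * 8^-1 :> R); last by lra.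
  rewrite !exprMn ler_wpM2r ?exprn_ge0 // -natrX -natrM -natrM ler_nat.
  by rewrite leq_mul // ltnW // ltn_expl.
have D0 : D @ \oo --> (0 : R).
  have g0 : geometric 2 (2^-1) @ \oo --> (0 : R).
    by apply: cvg_geometric; rewrite ger0_norm //; lra.
  apply: (@squeeze_cvgr _ _ _ _ (fun n => - geometric 2 (2^-1) n) (geometric 2 (2^-1))) => //.
    by apply: nearW => n; rewrite -ler_norml; exact: Dle.
  by rewrite -[X in _ --> X]oppr0; exact: cvgN.
rewrite (_ : series _ = fun N => series x N * series y N - D N); last first.
  by apply/funext=> N; rewrite /D opprB addrC subrK.
rewrite -[X in _ --> X]subr0; apply: cvgB => //.
by apply: cvgM.
Qed.

Lemma fps_sum_gt0 x : geobnd 8^-1 x -> x 0%N = 1 -> 0 < limn (series x).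
Proof.
move=> xb x0; have r8 : 0 <= (8^-1 : R) < 1 by lra.
have cx := geobnd_cvg r8 xb.
apply: (@lt_le_trans _ _ (2^-1)) => //.
apply: limr_ge => //; exists 1%N => // -[//|N] _ /=.
(* The added term is the bound [8^(-N) / 7] for the remaining tail, which makes the induction go
   through. *)
suff : 2^-1 + 7^-1 * 8^-1 ^+ N <= series x N.+1.
  by apply: le_trans; rewrite lerDl mulr_ge0 ?exprn_ge0.
elim: N => [|N ih]; first by rewrite seriesEord /= big_ord1 x0 expr0; lra.
have -> : series x N.+2 = series x N.+1 + x N.+1 by rewrite !seriesEord /= big_ord_recr.
move: (xb N.+1) ih; rewrite ler_norml exprS => /andP[h _].
have v0 : 0 <= 8^-1 ^+ N :> R by rewrite exprn_ge0.
by move: h v0; move: (8^-1 ^+ N) (series x N.+1) (x N.+1) => v S y; lra.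
Qed.

(** The hypotheses are the real and imaginary parts of [q A' B = A B']. Positive real parts make
    [ln] of the squared modulus and [atan] of the slope differentiable representatives of the
    logarithm, and [q Log A - Log B] has zero derivative. *)
Lemma log_ode (q : R) (ar ai br bi dar dai dbr dbi : R -> R) :
  (forall t, 0 <= t <= 1 -> [/\ is_derive t 1 ar (dar t), is_derive t 1 ai (dai t),
      is_derive t 1 br (dbr t) & is_derive t 1 bi (dbi t)]) ->
  (forall t, 0 <= t <= 1 -> [/\ 0 < ar t, 0 < br t,
     q * (dar t * br t - dai t * bi t) = ar t * dbr t - ai t * dbi t &
     q * (dar t * bi t + dai t * br t) = ar t * dbi t + ai t * dbr t]) ->
  ar 0 = 1 -> ai 0 = 0 -> br 0 = 1 -> bi 0 = 0 ->
  q * ln (ar 1 ^+ 2 + ai 1 ^+ 2) = ln (br 1 ^+ 2 + bi 1 ^+ 2) /\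
  q * atan (ai 1 / ar 1) = atan (bi 1 / br 1).
Proof.
move=> d h ar0 ai0 br0 bi0.
have cst (G : R -> R) : (forall t, 0 <= t <= 1 -> is_derive t (1 : R) G 0) -> G 0 = 0 -> G 1 = 0.
  move=> dG G0; have [||c _] := @MVT R G (fun=> 0) 0 1 ltr01.
  - by move=> t; rewrite in_itv /= => /andP[t0 t1]; apply: dG; rewrite !ltW.
  - apply: derivable_within_continuous => t; rewrite in_itv /= => t01.
    by have [] := dG t t01.
  - by rewrite G0 mul0r subr0.
have sq (u v du dv : R -> R) t : is_derive t (1 : R) u (du t) -> is_derive t (1 : R) v (dv t) ->
    0 < u t ->
    is_derive t (1 : R) (fun s => ln (u s ^+ 2 + v s ^+ 2))
      (2 * (u t * du t + v t * dv t) / (u t ^+ 2 + v t ^+ 2)) /\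
    is_derive t (1 : R) (fun s => atan (v s / u s))
      ((u t * dv t - v t * du t) / (u t ^+ 2 + v t ^+ 2)).
  move=> Du Dv u0.
  have p0 : 0 < u t ^+ 2 + v t ^+ 2 by rewrite ltr_pwDl ?sqr_ge0 // exprn_gt0.
  split.
    have D2 := is_deriveD (is_deriveM Du Du) (is_deriveM Dv Dv).
    have L : is_derive ((u * u + v * v) t) 1 (@ln R) (u t ^+ 2 + v t ^+ 2)^-1.
      by rewrite /= -!expr2; exact: is_derive1_ln.
    rewrite [X in is_derive _ _ _ X](_ : _ = (u t ^+ 2 + v t ^+ 2)^-1 *
      (u t *: du t + u t *: du t + (v t *: dv t + v t *: dv t))); last first.
      by rewrite /GRing.scale /=; field; rewrite gt_eqF.
    by have := is_derive1_comp L D2.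
  have un0 : u t != 0 by rewrite gt_eqF.
  have D2 := is_deriveM Dv (is_deriveV un0 Du).
  have L := is_derive1_atan (v t / u t).
  have := is_derive1_comp (L : is_derive ((v * (fun s => (u s)^-1)) t) 1 (@atan R) _) D2.
  rewrite [X in is_derive _ _ _ X -> _](_ : _ =
    (u t * dv t - v t * du t) / (u t ^+ 2 + v t ^+ 2)) //.
  by rewrite /GRing.scale /=; field; rewrite un0 !gt_eqF.
(* The identity [q A' B = A B'] is multiplied by the conjugate of [A B]; real and imaginary parts
   give the two claims. *)
have key t : 0 <= t <= 1 ->
  q * (2 * (ar t * dar t + ai t * dai t) / (ar t ^+ 2 + ai t ^+ 2)) =
    2 * (br t * dbr t + bi t * dbi t) / (br t ^+ 2 + bi t ^+ 2) /\
  q * ((ar t * dai t - ai t * dar t) / (ar t ^+ 2 + ai t ^+ 2)) =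
    (br t * dbi t - bi t * dbr t) / (br t ^+ 2 + bi t ^+ 2).
  move=> /h[]; move: (ar t) (ai t) (br t) (bi t) (dar t) (dai t) (dbr t) (dbi t).
  move=> a a' b b' c c' e e' a0 b0 E1 E2.
  have p0 : a ^+ 2 + a' ^+ 2 != 0 by rewrite gt_eqF // ltr_pwDl ?sqr_ge0 // exprn_gt0.
  have p1 : b ^+ 2 + b' ^+ 2 != 0 by rewrite gt_eqF // ltr_pwDl ?sqr_ge0 // exprn_gt0.
  split; rewrite mulrA; apply/eqP; rewrite eqr_div //; apply/eqP.
    transitivity (2 * ((q * (c * b - c' * b')) * (a * b - a' * b') +
      (q * (c * b' + c' * b)) * (a * b' + a' * b))); first by ring.
    by rewrite E1 E2; ring.
  transitivity ((q * (c * b' + c' * b)) * (a * b - a' * b') -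
    (q * (c * b - c' * b')) * (a * b' + a' * b)); first by ring.
  by rewrite E1 E2; ring.
split; apply/eqP; rewrite -subr_eq0; apply/eqP.
  apply: (cst (fun t => q * ln (ar t ^+ 2 + ai t ^+ 2) - ln (br t ^+ 2 + bi t ^+ 2))).
    move=> t t01; have [a0 b0 _ _] := h t t01; have [Dar Dai Dbr Dbi] := d t t01.
    have [Da _] := sq _ _ _ _ _ Dar Dai a0; have [Db _] := sq _ _ _ _ _ Dbr Dbi b0.
    have := is_deriveB (is_deriveZ q Da) Db.
    by rewrite [X in is_derive _ _ _ X -> _](_ : _ = 0) //; apply/eqP; rewrite subr_eq0; apply/eqP; exact: (key t t01).1.
  by rewrite ar0 ai0 br0 bi0 expr1n expr0n /= addr0 ln1 mulr0 subr0.
apply: (cst (fun t => q * atan (ai t / ar t) - atan (bi t / br t))).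
  move=> t t01; have [a0 b0 _ _] := h t t01; have [Dar Dai Dbr Dbi] := d t t01.
  have [_ Da] := sq _ _ _ _ _ Dar Dai a0; have [_ Db] := sq _ _ _ _ _ Dbr Dbi b0.
  have := is_deriveB (is_deriveZ q Da) Db.
  by rewrite [X in is_derive _ _ _ X -> _](_ : _ = 0) //; apply/eqP; rewrite subr_eq0; apply/eqP; exact: (key t t01).2.
by rewrite ar0 ai0 br0 bi0 !mul0r atan0 mulr0 subr0.
Qed.

Lemma cpow_log (q a a' b b' : R) : q != 0 -> 0 < a -> 0 < b ->
  q * ln (a ^+ 2 + a' ^+ 2) = ln (b ^+ 2 + b' ^+ 2) ->
  q * atan (a' / a) = atan (b' / b) ->
  cpow (Complex b b') (1 / q) = Complex a a'.
Proof.
move=> q0 a0 b0 hl ha.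
have pa : 0 < a ^+ 2 + a' ^+ 2 by rewrite ltr_pwDl ?sqr_ge0 // exprn_gt0.
have pb : 0 < b ^+ 2 + b' ^+ 2 by rewrite ltr_pwDl ?sqr_ge0 // exprn_gt0.
have hA : 1 / q * Arg (Complex b b') = atan (a' / a).
  by rewrite /Arg /= b0 -ha mulrA div1r mulVf // mul1r.
have ca : cos (atan (a' / a)) * Num.sqrt (a ^+ 2 + a' ^+ 2) = a.
  rewrite cos_atan (_ : a ^+ 2 + _ = a ^+ 2 * (1 + (a' / a) ^+ 2)); last by field; rewrite gt_eqF.
  rewrite sqrtrM ?sqr_ge0 // sqrtr_sqr gtr0_norm // mulrC mulfK // sqrtr_eq0 -ltNge.
  by rewrite ltr_pwDl ?sqr_ge0.
have hN : powR (cabs (Complex b b')) (1 / q) = Num.sqrt (a ^+ 2 + a' ^+ 2).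
  rewrite /cabs /= -!powR12_sqrt ?ltW // -powRrM /powR !gt_eqF // -hl.
  by congr expR; field.
have sa : sin (atan (a' / a)) * Num.sqrt (a ^+ 2 + a' ^+ 2) = a'.
  have := atanK (a' / a); rewrite /tan => /(canRL (divfK _)) ->; last first.
    by apply: contraTneq a0 => c0; rewrite -ca c0 mul0r ltxx.
  by rewrite -mulrA ca divfK // gt_eqF.
by rewrite /cpow hN hA; congr Complex; rewrite mulrC.
Qed.

Definition fpsRe (f : fps) (w : R[i]) : fps := fun n => f n * complex.Re (w ^+ n).
Definition fpsIm (f : fps) (w : R[i]) : fps := fun n => f n * complex.Im (w ^+ n).

(** On the ray [t |-> t w] the real and imaginary parts of a series are real power series in [t], so
    only real differentiation is used. The bound with 1/16 keeps [A] and [B] in the right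
    half-plane, where the principal argument is an [atan]. *)
Lemma fps_cpow (q : R) (A B : fps) (w : R[i]) : q != 0 -> A 0%N = 1 -> B 0%N = 1 ->
  fpsC q * (fderiv A * B) = A * fderiv B ->
  (forall n, `|A n| * cabs w ^+ n <= 16^-1 ^+ n) ->
  (forall n, `|B n| * cabs w ^+ n <= 16^-1 ^+ n) ->
  cpow (Complex (limn (series (fpsRe B w))) (limn (series (fpsIm B w)))) (1 / q) =
  Complex (limn (series (fpsRe A w))) (limn (series (fpsIm A w))).
Proof.
move=> q0 A0 B0 AB Ab Bb.
have bR (F : fps) : (forall n, `|F n| * cabs w ^+ n <= 16^-1 ^+ n) ->
    geobnd 16^-1 (fpsRe F w) /\ geobnd 16^-1 (fpsIm F w).
  move=> Fb; split=> n; apply: le_trans (Fb n); rewrite normrM ler_wpM2l // -cabsX.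
    exact: norm_Re_le.
  exact: norm_Im_le.
have [bAr bAi] := bR _ Ab; have [bBr bBi] := bR _ Bb.
pose T (f : fps) (t : R) : fps := fun n => f n * t ^+ n.
pose V f t := limn (pseries f t).
have TM (f g : fps) t : T (f * g) t = T f t * T g t.
  apply: fpsP => n; rewrite /T !fpsME mulr_suml; apply: eq_bigr => i _.
  by rewrite mulrACA -exprD subnKC // -ltnS.
have bT f t : 0 <= t <= 1 -> geobnd 16^-1 f -> geobnd 8^-1 (T f t).
  move=> /andP[t0 t1] /(geobnd_scale t); apply: geobnd_le.
  by rewrite ger0_norm //; apply/andP; split; nra.
have bD f t : 0 <= t <= 1 -> geobnd 16^-1 f -> geobnd 8^-1 (T (pseries_diffs f) t).
  move=> /andP[t0 t1] /geobnd_diffs fb; have /(geobnd_scale t) := fb ltac:(lra); apply: geobnd_le.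
  by rewrite ger0_norm //; apply/andP; split; nra.
have V0 f : V f 0 = f 0%N.
  rewrite /V; apply: cvg_lim => //; apply: cvg_near_cst; exists 1%N => // -[//|n] _.
  rewrite /= /pseries seriesEord /= big_ord_recl expr0 mulr1 big1 ?addr0 // => i _.
  by rewrite expr0n /= mulr0.
have VM (f g : fps) t : geobnd 8^-1 (T f t) -> geobnd 8^-1 (T g t) ->
    series (T (f * g) t) @ \oo --> V f t * V g t.
  by move=> fb gb; rewrite TM; exact: fps_sumM.
have V1 f : V f 1 = limn (series f).
  rewrite /V (_ : pseries f 1 = series f) //; apply/funext => n.
  by rewrite /pseries !seriesEord /=; apply: eq_bigr => i _; rewrite expr1n mulr1.
have wD i j : complex.Re (w ^+ (i + j)) =
    complex.Re (w ^+ i) * complex.Re (w ^+ j) - complex.Im (w ^+ i) * complex.Im (w ^+ j) /\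
    complex.Im (w ^+ (i + j)) =
    complex.Re (w ^+ i) * complex.Im (w ^+ j) + complex.Im (w ^+ i) * complex.Re (w ^+ j).
  by rewrite exprD; case: (w ^+ i) (w ^+ j) => [a b] [c d].
(* The derivative of [F (t w)] in [t] is [w F' (t w)], whence the exponent [i.+1]. *)
have dE (F : fps) i : pseries_diffs (fpsRe F w) i = fderiv F i * complex.Re (w ^+ i.+1) /\
    pseries_diffs (fpsIm F w) i = fderiv F i * complex.Im (w ^+ i.+1).
  by rewrite /pseries_diffs /fderiv /fpsRe /fpsIm !mulrA !mulr_natl.
have ABn n : q * (fderiv A * B) n = (A * fderiv B) n by rewrite -AB fpsCE.
have E1 : fpsC q * ((pseries_diffs (fpsRe A w) : fps) * fpsRe B w -
      (pseries_diffs (fpsIm A w) : fps) * fpsIm B w) =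
    fpsRe A w * (pseries_diffs (fpsRe B w) : fps) - fpsIm A w * (pseries_diffs (fpsIm B w) : fps).
  apply: fpsP => n; rewrite fpsCE !fpsDE !fpsNE !fpsME.
  transitivity (q * (fderiv A * B) n * complex.Re (w ^+ n.+1)).
    rewrite -mulrA fpsME -sumrB mulr_suml; congr (_ * _); apply: eq_bigr => i _.
    rewrite !(dE A _).1 !(dE A _).2 /fpsRe /fpsIm.
    have := (wD i.+1 ((n - i))%N).1; rewrite (_ : (i.+1 + (n - i))%N = n.+1); last by have := ltn_ord i; lia.
    by move=> ->; ring.
  rewrite ABn fpsME -sumrB mulr_suml; apply: eq_bigr => i _.
  rewrite !(dE B _).1 !(dE B _).2 /fpsRe /fpsIm.
  have := (wD i ((n - i).+1)%N).1; rewrite (_ : (i + (n - i).+1)%N = n.+1); last by have := ltn_ord i; lia.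
  by move=> ->; ring.
have E2 : fpsC q * ((pseries_diffs (fpsRe A w) : fps) * fpsIm B w +
      (pseries_diffs (fpsIm A w) : fps) * fpsRe B w) =
    fpsRe A w * (pseries_diffs (fpsIm B w) : fps) + fpsIm A w * (pseries_diffs (fpsRe B w) : fps).
  apply: fpsP => n; rewrite fpsCE !fpsDE !fpsME.
  transitivity (q * (fderiv A * B) n * complex.Im (w ^+ n.+1)).
    rewrite -mulrA fpsME -big_split mulr_suml; congr (_ * _); apply: eq_bigr => i _ /=.
    rewrite !(dE A _).1 !(dE A _).2 /fpsRe /fpsIm.
    have := (wD i.+1 ((n - i))%N).2; rewrite (_ : (i.+1 + (n - i))%N = n.+1); last by have := ltn_ord i; lia.
    by move=> ->; ring.
  rewrite ABn fpsME -big_split mulr_suml; apply: eq_bigr => i _ /=.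
  rewrite !(dE B _).1 !(dE B _).2 /fpsRe /fpsIm.
  have := (wD i ((n - i).+1)%N).2; rewrite (_ : (i + (n - i).+1)%N = n.+1); last by have := ltn_ord i; lia.
  by move=> ->; ring.
(* The sign [s] is [-1] for the real part of a complex product and [1] for the imaginary part. *)
have lims (f g h k f' g' h' k' : fps) (s : R) t :
    (forall F, F \in [:: f; g; h; k; f'; g'; h'; k'] -> geobnd 8^-1 (T F t)) ->
    fpsC q * (f * g + fpsC s * (h * k)) = f' * g' + fpsC s * (h' * k') ->
    q * (V f t * V g t + s * (V h t * V k t)) = V f' t * V g' t + s * (V h' t * V k' t).
  move=> bb E.
  have c1 : series (T (f' * g' + fpsC s * (h' * k')) t) @ \oo -->
      V f' t * V g' t + s * (V h' t * V k' t).
    rewrite (_ : series _ = (fun N => series (T (f' * g') t) N + s * series (T (h' * k') t) N)); last first.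
      apply/funext=> N; rewrite !seriesEord /= mulr_sumr -big_split; apply: eq_bigr => i _.
      by rewrite /T fpsDE fpsCE mulrDl mulrA.
    by apply: cvgD; [|apply: cvgMr]; apply: VM; apply: bb; rewrite !inE eqxx ?orbT.
  have c2 : series (T (fpsC q * (f * g + fpsC s * (h * k))) t) @ \oo -->
      q * (V f t * V g t + s * (V h t * V k t)).
    rewrite (_ : series _ = (fun N => q * (series (T (f * g) t) N + s * series (T (h * k) t) N))); last first.
      apply/funext=> N; rewrite !seriesEord /= !mulr_sumr -big_split mulr_sumr; apply: eq_bigr => i _.
      by rewrite /T fpsCE fpsDE fpsCE /=; ring.
    apply: cvgMr; by apply: cvgD; [|apply: cvgMr]; apply: VM; apply: bb; rewrite !inE eqxx ?orbT.
  by rewrite E in c2; rewrite -(cvg_lim (@Rhausdorff R) c1) -(cvg_lim (@Rhausdorff R) c2).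
have bnds t : 0 <= t <= 1 -> [/\ geobnd 8^-1 (T (fpsRe A w) t), geobnd 8^-1 (T (fpsIm A w) t),
   geobnd 8^-1 (T (fpsRe B w) t) & geobnd 8^-1 (T (fpsIm B w) t)] by split; exact: bT.
have bndsD t : 0 <= t <= 1 -> [/\ geobnd 8^-1 (T (pseries_diffs (fpsRe A w)) t),
   geobnd 8^-1 (T (pseries_diffs (fpsIm A w)) t),
   geobnd 8^-1 (T (pseries_diffs (fpsRe B w)) t) &
   geobnd 8^-1 (T (pseries_diffs (fpsIm B w)) t)] by split; exact: bD.
have re0 (F : fps) : fpsRe F w 0%N = F 0%N by rewrite /fpsRe expr0 /= mulr1.
have im0 (F : fps) : fpsIm F w 0%N = 0 by rewrite /fpsIm expr0 /= mulr0.
have [|t t01|||||hl ha] := @log_ode q (V (fpsRe A w)) (V (fpsIm A w)) (V (fpsRe B w)) (V (fpsIm B w))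
   (V (pseries_diffs (fpsRe A w))) (V (pseries_diffs (fpsIm A w)))
   (V (pseries_diffs (fpsRe B w))) (V (pseries_diffs (fpsIm B w))).
- move=> t /andP[t0 t1].
  have t2 : `|t| < 2 by rewrite ger0_norm //; lra.
  by split; exact: pseries_derive.
- have [b1 b2 b3 b4] := bnds t t01; have [b5 b6 b7 b8] := bndsD t t01.
  split.
  + by apply: (@fps_sum_gt0 (T (fpsRe A w) t)); rewrite // /T expr0 mulr1 re0.
  + by apply: (@fps_sum_gt0 (T (fpsRe B w) t)); rewrite // /T expr0 mulr1 re0.
  + have := lims (pseries_diffs (fpsRe A w)) (fpsRe B w) (pseries_diffs (fpsIm A w)) (fpsIm B w)
      (fpsRe A w) (pseries_diffs (fpsRe B w)) (fpsIm A w) (pseries_diffs (fpsIm B w)) (-1) t.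
    rewrite fpsCN fpsC1 !mulN1r; apply=> //.
    by move=> F; rewrite !inE => /or4P[/eqP->|/eqP->|/eqP->|/or4P[/eqP->|/eqP->|/eqP->|/orP[/eqP->|/eqP->]]].
  + have := lims (pseries_diffs (fpsRe A w)) (fpsIm B w) (pseries_diffs (fpsIm A w)) (fpsRe B w)
      (fpsRe A w) (pseries_diffs (fpsIm B w)) (fpsIm A w) (pseries_diffs (fpsRe B w)) 1 t.
    rewrite fpsC1 !mul1r; apply=> //.
    by move=> F; rewrite !inE => /or4P[/eqP->|/eqP->|/eqP->|/or4P[/eqP->|/eqP->|/eqP->|/orP[/eqP->|/eqP->]]].
- by rewrite V0 re0.
- by rewrite V0 im0.
- by rewrite V0 re0.
- by rewrite V0 im0.
rewrite !V1 in hl ha.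
have g01 : 0 <= (1 : R) <= 1 by lra.
have [b1 b2 b3 b4] := bnds 1 g01.
have pos (F : fps) : F 0%N = 1 -> geobnd 8^-1 (T (fpsRe F w) 1) -> 0 < limn (series (fpsRe F w)).
  by move=> F0 Fb; rewrite -V1; apply: (@fps_sum_gt0 (T (fpsRe F w) 1)); rewrite // /T expr0 mulr1 re0.
by apply: cpow_log => //; apply: pos.
Qed.

End PrincipalPower.

(** * The relation P *)

Section MarkovKreinRelation.
Variable R : realType.
Local Open Scope classical_set_scope.
Local Notation prob := (probability (measurableTypeR R) R).
Local Notation fps := (fps R).
Implicit Types (mu nu rho lam : prob) (z w : R[i]) (q b c x t : R).

Lemma fps_sum_stieltjes mu (M : R) z c :
  mu [set x : R | M < `|x|] = 0%E -> 2 * `|M| < cabs z ->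
  let F := 1 - fpsC c * gser (moment mu) in
  limn (series (fpsRe F z^-1)) = 1 - c * complex.Re (stieltjes mu z) /\
  limn (series (fpsIm F z^-1)) = - (c * complex.Im (stieltjes mu z)).
Proof.
move=> muM zM F.
pose e N := `|M| ^+ N * cabs z^-1 ^+ N * (2 * cabs z^-1).
have z0 : 0 < cabs z by apply: le_lt_trans zM; rewrite mulr_ge0.
have e0 : e @ \oo --> (0 : R).
  have -> : e = geometric (2 * cabs z^-1) (`|M| * cabs z^-1).
    by apply/funext=> N /=; rewrite exprMn mulrC.
  apply: cvg_geometric; rewrite cabsV ger0_norm; last by rewrite mulr_ge0 // invr_ge0 ltW.
  by rewrite ltr_pdivrMr // mul1r; have := normr_ge0 M; lra.
have conv (x : nat -> R) (l : R) : (forall N, `|l - x N| <= e N) -> x @ \oo --> l.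
  move=> h; rewrite (_ : x = fun N => l - (l - x N)); last by apply/funext=> N; rewrite subKr.
  rewrite -[X in _ --> X]subr0; apply: cvgB; first exact: cvg_cst.
  apply: (@squeeze_cvgr _ _ _ _ (fun N => - e N) e) => //.
    by apply: nearW => N; rewrite -ler_norml; exact: h.
  by rewrite -[X in _ --> X]oppr0; exact: cvgN.
have F0 : F 0%N = 1 by rewrite /F fpsDE fpsNE fpsCE fps1E /= mulr0 subr0.
have FS n : F n.+1 = - (c * moment mu n) by rewrite /F fpsDE fpsNE fpsCE fps1E /= add0r.
split; apply: cvg_lim => //; rewrite -cvg_shiftS.
  rewrite (_ : [sequence _]_n = fun N => 1 - c * \sum_(i < N) moment mu i * complex.Re (z^-1 ^+ i.+1)).
    apply: cvgB; [exact: cvg_cst|apply: cvgMr; apply: conv => N].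
    by have [] := stieltjes_expand N muM zM.
  apply/funext=> N /=; rewrite seriesEord /= big_ord_recl /fpsRe F0 expr0 mulr1.
  congr (_ + _); rewrite mulr_sumr -sumrN; apply: eq_bigr => i _.
  by rewrite FS mulNr mulrA.
rewrite (_ : [sequence _]_n = fun N => - (c * \sum_(i < N) moment mu i * complex.Im (z^-1 ^+ i.+1))).
  apply: cvgN; apply: cvgMr; apply: conv => N.
  by have [] := stieltjes_expand N muM zM.
apply/funext=> N /=; rewrite seriesEord /= big_ord_recl /fpsIm F0 expr0 mulr0 add0r.
rewrite mulr_sumr -sumrN; apply: eq_bigr => i _.
by rewrite FS mulNr mulrA.
Qed.

Lemma growth_small (f : fps) : growth f -> f 0%N = 1 -> exists2 r : R, 0 < r &
  forall s : R, 0 <= s -> s <= r -> forall n, `|f n| * s ^+ n <= 16^-1 ^+ n.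
Proof.
move=> [K [C h]] f0.
(* The constant [1 + |K|] is absorbed into the rate, which is possible from degree 1 on; degree 0 is
   met with equality. *)
pose D := (1 + `|K|) * (1 + `|C|).
have D1 : 1 <= D by rewrite /D; have := normr_ge0 K; have := normr_ge0 C; nra.
have D0 : 0 < D by apply: lt_le_trans D1.
exists (16^-1 / D); first by rewrite divr_gt0.
move=> s s0 sD [|n]; first by rewrite f0 !expr0 normr1 mulr1.
have fD : `|f n.+1| <= D ^+ n.+1.
  apply: le_trans (h _) _; apply: le_trans (ler_norm _) _; rewrite normrM normrX /D exprMn.
  apply: ler_pM; rewrite ?exprn_ge0 //.
    apply: (@le_trans _ _ (1 + `|K|)); first by rewrite lerDr.
    by rewrite exprS ler_peMr ?exprn_ege1 // ?addr_ge0 // lerDl.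
  by rewrite lerXn2r ?nnegrE ?addr_ge0 // lerDr.
apply: le_trans (ler_wpM2r _ fD) _; first by rewrite exprn_ge0.
rewrite -exprMn lerXn2r ?nnegrE //; first by rewrite mulr_ge0 // ltW.
by rewrite mulrC -ler_pdivlMr.
Qed.

Lemma csupp_moment_growth mu : compact_supp mu -> growth (moment mu).
Proof. by move=> [M /csupp_growth]. Qed.

Lemma gser_P_rel q mu nu : q != 0 -> compact_supp mu -> compact_supp nu ->
  gser (moment nu) = fcomp (gser (bmom q)) (gser (moment mu)) -> P_rel q mu nu.
Proof.
move=> q0 cmu cnu nuE.
pose A := 1 - fpsC 1 * gser (moment mu); pose B := 1 - fpsC q * gser (moment nu).
have gm0 : gser (moment mu) 0%N = 0 by [].
have A0 : A 0%N = 1 by rewrite /A fpsDE fpsNE fpsCE fps1E /= mulr0 subr0.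
have B0 : B 0%N = 1 by rewrite /B fpsDE fpsNE fpsCE fps1E /= mulr0 subr0.
have gr c mu' : compact_supp mu' -> growth (1 - fpsC c * gser (moment mu')).
  move=> /csupp_moment_growth [K [C h]]; exists (1 + `|c| * `|K|), (1 + `|C|).
  have C1 : 1 <= 1 + `|C| by rewrite lerDl.
  move=> [|n]; rewrite fpsDE fpsNE fpsCE fps1E /=.
    by rewrite mulr0 subr0 normr1 expr0 mulr1 lerDl mulr_ge0.
  rewrite add0r normrN normrM mulrDl mul1r -[leLHS]add0r; apply: lerD; first by rewrite exprn_ge0 ?addr_ge0.
  rewrite -mulrA ler_wpM2l //; apply: le_trans (h n) _; apply: le_trans (ler_norm _) _.
  rewrite normrM normrX ler_wpM2l // exprS -[leLHS]mul1r; apply: ler_pM; rewrite ?exprn_ge0 //.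
  by rewrite lerXn2r ?nnegrE ?addr_ge0 // lerDr.
(* The differential equation of the beta series, composed with [g_mu] and multiplied by its
   derivative. *)
have AB : fpsC q * (fderiv A * B) = A * fderiv B.
  have ode := congr1 (fun f => fcomp f (gser (moment mu))) (bmom_ode q).
  rewrite fcompM // !fcompD !fcompN fcompM // !fcompC fcomp1 (fcompX gm0) -nuE in ode.
  have d1 : fderiv (1 : fps) = 0 by rewrite -fpsC1 fderivC.
  have dA : fderiv A = - fderiv (gser (moment mu)).
    by rewrite /A fpsC1 mul1r fderivD fderivN d1 add0r.
  have dB : fderiv B = - (fpsC q * (fcomp (fderiv (gser (bmom q))) (gser (moment mu)) *
      fderiv (gser (moment mu)))).
    by rewrite /B fderivD fderivN d1 add0r fderivM fderivC mul0r add0r nuE fderiv_comp.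
  rewrite dA dB /A /B fpsC1 mul1r.
  set D := fcomp _ _ in ode *; set g' := fderiv (gser (moment mu)).
  transitivity (- (fpsC q * ((1 - fpsC q * gser (moment nu)) * g'))); first by ring.
  by rewrite -ode; ring.
have [rA rA0 hA] := growth_small (gr 1 _ cmu) A0.
have [rB rB0 hB] := growth_small (gr q _ cnu) B0.
have [M muM] := cmu; have [M' nuM] := cnu.
exists (2 * `|M| + 2 * `|M'| + rA^-1 + rB^-1) => z zr.
have [P1 P2 P3 P4] : [/\ 0 <= `|M|, 0 <= `|M'|, 0 < rA^-1 & 0 < rB^-1] by rewrite !normr_ge0 !invr_gt0.
have zM : 2 * `|M| < cabs z by lra.
have zM' : 2 * `|M'| < cabs z by lra.
have z0 : 0 < cabs z by lra.
have wA : cabs z^-1 <= rA by rewrite cabsV invf_ple ?posrE //; lra.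
have wB : cabs z^-1 <= rB by rewrite cabsV invf_ple ?posrE //; lra.
have := @fps_cpow R q A B z^-1 q0 A0 B0 AB (hA _ (cabs_ge0 _) wA) (hB _ (cabs_ge0 _) wB).
have [-> ->] := fps_sum_stieltjes 1 muM zM.
have [-> ->] := fps_sum_stieltjes q nuM zM'.
case: (stieltjes mu z) (stieltjes nu z) => [a a'] [s s'] /=.
rewrite !mul1r => h.
transitivity (Complex (1 - a) (- a')); first by congr Complex; rewrite /= ?sub0r.
rewrite -h; congr cpow; congr Complex; rewrite /= ?mul0r ?subr0 ?addr0 ?sub0r //.
Qed.

(** At large real points the transform is small, so the base is positive and the principal power is
    [powR], which can be inverted. *)
Lemma P_rel_real q mu nu : compact_supp mu -> compact_supp nu -> P_rel q mu nu ->
  exists r : R, forall x, r < x ->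
    let h := complex.Re (stieltjes nu (Complex x 0)) in
    0 < 1 - q * h /\ 1 - complex.Re (stieltjes mu (Complex x 0)) = powR (1 - q * h) (1 / q).
Proof.
move=> cmu cnu [r hr].
(* With this bound on the transform, [|q h| <= 1/2]. *)
have e0 : 0 < (2 * (1 + `|q|))^-1 by rewrite invr_gt0 mulr_gt0 // ltr_pwDl.
have [r' hr'] := stieltjes_small cnu e0.
exists (Num.max `|r| r') => x; rewrite gt_max => /andP[xr xr'] h.
have x0 : 0 < x by apply: le_lt_trans xr.
have qh : 0 < 1 - q * h.
  rewrite subr_gt0; apply: le_lt_trans (ler_norm _) _; rewrite normrM.
  apply: (@le_lt_trans _ _ ((1 + `|q|) * (2 * (1 + `|q|))^-1)).
    by apply: ler_pM => //; [rewrite lerDr|exact: hr'].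
  by rewrite invfM mulrCA mulfV ?mulr1 ?invf_lt1 ?ltr1n // gt_eqF // ltr_pwDl.
split=> //.
have := hr (Complex x 0); rewrite cabs_real (gtr0_norm x0) => /(_ (le_lt_trans (ler_norm _) xr)).
rewrite [stieltjes mu _]stieltjes_real [stieltjes nu _]stieltjes_real -/h.
rewrite (_ : 1 - Complex q 0 * Complex h 0 = Complex (1 - q * h) 0); last first.
  by congr Complex; rewrite /=; ring.
rewrite /cpow /Arg /= qh mul0r atan0 mulr0 cos0 mulr1.
by rewrite (_ : cabs _ = 1 - q * h) => [[]//|]; rewrite cabs_real gtr0_norm.
Qed.

Lemma meas_eq_stieltjes mu nu : meas_eq mu nu -> forall z, stieltjes mu z = stieltjes nu z.
Proof.
move=> e z; have ei (f : R -> R) : Rintegral mu setT f = Rintegral nu setT f.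
  by congr fine; apply: eq_measure_integral => A mA _; exact: e.
by rewrite /stieltjes !ei.
Qed.

Lemma P_rel_inj_r q mu nu nu' : q != 0 -> compact_supp mu -> compact_supp nu ->
  compact_supp nu' -> P_rel q mu nu -> P_rel q mu nu' ->
  forall n, moment nu n = moment nu' n.
Proof.
move=> q0 cmu cnu cnu' /(P_rel_real cmu cnu)[r h] /(P_rel_real cmu cnu')[r' h'].
apply: (@stieltjes_real_inj R nu nu' (Num.max r r')) => // x; rewrite gt_max => /andP[xr xr'].
have [p e] := h x xr; have [p' e'] := h' x xr'.
have /(congr1 (fun y => powR y q)) := etrans (esym e) e'.
rewrite -!powRrM div1r mulVf // !powRr1 ?(ltW p) ?(ltW p') //.
by move=> /(addrI 1)/oppr_inj/(mulfI q0).
Qed.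

Lemma P_rel_inj_l q mu mu' nu nu' : compact_supp mu -> compact_supp mu' ->
  compact_supp nu -> compact_supp nu' -> P_rel q mu nu -> P_rel q mu' nu' ->
  meas_eq nu nu' -> meas_eq mu mu'.
Proof.
move=> cmu cmu' cnu cnu' /(P_rel_real cmu cnu)[r h] /(P_rel_real cmu' cnu')[r' h'] ee.
apply: moments_unique => //.
apply: (@stieltjes_real_inj R mu mu' (Num.max r r')) => // x; rewrite gt_max => /andP[xr xr'].
have [_ e] := h x xr; have [_ e'] := h' x xr'.
by move: e; rewrite (meas_eq_stieltjes ee) -e' => /(addrI 1)/oppr_inj.
Qed.

Lemma P_gser_exists q mu : -1 < q < 1 -> compact_supp mu -> exists2 nu, compact_supp nu &
  gser (moment nu) = fcomp (gser (bmom q)) (gser (moment mu)).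
Proof.
move=> q1 cmu; have [M muM] := cmu.
pose f := fcomp (gser (bmom q)) (gser (moment mu)); pose n k := f k.+1.
have nE : gser n = f.
  by apply: fpsP => -[|k] //=; rewrite /f fcomp0.
have gn : growth n.
  rewrite growth_gser nE; apply: growth_comp => //; rewrite -growth_gser.
    exact: bmom_growth.
  exact: csupp_moment_growth.
have pn : psd n.
  by apply: (psd_mix (bmom_nnegf q1) (psd_nnegf (csupp_nnegf muM))); rewrite nE.
have n0 : n 0%N = 1.
  by rewrite /n /f fcomp1E //= moment0 mul1r.
have [nu cnu nuE] := moment_problem pn gn n0.
by exists nu => //; rewrite -/f -nE; apply: fpsP => -[|k] //=.
Qed.

(** The converse of [gser_P_rel] comes from uniqueness: the measure built from the series is related
    to [mu] too, so it has the moments of [nu]. *)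
Lemma P_rel_gser q mu nu : q != 0 -> -1 < q < 1 -> compact_supp mu -> compact_supp nu ->
  P_rel q mu nu -> gser (moment nu) = fcomp (gser (bmom q)) (gser (moment mu)).
Proof.
move=> q0 q1 cmu cnu h; have [nu' cnu' e] := P_gser_exists q1 cmu.
have h' := gser_P_rel q0 cmu cnu' e; rewrite -e; apply: fpsP => -[|n] //=.
exact: (P_rel_inj_r q0 cmu cnu cnu' h h').
Qed.

Lemma P_exists q mu : q != 0 -> -1 < q < 1 -> compact_supp mu ->
  exists nu, [/\ compact_supp nu, P_rel q mu nu &
    forall nu', compact_supp nu' -> P_rel q mu nu' -> meas_eq nu' nu].
Proof.
move=> q0 q1 cmu; have [nu cnu e] := P_gser_exists q1 cmu.
have h := gser_P_rel q0 cmu cnu e; exists nu; split => // nu' cnu' h'.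
by apply: moments_unique => // n; exact: (P_rel_inj_r q0 cmu cnu' cnu h' h).
Qed.

Lemma free_conv_measure mu nu : compact_supp mu -> compact_supp nu ->
  exists2 rho, compact_supp rho & is_free_conv rho mu nu.
Proof.
move=> cmu cnu; have [M muM] := cmu; have [M' nuM] := cnu.
have [s gs es] := strip_exists (moment0 mu) (csupp_moment_growth cmu).
have [s' gs' es'] := strip_exists (moment0 nu) (csupp_moment_growth cnu).
have ps := strip_psd (psd_nnegf (csupp_nnegf muM)) (moment0 mu) es.
have ps' := strip_psd (psd_nnegf (csupp_nnegf nuM)) (moment0 nu) es'.
have [m [m0 pm gm km]] := free_conv_exists (moment0 mu) (moment0 nu)
  (csupp_moment_growth cmu) gs gs' (csupp_nnegf muM) (psd_growth_nnegf ps gs)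
  (psd_growth_nnegf ps' gs') es es'.
have [rho crho e] := moment_problem pm gm m0.
exists rho => // n _; rewrite /free_cumulant -km; congr free_cumulant_seq.
exact/funext.
Qed.

Lemma is_free_convE rho mu nu : is_free_conv rho mu nu ->
  free_cumulant_seq (moment rho) =
  (free_cumulant_seq (moment mu) : fps) + (free_cumulant_seq (moment nu) : fps).
Proof.
move=> h; apply: fpsP => -[|n]; first by rewrite fpsDE /free_cumulant_seq /= addr0.
by rewrite fpsDE; exact: h.
Qed.

(** [gam] is the compositional inverse of the beta series, hence independent of the measures. The
    identity [X = gam (1 + C_beta)] is recorded because it absorbs the shift in the second
    relation. *)
Lemma P_cumulant q : q != 0 -> -1 < q < 1 -> exists2 gam : fps,
  gam 0%N = 0 /\ fpsX = gam * (1 + (free_cumulant_seq (bmom q) : fps)) &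
  forall mu nu, compact_supp mu -> compact_supp nu -> P_rel q mu nu ->
  free_cumulant_seq (moment nu) = (free_cumulant_seq (bmom q) : fps) +
    (1 + (free_cumulant_seq (bmom q) : fps)) * fcomp (free_cumulant_seq (moment mu)) gam.
Proof.
move=> q0 q1; have b0 : bmom q 0%N = 1 by [].
have [gam [[g0 _] gb bg]] := fcomp_inverse (gser_ord1 b0).
exists gam.
  split=> //; have := congr1 (fun f => fcomp f gam) (cumulant_eq b0).
  rewrite bg fcompM // fcompX // fcompD fcomp1 fcompA // bg fcompXr.
  by move=> ->.
move=> mu nu cmu cnu /(P_rel_gser q0 q1 cmu cnu) e.
exact: (cumulant_comp (moment0 mu) (moment0 nu) b0 e g0 gb bg).
Qed.

Lemma beta_cumulantE q n : -1 < q < 1 -> beta_cumulant q n = free_cumulant_seq (bmom q) n.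
Proof.
move=> q1; rewrite /beta_cumulant; congr free_cumulant_seq.
by apply/funext=> k; exact: beta_moment_bmom.
Qed.

(** Subtracting the beta cumulants from the affine formula of [P_cumulant] leaves an expression
    linear in the cumulants of the source measure, so sums are preserved. *)
Lemma P_qconv q nu1 nu2 p1 p2 rho prho : q != 0 -> -1 < q < 1 ->
  compact_supp nu1 -> compact_supp nu2 -> compact_supp p1 -> compact_supp p2 ->
  P_rel q nu1 p1 -> P_rel q nu2 p2 ->
  compact_supp rho -> is_free_conv rho nu1 nu2 ->
  compact_supp prho -> P_rel q rho prho -> is_qconv q prho p1 p2.
Proof.
move=> q0 q1 c1 c2 d1 d2 h1 h2 crho fc cp hp n _.
have [gam _ E] := P_cumulant q0 q1.
rewrite beta_cumulantE // /free_cumulant (E _ _ crho cp hp) (E _ _ c1 d1 h1) (E _ _ c2 d2 h2).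
rewrite (is_free_convE fc) fcompD mulrDr !fpsDE.
by ring.
Qed.

(** * Images of measures under the reflections x |-> b - x *)

Lemma refl_measurable b : measurable_fun setT (fun x : R => b - x).
Proof. exact: measurable_funB. Qed.

Definition refl_fun b : {mfun measurableTypeR R >-> measurableTypeR R} :=
  MeasurableFun.Pack (MeasurableFun.Class (isMeasurableFun.Build _ _
    (measurableTypeR R) (measurableTypeR R) (fun x : R => b - x)
    (refl_measurable b))).

Definition refl b mu : prob := distribution mu (refl_fun b).

Lemma reflE b mu (A : set R) : refl b mu A = mu [set x | A (b - x)].
Proof. by []. Qed.

Lemma norm_set_measurable (M b : R) : measurable [set x : R | M < `|b - x|].
Proof.
rewrite -[X in measurable X]setTI.
rewrite (_ : [set x | _] = (fun x => `|b - x|) @^-1` `]M, +oo[); last first.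
  by apply/seteqP; split=> x /=; rewrite in_itv /= andbT.
have : measurable_fun setT (fun x : R => `|b - x|).
  by apply: measurableT_comp => //; exact: measurable_funB.
by apply.
Qed.

Lemma refl_supp b mu (M : R) : mu [set x : R | M < `|x|] = 0%E ->
  refl b mu [set x : R | M + `|b| < `|x|] = 0%E.
Proof.
move=> muM; rewrite reflE /=.
apply: (@subset_measure0 _ _ _ mu _ [set x : R | M < `|x|]) => //.
- exact: norm_set_measurable.
- have := norm_set_measurable M 0.
  by rewrite (_ : [set x : R | M < `|0 - x|] = [set x : R | M < `|x|]) //; apply/seteqP; split=> x /=; rewrite sub0r normrN.
- move=> x /= h; have := ler_normB b x; lra.
Qed.

Lemma refl_csupp b mu : compact_supp mu -> compact_supp (refl b mu).
Proof. by move=> [M /(refl_supp b)]; exists (M + `|b|). Qed.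

Lemma refl_integral b mu (f : R -> R) : measurable_fun setT f ->
  mu.-integrable setT (EFin \o (fun x => f (b - x))) ->
  Rintegral (refl b mu) setT f = Rintegral mu setT (fun x => f (b - x)).
Proof.
move=> mf fi; congr fine; rewrite integral_distribution //.
exact/measurable_EFinP.
Qed.

Lemma refl_moment b mu n : compact_supp mu -> moment (refl b mu) n =
  \sum_(k < n.+1) 'C(n, k)%:R * (-1) ^+ k * b ^+ (n - k) * moment mu k.
Proof.
move=> [M muM].
have e x : (b - x) ^+ n = \sum_(k < n.+1) ('C(n, k)%:R * (-1) ^+ k * b ^+ (n - k)) * x ^+ k.
  rewrite exprBn; apply: eq_bigr => i _; rewrite -mulr_natl; ring.
rewrite /moment refl_integral.
- under eq_Rintegral do rewrite e.
  exact: (csupp_moment_sum muM (fun k => 'C(n, k)%:R * (-1) ^+ k * b ^+ (n - k))).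
- exact: measurable_funX.
- have := csupp_horner_integrable muM (\poly_(k < n.+1) ('C(n, k)%:R * (-1) ^+ k * b ^+ (n - k))).
  by under eq_fun do rewrite horner_poly -e.
Qed.

Lemma refl_stieltjes b mu (M : R) z : mu [set x : R | M < `|x|] = 0%E ->
  2 * `|M| < cabs (Complex b 0 - z) ->
  stieltjes (refl b mu) z = - stieltjes mu (Complex b 0 - z).
Proof.
move=> muM zM.
have e t : (z - Complex (b - t) 0)^-1 = - (Complex b 0 - z - Complex t 0)^-1.
  rewrite -invrN; congr (_^-1); case: z {zM} => [x y].
  by congr Complex; rewrite /=; ring.
have MM t : `|t| <= M -> `|t| <= `|M| by move=> /le_trans; apply; exact: ler_norm.
have [mR mI] := resolvent_measurable (Complex b 0 - z).
have [mR' mI'] := resolvent_measurable z.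
have [iR iI] : mu.-integrable setT (EFin \o fun t => complex.Re (Complex b 0 - z - Complex t 0)^-1) /\
    mu.-integrable setT (EFin \o fun t => complex.Im (Complex b 0 - z - Complex t 0)^-1).
  split; apply: (csupp_integrable (B := 2 * cabs (Complex b 0 - z)^-1) muM) => // t /MM tM;
    have [_ h] := resolvent_bound (normr_ge0 M) zM tM; apply: le_trans h.
    exact: norm_Re_le.
  exact: norm_Im_le.
have ReN u : complex.Re (- u) = -1 * complex.Re u by case: u => [x y]; rewrite mulN1r.
have ImN u : complex.Im (- u) = -1 * complex.Im u by case: u => [x y]; rewrite mulN1r.
have iRe : mu.-integrable setT (EFin \o fun t => complex.Re (z - Complex (b - t) 0)^-1).
  under eq_fun do rewrite e ReN.
  by have := integrableZl measurableT (-1) iR; apply: eq_integrable.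
have iIm : mu.-integrable setT (EFin \o fun t => complex.Im (z - Complex (b - t) 0)^-1).
  under eq_fun do rewrite e ImN.
  by have := integrableZl measurableT (-1) iI; apply: eq_integrable.
rewrite /stieltjes (refl_integral (f := fun t => complex.Re (z - Complex t 0)^-1)) //.
rewrite (refl_integral (f := fun t => complex.Im (z - Complex t 0)^-1)) //.
rewrite -[RHS]mulN1r; under eq_Rintegral do rewrite e ReN.
under [X in Complex _ X]eq_Rintegral do rewrite e ImN.
rewrite !RintegralZl //; congr Complex; rewrite /= ?mulN1r; ring.
Qed.

End MarkovKreinRelation.

(** * The relation Q *)

Section ReflectedRelation.
Variable R : realType.
Local Notation prob := (probability (measurableTypeR R) R).
Local Notation fps := (fps R).
Implicit Types (mu nu rho lam : prob) (z w : R[i]) (q b c x t : R).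

Lemma cabsN z : cabs (- z) = cabs z.
Proof. by case: z => [x y]; rewrite /cabs /= !sqrrN. Qed.

(** An equality of propositions at a single point, so that it rewrites in both directions; the point
    moves from [z] to [-z], which leaves the condition of large modulus unchanged. *)
Lemma Q_rel_pointwise q mu lam : compact_supp mu -> compact_supp lam ->
  exists r0 : R, forall z, r0 < cabs z ->
  (1 - stieltjes (refl (-1) mu) z =
     cpow (1 - Complex (- q) 0 * stieltjes (refl 0 lam) z) (1 / (- q))) =
  (1 + stieltjes mu (- z - 1) = cpow (1 - Complex q 0 * stieltjes lam (- z)) (- (1 / q))).
Proof.
move=> [M muM] [M' lamM]; exists (1 + 2 * `|M| + 2 * `|M'|) => z zr.
have [P1 P2] : 0 <= `|M| /\ 0 <= `|M'| by rewrite !normr_ge0.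
have e1 : Complex (-1) 0 - z = - z - 1.
  by case: z {zr} => [x y]; congr Complex; rewrite /=; ring.
have e0 : Complex 0 0 - z = - z by rewrite (_ : Complex 0 0 = 0) // sub0r.
have h : cabs z <= cabs (- z - 1) + 1.
  rewrite -(cabsN z) -[X in _ <= _ + X](normr1 R) -cabs_real !cabsE.
  by rewrite -[X in Normc.normc X <= _](subrK (Complex 1 0)) le_normcD.
rewrite (refl_stieltjes muM) ?e1; last by lra.
rewrite (refl_stieltjes lamM) ?e0 ?cabsN; last by lra.
rewrite opprK (_ : Complex (- q) 0 = - Complex q 0); last by congr Complex; rewrite /= oppr0.
by rewrite mulrNN invrN mulrN.
Qed.

Lemma Q_relE q mu lam : compact_supp mu -> compact_supp lam ->
  Q_rel q mu lam <-> P_rel (- q) (refl (-1) mu) (refl 0 lam).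
Proof.
move=> cmu clam; have [r0 e] := Q_rel_pointwise q cmu clam.
split=> -[r h]; exists (Num.max r r0) => z; rewrite gt_max => /andP[zr zr0].
  by rewrite e //; apply: h; rewrite cabsN.
have := h (- z); rewrite e cabsN // => /(_ zr).
by rewrite opprK.
Qed.

Lemma refl_meas_eq b mu nu : meas_eq mu nu -> meas_eq (refl b mu) (refl b nu).
Proof. by move=> e A mA; apply: e; rewrite -[X in measurable X]setTI; exact: refl_measurable. Qed.

Lemma reflK b mu (A : set R) : refl b (refl b mu) A = mu A.
Proof.
rewrite reflE reflE; congr (mu _); apply/seteqP.
by split=> x /=; rewrite subKr.
Qed.

Lemma refl_meas_inj b mu nu : meas_eq (refl b mu) (refl b nu) -> meas_eq mu nu.
Proof. by move=> /(refl_meas_eq b) e A /e; rewrite !reflK. Qed.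

Lemma Q_exists q mu : q != 0 -> -1 < q < 1 -> compact_supp mu ->
  exists lam, [/\ compact_supp lam, Q_rel q mu lam &
    forall lam', compact_supp lam' -> Q_rel q mu lam' -> meas_eq lam' lam].
Proof.
move=> q0 q1 cmu; have cmu' := refl_csupp (-1) cmu.
have q0' : - q != 0 by rewrite oppr_eq0.
have q1' : -1 < - q < 1 by move/andP: q1 => [? ?]; apply/andP; split; lra.
have [nu [cnu h u]] := P_exists q0' q1' cmu'.
have clam := refl_csupp 0 cnu.
exists (refl 0 nu); split=> //.
  apply/(Q_relE _ cmu clam); have [r hr] := h; exists r => z zr.
  rewrite hr //; congr (cpow (1 - _ * _) _); apply: meas_eq_stieltjes => A _.
  by rewrite reflK.
move=> lam' clam' /(Q_relE _ cmu clam') h'.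
apply: (@refl_meas_inj 0) => A mA; rewrite reflK.
exact: (u _ (refl_csupp 0 clam') h').
Qed.

Lemma Q_rel_inj_l q mu mu' lam lam' : compact_supp mu -> compact_supp mu' ->
  compact_supp lam -> compact_supp lam' -> Q_rel q mu lam -> Q_rel q mu' lam' ->
  meas_eq lam lam' -> meas_eq mu mu'.
Proof.
move=> c1 c2 d1 d2 /(Q_relE _ c1 d1) h1 /(Q_relE _ c2 d2) h2 /(refl_meas_eq 0) e.
apply: (@refl_meas_inj (-1)).
exact: (P_rel_inj_l (refl_csupp _ c1) (refl_csupp _ c2) (refl_csupp _ d1) (refl_csupp _ d2) h1 h2 e).
Qed.

(** The reflection about [-1] adds [- X] to the cumulant series of [nu], and [(1 + C_beta) gam = X]
    returns this as [- X]. It cancels the [+ X] that appears when the beta law for [-q] is expressed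
    through the one for [q], and what remains is linear in the cumulants of [nu]. *)
Lemma Q_cumulant q : q != 0 -> -1 < q < 1 -> exists gam : fps, forall nu lam n,
  compact_supp nu -> compact_supp lam -> Q_rel q nu lam ->
  free_cumulant lam n = beta_cumulant q n + (-1) ^+ n *
    ((1 + (free_cumulant_seq (bmom (- q)) : fps)) *
     fcomp (fcomp (free_cumulant_seq (moment nu)) (- fpsX)) gam) n.
Proof.
move=> q0 q1.
have q0' : - q != 0 by rewrite oppr_eq0.
have q1' : -1 < - q < 1 by move/andP: q1 => [? ?]; apply/andP; split; lra.
have [gam [g0 gX] E] := P_cumulant q0' q1'.
exists gam => nu lam n cnu clam /(Q_relE _ cnu clam) h.
have := E _ _ (refl_csupp _ cnu) (refl_csupp _ clam) h.
have -> : free_cumulant_seq (moment (refl (-1) nu)) =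
    fcomp (free_cumulant_seq (moment nu)) (- fpsX) - fpsX.
  apply: fpsP => k; rewrite fpsDE fpsNE fcomp_oppX.
  rewrite (cumulant_reflect (moment0 nu) (fun n => refl_moment (-1) n cnu)) mulN1r.
  by congr (_ - _); rewrite /fpsX; case: k => [|[|k]].
rewrite fcompD fcompN fcompX // => /(congr1 (fun f => f n)).
rewrite mulrDr mulrN [_ * gam]mulrC -gX !fpsDE fpsNE.
rewrite (cumulant_reflect (moment0 lam) (fun n => refl_moment 0 n clam)) mul0r addr0.
rewrite (@cumulant_reflect R (bmom q) (bmom (- q)) 1 erefl (bmom_reflect q) n) mul1r.
rewrite (_ : fpsX n = (n == 1)%N%:R :> R); last by rewrite /fpsX; case: n => [|[|n]].
rewrite beta_cumulantE // /free_cumulant.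
set x := free_cumulant_seq (moment lam) n; set y := free_cumulant_seq (bmom q) n.
set d := (n == 1)%N%:R => e.
by rewrite -[LHS](signrMK n) e -addrA (addrC d) subrK mulrDr signrMK.
Qed.

Lemma Q_qconv q nu1 nu2 l1 l2 rho lrho : q != 0 -> -1 < q < 1 ->
  compact_supp nu1 -> compact_supp nu2 -> compact_supp l1 -> compact_supp l2 ->
  Q_rel q nu1 l1 -> Q_rel q nu2 l2 ->
  compact_supp rho -> is_free_conv rho nu1 nu2 ->
  compact_supp lrho -> Q_rel q rho lrho -> is_qconv q lrho l1 l2.
Proof.
move=> q0 q1 c1 c2 d1 d2 h1 h2 crho fc cl hl n _.
have [gam E] := Q_cumulant q0 q1.
rewrite (E _ _ n crho cl hl) (E _ _ n c1 d1 h1) (E _ _ n c2 d2 h2).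
rewrite (is_free_convE fc) !fcompD [(1 + _) * (_ + _)]mulrDr fpsDE; ring.
Qed.

End ReflectedRelation.

Theorem theorem30 (R : realType) (q : R) :
  ((-1 < q < 0) \/ (0 < q < 1)) ->
  (* existence and uniqueness of nu = P(mu) *)
  (forall mu : probability (measurableTypeR R) R, compact_supp mu ->
     exists nu : probability (measurableTypeR R) R,
       [/\ compact_supp nu, P_rel q mu nu &
           forall nu' : probability (measurableTypeR R) R,
             compact_supp nu' -> P_rel q mu nu' -> meas_eq nu' nu]) /\
  (* existence and uniqueness of lam = Q(mu) *)
  (forall mu : probability (measurableTypeR R) R, compact_supp mu ->
     exists lam : probability (measurableTypeR R) R,
       [/\ compact_supp lam, Q_rel q mu lam &
           forall lam' : probability (measurableTypeR R) R,
             compact_supp lam' -> Q_rel q mu lam' -> meas_eq lam' lam]) /\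
  (* injectivity of P *)
  (forall mu1 mu2 nu1 nu2 : probability (measurableTypeR R) R,
     compact_supp mu1 -> compact_supp mu2 -> compact_supp nu1 -> compact_supp nu2 ->
     P_rel q mu1 nu1 -> P_rel q mu2 nu2 -> meas_eq nu1 nu2 -> meas_eq mu1 mu2) /\
  (* injectivity of Q *)
  (forall mu1 mu2 lam1 lam2 : probability (measurableTypeR R) R,
     compact_supp mu1 -> compact_supp mu2 -> compact_supp lam1 -> compact_supp lam2 ->
     Q_rel q mu1 lam1 -> Q_rel q mu2 lam2 -> meas_eq lam1 lam2 -> meas_eq mu1 mu2) /\
  (* P(nu1) ⊗_q P(nu2) exists and equals P(nu1 ⊞ nu2) *)
  (forall nu1 nu2 p1 p2 : probability (measurableTypeR R) R,
     compact_supp nu1 -> compact_supp nu2 -> compact_supp p1 -> compact_supp p2 ->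
     P_rel q nu1 p1 -> P_rel q nu2 p2 ->
     (exists rho : probability (measurableTypeR R) R,
        compact_supp rho /\ is_qconv q rho p1 p2) /\
     (forall rho prho : probability (measurableTypeR R) R,
        compact_supp rho -> is_free_conv rho nu1 nu2 ->
        compact_supp prho -> P_rel q rho prho -> is_qconv q prho p1 p2)) /\
  (* Q(nu1) ⊗_q Q(nu2) exists and equals Q(nu1 ⊞ nu2) *)
  (forall nu1 nu2 l1 l2 : probability (measurableTypeR R) R,
     compact_supp nu1 -> compact_supp nu2 -> compact_supp l1 -> compact_supp l2 ->
     Q_rel q nu1 l1 -> Q_rel q nu2 l2 ->
     (exists rho : probability (measurableTypeR R) R,
        compact_supp rho /\ is_qconv q rho l1 l2) /\
     (forall rho qrho : probability (measurableTypeR R) R,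
        compact_supp rho -> is_free_conv rho nu1 nu2 ->
        compact_supp qrho -> Q_rel q rho qrho -> is_qconv q qrho l1 l2)).
Proof.
move=> hq.
have q0 : q != 0 by case: hq => /andP[h1 h2]; [rewrite lt_eqF|rewrite gt_eqF].
have q1 : -1 < q < 1 by case: hq => /andP[h1 h2]; apply/andP; split; lra.
split; first by move=> mu cmu; exact: P_exists.
split; first by move=> mu cmu; exact: Q_exists.
split; first by move=> mu1 mu2 nu1 nu2 c1 c2 d1 d2; exact: P_rel_inj_l.
split; first by move=> mu1 mu2 l1 l2 c1 c2 d1 d2; exact: Q_rel_inj_l.
split=> nu1 nu2 p1 p2 c1 c2 d1 d2 h1 h2; have [rho crho fc] := free_conv_measure c1 c2.
  split; last by move=> rho' p' cr f' cp'; exact: (P_qconv q0 q1 c1 c2 d1 d2 h1 h2 cr f' cp').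
  have [p [cp hp _]] := P_exists q0 q1 crho; exists p; split=> //.
  exact: (P_qconv q0 q1 c1 c2 d1 d2 h1 h2 crho fc cp hp).
split; last by move=> rho' p' cr f' cp'; exact: (Q_qconv q0 q1 c1 c2 d1 d2 h1 h2 cr f' cp').
have [l [cl hl _]] := Q_exists q0 q1 crho; exists l; split=> //.
exact: (Q_qconv q0 q1 c1 c2 d1 d2 h1 h2 crho fc cl hl).
Qed.
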